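(* Under the condition $Mr=-c-N$ with $M\in\mathbb{Z}$, the operators $t(\beta)=\mathrm{Tr}[\mathcal{L}^{(M)}(\beta)]$ of $\mathcal{D}Y_r(sl(N))_c$ close a quadratic algebra $$t(\beta_1)\,t(\beta_2)=\mathcal{Y}_{N,r,M}(\beta_2-\beta_1)\,t(\beta_2)\,t(\beta_1),$$ where $$\mathcal{Y}_{N,r,M}(\beta)=\prod_{k=1}^{K}\frac{\sin^2\frac{i\beta-k\pi r}{N}}{\sin^2\frac{i\beta+k\pi r}{N}}\;\frac{\sin\frac{i\beta+k\pi r+\pi}{N}}{\sin\frac{i\beta-k\pi r+\pi}{N}}\;\frac{\sin\frac{i\beta+k\pi r-\pi}{N}}{\sin\frac{i\beta-k\pi r-\pi}{N}},$$ with $K=M$ if $M>0$ and $K=|M|-1$ if $M<0$ (and $\mathcal{Y}_{N,r,0}=1$).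
   Context: $N\ge2$ is an integer; $r,c$ are parameters, generic so that all functions below are defined. $R$-matrix. Put $S_2(x|\omega_1,\omega_2)=\Gamma_2(\omega_1+\omega_2-x|\omega_1,\omega_2)/\Gamma_2(x|\omega_1,\omega_2)$ with $\Gamma_2(x|\omega_1,\omega_2)=\exp\big(\frac{\partial}{\partial s}\sum_{n_1,n_2\ge0}(x+n_1\omega_1+n_2\omega_2)^{-s}|_{s=0}\big)$, and $S_0(\beta)=\frac{S_2(-\frac{i\beta}{\pi}|r,N)S_2(1+\frac{i\beta}{\pi}|r,N)}{S_2(\frac{i\beta}{\pi}|r,N)S_2(1-\frac{i\beta}{\pi}|r,N)}$. Then $R(\beta,r)=\sum_{a,b,c'\in\mathbb{Z}_N}R_{a,b}^{c',a+b-c'}(\beta,r)\,e_a^{c'}\otimes e_b^{a+b-c'}$ ($e_a^{c'}$: elementary matrix with $1$ in row $a$, column $c'$; indices modulo $N$), $$R_{a,b}^{c',a+b-c'}(\beta,r)=-\frac1N S_0(\beta)\frac{\sin\frac{i\beta+\pi+(b-a)\pi r}{Nr}}{\sin\frac{i\beta+(b-c')\pi r}{Nr}\sin\frac{\pi-(a-c')\pi r}{Nr}}\cdot\frac{\sin\frac{i\beta}{r}\sin\frac{\pi}{r}}{\sin\frac{i\beta+\pi}{r}}.$$ Set $\widehat R(\beta)=\widehat R(\beta,r)=\frac{\sin\frac{\pi-i\beta}{N}}{\sin\frac{i\beta}{N}}R(\beta,r)$ and $\widehat R^*(\beta)=\widehat R(\beta,r-c)$. $h$ is the $N\times N$ matrix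 $h_{ij}=\delta_{i+1,j}$ (indices modulo $N$). Algebra. $\mathcal{D}Y_r(gl(N))_c$ is the algebra with abstract generators the entries $L_{ij}(\beta)$ of an $N\times N$ matrix $L(\beta)$, with relations (understood at the level of generating functionals, no mode expansion being fixed) $$\widehat R_{12}(\beta_1-\beta_2)L_1(\beta_1)L_2(\beta_2)=L_2(\beta_2)L_1(\beta_1)\widehat R^*_{12}(\beta_1-\beta_2),$$ where $L_1(\beta)=L(\beta)\otimes\mathbb{I}$, $L_2(\beta)=\mathbb{I}\otimes L(\beta)$; $L(\beta)$ is taken invertible. $\mathcal{D}Y_r(sl(N))_c$ is its quotient by $q\text{-}\det L-1$, with $q\text{-}\det L(\beta)=\sum_{\sigma\in\mathfrak{S}_N}\varepsilon(\sigma)\prod_{k=1}^N L_{k,\sigma(k)}(\beta-i\pi(k-N-1))$ (central), $\varepsilon(\sigma)$ being the signature. Put $L^+(\beta)=L(\beta-\frac12 i\pi c)$, $L^-(\beta)=h\,L(\beta-i\pi r)\,h^{-1}$, and $\widetilde L^\pm(\beta)=\big(L^\pm(\beta)^{-1}\big)^t$, where $t$ is transposition of matrix indices (entries of a matrix product are multiplied in the written order). For $M\in\mathbb{Z}$, $\mathcal{L}^{(M)}(\beta)=\big(h^{-M}L^+(\beta-\frac12 i\pi c)\big)^t\,\widetilde L^-(\beta)$. *)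

(* Defs.v *)
(* The complex numbers are R[i], for R : realType. *)
From HB Require Import structures.
From mathcomp Require Import all_boot all_order all_algebra all_fingroup.
From mathcomp Require Import all_classical all_reals all_analysis.
From mathcomp Require Import complex mxtens.

Set Implicit Arguments.
Unset Strict Implicit.
Unset Printing Implicit Defensive.

Import Order.TTheory GRing.Theory Num.Theory.
Import numFieldNormedType.Exports.

Local Open Scope classical_set_scope.
Local Open Scope ring_scope.
Local Open Scope complex_scope.

Notation "A *t B" := (tensmx A B)
  (at level 40, left associativity, format "A  *t  B") : ring_scope.

(* In mathcomp-analysis, the normed space structure of the field R[i] is
   carried by its alias R[i]^o. *)

Definition cpi (R : realType) : R[i] := (pi : R)%:C.

Definition cexp (R : realType) (z : R[i]) : R[i] :=
  (expR (complex.Re z))%:C * (cos (complex.Im z) +i* sin (complex.Im z)).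

Definition csin (R : realType) (z : R[i]) : R[i] :=
  (cexp ('i%C * z) - cexp (- ('i%C * z))) / (2 * 'i%C).

Definition cmod (R : realType) (z : R[i]) : R := complex.Re `|z|.

(* Principal argument, with values in ]-pi, pi]. *)
Definition carg (R : realType) (z : R[i]) : R :=
  let a := acos (complex.Re z / cmod z) in
  if 0 <= complex.Im z then a else - a.

Definition cpow (R : realType) (z s : R[i]) : R[i] :=
  cexp (s * (ln (cmod z) +i* carg z)).

Definition analytic_at (R : realType) (f : R[i] -> R[i]) (s0 : R[i]) : Prop :=
  exists (a : nat -> R[i]) (e : R), 0 < e /\
    forall s : R[i], cmod (s - s0) < e ->
      ((fun m : nat => \sum_(k < m) a k * (s - s0) ^+ k) : nat -> R[i]^o)
        @ \oo --> (f s : R[i]^o).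

(* Z is the analytic continuation of the double zeta function
     s |-> \sum_(n1, n2 >= 0) (x + n1 w1 + n2 w2)^(-s)
   to -1 < Re s, s <> 1, 2. This region is connected, contains s = 0 and
   avoids the only poles, so the germ of Z at 0 is uniquely determined. The
   series converges absolutely for Re s > 2, hence can be summed along squares.
   The principal branch is the right one for w1 and w2 outside ]-oo, 0] with
   arguments differing by less than pi: then only finitely many of the points
   x + n1 w1 + n2 w2 may be separated from the others by the cut, and changing
   the branch of finitely many terms does not change exp(Z'(0)). *)
Definition is_zeta2 (R : realType) (x w1 w2 : R[i]) (Z : R[i] -> R[i]) : Prop :=
  (forall s : R[i], -1 < complex.Re s -> s != 1 -> s != 2 -> analytic_at Z s) /\
  (forall s : R[i], 2 < complex.Re s ->
     ((fun m : nat => \sum_(n1 < m) \sum_(n2 < m)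
         cpow (x + n1%:R * w1 + n2%:R * w2) (- s)) : nat -> R[i]^o)
       @ \oo --> (Z s : R[i]^o)).

Definition zeta2 (R : realType) (x w1 w2 : R[i]) : R[i]^o -> R[i]^o :=
  xget (fun=> 0) [set Z | is_zeta2 x w1 w2 Z].

Definition Gamma2 (R : realType) (x w1 w2 : R[i]) : R[i] :=
  cexp (derive1 (zeta2 x w1 w2) 0).

Definition S2 (R : realType) (x w1 w2 : R[i]) : R[i] :=
  Gamma2 (w1 + w2 - x) w1 w2 / Gamma2 x w1 w2.

(* From here on the integer N >= 2 is n.+2, so that 'I_n.+2 is the ring of
   integers modulo N and 'M_n.+2 a ring. The index k of 1, ..., N is k - 1. *)

Definition S0 (R : realType) (n : nat) (b r : R[i]) : R[i] :=
  let u := 'i%C * b / cpi R in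
  let N : R[i] := n.+2%:R in
  (S2 (- u) r N * S2 (1 + u) r N) / (S2 u r N * S2 (1 - u) r N).

(* For a, b, k in {0, ..., N-1}; the value only depends on a, b, k modulo N. *)
Definition Rcoef (R : realType) (n : nat) (b r : R[i]) (i j k : 'I_n.+2) : R[i] :=
  let p := cpi R in
  let N : R[i] := n.+2%:R in
  let i' : R[i] := (i : nat)%:R in
  let j' : R[i] := (j : nat)%:R in
  let k' : R[i] := (k : nat)%:R in
  - N^-1 * S0 n b r
  * (csin (('i%C * b + p + (j' - i') * p * r) / (N * r))
     / (csin (('i%C * b + (j' - k') * p * r) / (N * r))
        * csin ((p - (i' - k') * p * r) / (N * r))))
  * (csin ('i%C * b / r) * csin (p / r) / csin (('i%C * b + p) / r)).

Definition Rmat (R : realType) (n : nat) (b r : R[i]) : 'M[R[i]]_(n.+2 * n.+2) :=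
  \sum_(i < n.+2) \sum_(j < n.+2) \sum_(k < n.+2)
    Rcoef b r i j k *: (delta_mx i k *t delta_mx j (i + j - k)).

Definition Rhat (R : realType) (n : nat) (b r : R[i]) : 'M[R[i]]_(n.+2 * n.+2) :=
  let N : R[i] := n.+2%:R in
  (csin ((cpi R - 'i%C * b) / N) / csin ('i%C * b / N)) *: Rmat n b r.

Definition hmat (R : realType) (n : nat) : 'M[R[i]]_n.+2 :=
  \matrix_(i, j) (i + 1 == j)%:R.

(* Genericity of the parameters: the double Gamma functions of periods (r, N)
   and (r - c, N) exist (in R[i], x <= 0 means that x is a nonpositive real),
   and the denominators of Rcoef that do not involve the spectral parameter do
   not vanish, both for r and for r - c. *)
Definition generic_params (R : realType) (r c : R[i]) : Prop :=
  [/\ ~~ (r <= 0), ~~ (r - c <= 0),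
      forall k : int, k%:~R * r != 1
    & forall k : int, k%:~R * (r - c) != 1].

(* Genericity of a difference of spectral parameters: i b / pi avoids the
   countable group Z + Z r + Z c, which contains every zero and pole of the
   coefficient functions. *)
Definition generic_spec (R : realType) (r c b : R[i]) : Prop :=
  forall k l m : int, 'i%C * b / cpi R != k%:~R + l%:~R * r + m%:~R * c.

Definition mx_alg (R : realType) (A : algType R[i]) (p q : nat)
    (X : 'M[R[i]]_(p, q)) : 'M[A]_(p, q) :=
  map_mx (fun z => z%:A) X.
Arguments mx_alg {R} A {p q} X.

Definition is_mxinv (A : pzRingType) (m : nat) (X Y : 'M[A]_m) : Prop :=
  X *m Y = 1%:M /\ Y *m X = 1%:M.

(* invmx is restricted to matrices over commutative rings. *)
Definition mxinv (A : pzRingType) (m : nat) (X : 'M[A]_m) : 'M[A]_m :=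
  xget 0 [set Y | is_mxinv X Y].

(* (A, L) realizes the generators and relations of DY_r(gl(N))_c. *)
Definition is_DYgl (R : realType) (n : nat) (r c : R[i]) (A : algType R[i])
    (L : R[i] -> 'M[A]_n.+2) : Prop :=
  (forall b1 b2 : R[i], generic_spec r c (b1 - b2) ->
     mx_alg A (Rhat n (b1 - b2) r) *m (L b1 *t 1%:M) *m (1%:M *t L b2)
     = (1%:M *t L b2) *m (L b1 *t 1%:M) *m mx_alg A (Rhat n (b1 - b2) (r - c)))
  /\ (forall b : R[i], exists Y, is_mxinv (L b) Y).

(* With k - 1 in place of k, the shift k - N - 1 reads k - N. The factors are
   multiplied in increasing order of k. *)
Definition qdet (R : realType) (n : nat) (A : algType R[i])
    (L : R[i] -> 'M[A]_n.+2) (b : R[i]) : A :=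
  \sum_(s : 'S_n.+2) (-1) ^+ s *
    \prod_(k < n.+2) L (b - 'i%C * cpi R * ((k : nat)%:R - n.+2%:R)) k (s k).

Definition is_DYsl (R : realType) (n : nat) (r c : R[i]) (A : algType R[i])
    (L : R[i] -> 'M[A]_n.+2) : Prop :=
  is_DYgl r c L /\ (forall b : R[i], qdet L b = 1).

Definition Lplus (R : realType) (n : nat) (c : R[i]) (A : algType R[i])
    (L : R[i] -> 'M[A]_n.+2) (b : R[i]) : 'M[A]_n.+2 :=
  L (b - 2^-1 * 'i%C * cpi R * c).

Definition Lminus (R : realType) (n : nat) (r : R[i]) (A : algType R[i])
    (L : R[i] -> 'M[A]_n.+2) (b : R[i]) : 'M[A]_n.+2 :=
  mx_alg A (hmat R n) *m L (b - 'i%C * cpi R * r) *m mx_alg A (hmat R n)^-1.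

Definition Lminus_tilde (R : realType) (n : nat) (r : R[i]) (A : algType R[i])
    (L : R[i] -> 'M[A]_n.+2) (b : R[i]) : 'M[A]_n.+2 :=
  (mxinv (Lminus r L b))^T.

Definition LM (R : realType) (n : nat) (r c : R[i]) (M : int) (A : algType R[i])
    (L : R[i] -> 'M[A]_n.+2) (b : R[i]) : 'M[A]_n.+2 :=
  (mx_alg A (hmat R n ^ (- M)) *m Lplus c L (b - 2^-1 * 'i%C * cpi R * c))^T
  *m Lminus_tilde r L b.

Definition tM (R : realType) (n : nat) (r c : R[i]) (M : int) (A : algType R[i])
    (L : R[i] -> 'M[A]_n.+2) (b : R[i]) : A :=
  \tr (LM r c M L b).

Definition Kbound (M : int) : nat :=
  if 0 < M then `|M|%N else (`|M|%N).-1.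

Definition Yfun (R : realType) (n : nat) (r : R[i]) (M : int) (b : R[i]) : R[i] :=
  let p := cpi R in
  let N : R[i] := n.+2%:R in
  let z := 'i%C * b in
  \prod_(1 <= k < (Kbound M).+1)
    ((csin ((z - k%:R * p * r) / N) ^+ 2 / csin ((z + k%:R * p * r) / N) ^+ 2)
     * (csin ((z + k%:R * p * r + p) / N) / csin ((z - k%:R * p * r + p) / N))
     * (csin ((z + k%:R * p * r - p) / N) / csin ((z - k%:R * p * r - p) / N))).

(* Main.v *)
Require Import Defs.
From HB Require Import structures.
From mathcomp Require Import all_boot all_order all_algebra all_fingroup.
From mathcomp Require Import all_classical all_reals all_analysis.
From mathcomp Require Import complex mxtens ring lra.

Set Implicit Arguments.
Unset Strict Implicit.
Unset Printing Implicit Defensive.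

Import Order.TTheory GRing.Theory Num.Theory.
Import numFieldNormedType.Exports.

Local Open Scope classical_set_scope.
Local Open Scope ring_scope.
Local Open Scope complex_scope.

(** Put N = n.+2, rs = r - c and x = i (b1 - b2) / pi. By the addition formula
for the sine, the R-matrix of parameter r is a scalar function of x times the
matrix [Rtrig r x], whose nonzero entries are sums of two cotangents. The proof
rests on three properties of this matrix, the last two of which come down to
sums of products of cotangents over the residues modulo N:
- quasi-periodicity ([Rtrig_quasi]): subtracting r from x amounts to conjugating
  by h on the first tensor factor;
- unitarity ([Rtrig_unitary]): up to a scalar, the inverse is
  [Rtrig_inv r x] = R_21(-x);
- crossing ([Rtrig_crossing]): up to a scalar, the partial transposes of
  [Rtrig r x] and [Rtrig_inv r (x + N)] are inverse to each other.

Cyclicity of the trace under matrices of scalars gives t(b) = Tr(T(u)) for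
u = b - i pi r, T(u) = Lbar(u) L(u)^-1 and
Lbar(u) = h^(-M-1) L(u + i pi rs) h ([tM_trace]). The condition M r = - c - N
says that rs = (M + 1) r + N. Hence, in the defining relation taken at arguments
shifted by i pi rs, quasi-periodicity absorbs the shift of the right-hand matrix
(of parameter rs) completely, and that of the left-hand matrix up to a shift by
N: the pairs (L, L), (Lbar, L), (L, Lbar) and (Lbar, Lbar) obey relations with
R(x), R(x - N), R(x + N) and R(x) on the left, and with the same matrix on the
right ([exchange0] to [exchange3]). Eliminating the latter yields
  T_1 R(x + N)^-1 T_2 = R(x)^-1 T_2 R(x - N) T_1 R(x)^-1
up to a scalar ([exchange_ring]). After multiplication by R(x), crossing
separates the trace of either side into a product of two traces ([trace_fuse],
[trace_fuse_sym]), so t(b1) t(b2) is a scalar multiple of t(b2) t(b1).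

The scalar is made of unitarity constants and of values of the scalar factors of
the R-matrices at x and at x +- rs. It follows from the behaviour of these
factors under x -> x + r and x -> x + N ([Rfactor_shift], [Rfactor_shiftN],
[critical_scalar]), that is, from the difference equation of the double sine
  S2(x + w1) sin(pi x / w2) = K S2(x)  with K independent of x ([S2_shift]).

This equation is derived from the definition of Gamma2 by a zeta function.
- The partial sums of the double zeta series over squares, corrected by terms of
  Euler-Maclaurin type, converge locally uniformly for Re s > -1 away from the
  poles ([good_seq2]). The limit is one analytic continuation, and the identity
  theorem along a segment shows that every continuation has the same germ at 0
  ([Gamma2E]).
- Summation by differences gives Gamma2(x) = Gamma1(x) Gamma2(x + w1), where
  Gamma1 comes from the simple zeta function of period w2 ([Gamma2_shift]).
- The product Gamma1(x) Gamma1(w - x) sin(pi x / w) does not depend on x, because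
  Gamma1 is a limit of explicit products that match Euler's product for the sine
  ([Gamma1_reflection], [euler_sine]). *)

(** * Modulus and exponential of complex numbers *)

Section ComplexBasics.
Variable R : realType.
Notation C := R[i].
Implicit Types (z w : C) (x y : R).

Lemma cmodC z : (cmod z)%:C = `|z|.
Proof. by rewrite /cmod normc_def. Qed.

Lemma cmodE z : cmod z = Num.sqrt (complex.Re z ^+ 2 + complex.Im z ^+ 2).
Proof. by rewrite /cmod normc_def. Qed.

Lemma cmod_ge0 z : 0 <= cmod z.
Proof. by rewrite cmodE sqrtr_ge0. Qed.

Lemma cmod0 : cmod (0 : C) = 0.
Proof. by apply: complexI; rewrite cmodC normr0. Qed.

Lemma cmod1 : cmod (1 : C) = 1.
Proof. by apply: complexI; rewrite cmodC normr1. Qed.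

Lemma cmod_eq0 z : (cmod z == 0) = (z == 0).
Proof. by rewrite -(inj_eq (@complexI R)) cmodC normr_eq0. Qed.

Lemma cmod_gt0 z : (0 < cmod z) = (z != 0).
Proof. by rewrite lt_def cmod_ge0 andbT cmod_eq0. Qed.

Lemma cmodM z w : cmod (z * w) = cmod z * cmod w.
Proof. by apply: complexI; rewrite rmorphM /= !cmodC normrM. Qed.

Lemma cmodN z : cmod (- z) = cmod z.
Proof. by apply: complexI; rewrite !cmodC normrN. Qed.

Lemma cmodB z w : cmod (z - w) = cmod (w - z).
Proof. by rewrite -opprB cmodN. Qed.

Lemma cmodV z : cmod z^-1 = (cmod z)^-1.
Proof. by apply: complexI; rewrite fmorphV /= !cmodC normfV. Qed.

Lemma cmodX z k : cmod (z ^+ k) = cmod z ^+ k.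
Proof. by apply: complexI; rewrite rmorphXn /= !cmodC normrX. Qed.

Lemma cmodD z w : cmod (z + w) <= cmod z + cmod w.
Proof. by rewrite -lecR rmorphD /= !cmodC ler_normD. Qed.

Lemma cmodD3 z w v : cmod (z + w + v) <= cmod z + cmod w + cmod v.
Proof. by apply: le_trans (cmodD _ _) _; rewrite lerD2r cmodD. Qed.

Lemma cmod_subD z w v : cmod (z - w) <= cmod (z - v) + cmod (v - w).
Proof. by apply: le_trans (cmodD _ _); rewrite addrA subrK. Qed.

Lemma cmod_leD z w : cmod z - cmod w <= cmod (z + w).
Proof. by move: (cmodD (z + w) (- w)); rewrite addrK cmodN lerBlDr. Qed.

Lemma cmodR x : cmod x%:C = `|x|.
Proof. by rewrite cmodE /= expr0n addr0 sqrtr_sqr. Qed.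

Lemma cmod_nat k : cmod (k%:R : C) = k%:R.
Proof. by rewrite -(rmorph_nat (real_complex R)) cmodR normr_nat. Qed.

Lemma cmod_sum (I : Type) (r : seq I) (P : pred I) (F : I -> C) :
  cmod (\sum_(i <- r | P i) F i) <= \sum_(i <- r | P i) cmod (F i).
Proof.
elim/big_rec2: _ => [|i y1 y2 _ le]; first by rewrite cmod0.
by apply: le_trans (cmodD _ _) _; rewrite lerD2l.
Qed.

Lemma Re_le_cmod z : `|complex.Re z| <= cmod z.
Proof. by rewrite -lecR cmodC normc_ge_Re. Qed.

Lemma ImE z : complex.Im z = complex.Re (- ('i%C * z)).
Proof. by case: z => a b /=; rewrite mul0r mul1r sub0r opprK. Qed.

Lemma cmod_i : cmod ('i%C : C) = 1.
Proof. by rewrite cmodE /= expr0n add0r expr1n sqrtr1. Qed.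

Lemma Im_le_cmod z : `|complex.Im z| <= cmod z.
Proof. by rewrite ImE; apply: le_trans (Re_le_cmod _) _; rewrite cmodN cmodM cmod_i mul1r. Qed.

Lemma cmod_le_ReIm z : cmod z <= `|complex.Re z| + `|complex.Im z|.
Proof.
rewrite {1}[z]complexE; apply: le_trans (cmodD _ _) _.
by rewrite cmodM cmod_i mul1r !cmodR.
Qed.

Lemma ReD z w : complex.Re (z + w) = complex.Re z + complex.Re w.
Proof. by case: z => ? ?; case: w. Qed.
Lemma ImD z w : complex.Im (z + w) = complex.Im z + complex.Im w.
Proof. by case: z => ? ?; case: w. Qed.
Lemma ReN z : complex.Re (- z) = - complex.Re z. Proof. by case: z. Qed.
Lemma ImN z : complex.Im (- z) = - complex.Im z. Proof. by case: z. Qed.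
Lemma ReM z w : complex.Re (z * w) =
  complex.Re z * complex.Re w - complex.Im z * complex.Im w.
Proof. by case: z => ? ?; case: w. Qed.
Lemma ImM z w : complex.Im (z * w) =
  complex.Re z * complex.Im w + complex.Im z * complex.Re w.
Proof. by case: z => ? ?; case: w. Qed.

Lemma complex_ext z w : complex.Re z = complex.Re w ->
  complex.Im z = complex.Im w -> z = w.
Proof. by case: z => ? ?; case: w => ? ? /= -> ->. Qed.

Lemma cexpD z w : cexp (z + w) = cexp z * cexp w.
Proof.
case: z => a b; case: w => c d; rewrite /cexp /= expRD cosD sinD.
apply: complex_ext => /=; ring.
Qed.

Lemma cexp0 : cexp (0 : C) = 1.
Proof. by rewrite /cexp /= expR0 cos0 sin0 mul1r. Qed.

Lemma cexpNM z : cexp (- z) * cexp z = 1.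
Proof. by rewrite -cexpD addNr cexp0. Qed.

Lemma cexp_neq0 z : cexp z != 0.
Proof.
by apply/negP => /eqP e; move: (cexpNM z); rewrite e mulr0 => /eqP; rewrite eq_sym oner_eq0.
Qed.

Lemma cexpN z : cexp (- z) = (cexp z)^-1.
Proof. by apply: (mulIf (cexp_neq0 z)); rewrite cexpNM mulVf ?cexp_neq0. Qed.

Lemma cexpB z w : cexp (z - w) = cexp z / cexp w.
Proof. by rewrite cexpD cexpN. Qed.

Lemma cexp_sum (I : Type) (r : seq I) (P : pred I) (F : I -> C) :
  cexp (\sum_(i <- r | P i) F i) = \prod_(i <- r | P i) cexp (F i).
Proof. by elim/big_rec2: _ => [|i y1 y2 _ <-]; rewrite ?cexp0 ?cexpD. Qed.

Lemma cexpMn z k : cexp (z *+ k) = cexp z ^+ k.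
Proof. by elim: k => [|k IH]; rewrite ?cexp0 // mulrS exprS cexpD IH. Qed.

Lemma cmod_cis x : cmod (cos x +i* sin x) = 1.
Proof. by rewrite cmodE /= cos2Dsin2 sqrtr1. Qed.

Lemma cmod_cexp z : cmod (cexp z) = expR (complex.Re z).
Proof. by rewrite /cexp cmodM cmodR cmod_cis mulr1 ger0_norm ?expR_ge0. Qed.

Lemma cmod_cexp_le z : cmod (cexp z) <= expR (cmod z).
Proof. by rewrite cmod_cexp ler_expR (le_trans (ler_norm _) (Re_le_cmod _)). Qed.

Lemma cexp_i x : cexp ('i%C * x%:C) = cos x +i* sin x.
Proof.
have -> : 'i%C * x%:C = 0 +i* x by apply: complex_ext; rewrite ?ReM ?ImM /=; ring.
by rewrite /cexp /= expR0 mul1r.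
Qed.

End ComplexBasics.

(** * Limits of complex sequences *)

Section Limits.
Variable R : realType.
Notation C := R[i].
Implicit Types (u v : nat -> C) (l : C).

(** The norm of R[i] takes its values in R[i]; with the real-valued [cmod], limits can be
handled by inequalities in R. *)
Definition climit u l := forall e : R, 0 < e ->
  exists N, forall n, (N <= n)%N -> cmod (u n - l) < e.

Lemma climitP u l : ((u : nat -> C^o) @ \oo --> (l : C^o)) <-> climit u l.
Proof.
split=> [/cvgrPdist_lt h e e0|h].
  have /h [N _ hN] : 0 < e%:C :> C by rewrite ltcR.
  exists N => n Nn; rewrite -ltcR cmodC distrC; exact: hN.
apply/cvgrPdist_lt => e e0.
have eR : e = (complex.Re e)%:C by rewrite RRe_real ?gtr0_real.
have [|N hN] := h (complex.Re e); first by rewrite -ltcR -eR.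
by exists N => // n /hN; rewrite eR -ltcR cmodC distrC.
Qed.

Lemma climit_cst l : climit (fun=> l) l.
Proof. by move=> e e0; exists 0%N => n _; rewrite subrr cmod0. Qed.

Lemma climitD u v l l' : climit u l -> climit v l' ->
  climit (fun n => u n + v n) (l + l').
Proof.
move=> h h' e e0; have e20 : 0 < e / 2 by rewrite divr_gt0.
have [N hN] := h _ e20; have [N' hN'] := h' _ e20.
exists (maxn N N') => n; rewrite geq_max => /andP[/hN a /hN' b].
rewrite opprD addrACA; apply: le_lt_trans (cmodD _ _) _.
by rewrite [ltRHS](splitr e) ltrD.
Qed.

Lemma climitN u l : climit u l -> climit (fun n => - u n) (- l).
Proof. by move=> h e /h [N hN]; exists N => n /hN; rewrite -opprD cmodN. Qed.

Lemma climitB u v l l' : climit u l -> climit v l' ->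
  climit (fun n => u n - v n) (l - l').
Proof. by move=> h h'; apply: climitD => //; apply: climitN. Qed.

Lemma climitM u v l l' : climit u l -> climit v l' ->
  climit (fun n => u n * v n) (l * l').
Proof.
move=> h h'; apply: (proj1 (climitP (fun n => u n * v n) (l * l'))).
by apply: (@cvgM C nat \oo _ u v l l'); apply: (proj2 (climitP _ _)).
Qed.

Lemma climitMl a u l : climit u l -> climit (fun n => a * u n) (a * l).
Proof. by move=> h; apply: climitM => //; apply: climit_cst. Qed.

Lemma climitMr a u l : climit u l -> climit (fun n => u n * a) (l * a).
Proof. by move=> h; apply: climitM => //; apply: climit_cst. Qed.

Lemma climitV u l : l != 0 -> climit u l -> climit (fun n => (u n)^-1) l^-1.
Proof.
move=> l0 h; apply: (proj1 (climitP (fun n => (u n)^-1) l^-1)).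
by apply: (@cvgV C nat \oo _ u l) => //; apply: (proj2 (climitP _ _)).
Qed.

Lemma climit_sum (I : Type) (r : seq I) (u : I -> nat -> C) (l : I -> C) :
  (forall i, climit (u i) (l i)) ->
  climit (fun n => \sum_(i <- r) u i n) (\sum_(i <- r) l i).
Proof.
move=> h; elim: r => [|i r IH].
  rewrite big_nil (_ : (fun=> _) = (fun=> 0)); first exact: climit_cst.
  by apply/funext => n; rewrite big_nil.
rewrite big_cons (_ : (fun=> _) = (fun n => u i n + \sum_(i <- r) u i n)).
  exact: climitD.
by apply/funext => n; rewrite big_cons.
Qed.

Lemma climit_prod (I : Type) (r : seq I) (u : I -> nat -> C) (l : I -> C) :
  (forall i, climit (u i) (l i)) ->
  climit (fun n => \prod_(i <- r) u i n) (\prod_(i <- r) l i).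
Proof.
move=> h; elim: r => [|i r IH].
  rewrite big_nil (_ : (fun=> _) = (fun=> 1)); first exact: climit_cst.
  by apply/funext => n; rewrite big_nil.
rewrite big_cons (_ : (fun=> _) = (fun n => u i n * \prod_(i <- r) u i n)).
  exact: climitM.
by apply/funext => n; rewrite big_cons.
Qed.

Lemma climit_eq_from N0 u v l : (forall n, (N0 <= n)%N -> u n = v n) ->
  climit u l -> climit v l.
Proof.
move=> e h eps /h [N hN]; exists (maxn N0 N) => n.
by rewrite geq_max => /andP[a b]; rewrite -e ?hN.
Qed.

Lemma climit_squeeze N0 u l (v : nat -> R) :
  (forall n, (N0 <= n)%N -> cmod (u n - l) <= v n) ->
  v @ \oo --> (0 : R) -> climit u l.
Proof.
move=> h /cvgrPdist_lt hv e e0; have [N _ hN] := hv _ e0.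
exists (maxn N0 N) => n; rewrite geq_max => /andP[a b].
apply: le_lt_trans (h _ a) _; apply: le_lt_trans (ler_norm _) _.
by move: (hN _ b); rewrite /= sub0r normrN.
Qed.

Lemma climit_norm0 u l : climit u l -> (fun n => cmod (u n - l)) @ \oo --> (0 : R).
Proof.
move=> h; apply/cvgrPdist_lt => e /h [N hN]; exists N => // n /hN /=.
by rewrite sub0r normrN ger0_norm ?cmod_ge0.
Qed.

Lemma climit_shift u l : climit u l -> climit (fun n => u n.+1) l.
Proof. by move=> h e /h [N hN]; exists N => n Nn; apply/hN/leqW. Qed.

Lemma climit_le N0 u l (B : R) : climit u l ->
  (forall n, (N0 <= n)%N -> cmod (u n) <= B) -> cmod l <= B.
Proof.
move=> h hB; apply/ler_addgt0Pr => e /h [N hN].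
have := hN (maxn N0 N) (leq_maxr _ _); have := hB (maxn N0 N) (leq_maxl _ _).
move=> a b; rewrite -[l](subrK (u (maxn N0 N))) addrC.
apply: le_trans (cmodD _ _) _; apply: lerD => //; rewrite cmodB; exact: ltW.
Qed.

Lemma climit_unique u l l' : climit u l -> climit u l' -> l = l'.
Proof.
move=> h h'; apply/eqP; rewrite -subr_eq0 -cmod_eq0 eq_le cmod_ge0 andbT.
by apply: (climit_le (N0 := 0) (climitB h h')) => n _; rewrite subrr cmod0.
Qed.

(** Real and imaginary parts are Cauchy sequences of real numbers. *)
Lemma climit_cauchy u (tau : nat -> R) N0 :
  (forall n m, (N0 <= n)%N -> (n <= m)%N -> cmod (u m - u n) <= tau n) ->
  tau @ \oo --> (0 : R) -> exists l, climit u l.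
Proof.
move=> h /cvgrPdist_lt ht.
have key (p : C -> R) : (forall z w, p (z - w) = p z - p w) ->
    (forall z, `|p z| <= cmod z) -> cvg ((p \o u) @ \oo).
  move=> pB ple; apply/cauchy_cvgP; apply: cauchy_exP => e e0.
  have [N _ hN] := ht _ e0.
  pose M := maxn N0 N; exists (p (u M)); exists M => // n /= Mn.
  rewrite /ball /= distrC -pB; apply: le_lt_trans (ple _) _.
  apply: le_lt_trans (h M n (leq_maxl _ _) Mn) _.
  apply: le_lt_trans (ler_norm _) _.
  by move: (hN M (leq_maxr _ _)); rewrite /= sub0r normrN.
have /cvg_ex [a ha] := key (@complex.Re R)
  (fun z w => ltac:(by rewrite ReD ReN)) (@Re_le_cmod R).
have /cvg_ex [b hb] := key (@complex.Im R)
  (fun z w => ltac:(by rewrite ImD ImN)) (@Im_le_cmod R).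
exists (a +i* b).
apply: (@climit_squeeze 0 _ _ (fun n => `|complex.Re (u n) - a| + `|complex.Im (u n) - b|)).
  by move=> n _; apply: le_trans (cmod_le_ReIm _) _; rewrite ReD ImD ReN ImN.
rewrite -[X in _ --> X](addr0 0); apply: cvgD.
  by apply/norm_cvg0P; apply/subr_cvg0.
by apply/norm_cvg0P; apply/subr_cvg0.
Qed.

End Limits.

(** * Complex functions of a real variable *)

Section RealParameter.
Variable R : realType.
Notation C := R[i].
Implicit Types (f g : R -> C) (t : R) (d : C).

(** Derivatives are taken componentwise, so that the real rules apply to [cexp] and [clog1p]. *)
Definition cderiv f t d :=
  is_derive t 1 (fun x => complex.Re (f x)) (complex.Re d) /\
  is_derive t 1 (fun x => complex.Im (f x)) (complex.Im d).

Lemma is_derive_cast (h : R -> R) t (a b : R) : is_derive t 1 h a -> a = b ->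
  is_derive t 1 h b.
Proof. by move=> ? <-. Qed.

Lemma cderiv_cast f t d d' : cderiv f t d -> d = d' -> cderiv f t d'.
Proof. by move=> ? <-. Qed.

Lemma cderiv_ext f g t d : (forall x, f x = g x) -> cderiv f t d -> cderiv g t d.
Proof. by move=> /funext ->. Qed.

Lemma cderiv_cst (a : C) t : cderiv (fun=> a) t 0.
Proof. by split; apply: is_derive_cst. Qed.

Lemma cderiv_real (h : R -> R) t (dh : R) : is_derive t 1 h dh ->
  cderiv (fun x => (h x)%:C) t dh%:C.
Proof. by move=> h1; split => //=; apply: is_derive_cst. Qed.

Lemma cderiv_id t : cderiv (fun x => x%:C) t 1.
Proof. by apply: cderiv_real; apply: is_derive_id. Qed.

Lemma cderivD f g t d d' : cderiv f t d -> cderiv g t d' ->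
  cderiv (fun x => f x + g x) t (d + d').
Proof.
move=> [h1 h2] [h3 h4]; split.
  rewrite ReD (_ : (fun _ => _) = (fun x => complex.Re (f x)) +
    (fun x => complex.Re (g x))); first exact: is_deriveD.
  by apply/funext => x /=; rewrite ReD.
rewrite ImD (_ : (fun _ => _) = (fun x => complex.Im (f x)) +
    (fun x => complex.Im (g x))); first exact: is_deriveD.
by apply/funext => x /=; rewrite ImD.
Qed.

Lemma is_deriveM' (h k : R -> R) t (a b : R) : is_derive t 1 h a ->
  is_derive t 1 k b -> is_derive t 1 (fun x => h x * k x) (h t * b + k t * a).
Proof. by move=> ? ?; exact: is_deriveM. Qed.

Lemma is_deriveB' (h k : R -> R) t (a b : R) : is_derive t 1 h a ->
  is_derive t 1 k b -> is_derive t 1 (fun x => h x - k x) (a - b).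
Proof. by move=> ? ?; exact: is_deriveB. Qed.

Lemma is_deriveD' (h k : R -> R) t (a b : R) : is_derive t 1 h a ->
  is_derive t 1 k b -> is_derive t 1 (fun x => h x + k x) (a + b).
Proof. by move=> ? ?; exact: is_deriveD. Qed.

Lemma cderivM f g t d d' : cderiv f t d -> cderiv g t d' ->
  cderiv (fun x => f x * g x) t (d * g t + f t * d').
Proof.
move=> [h1 h2] [h3 h4]; split.
  rewrite (_ : (fun _ => _) = (fun x => complex.Re (f x) * complex.Re (g x) -
    complex.Im (f x) * complex.Im (g x))); last by apply/funext => x; rewrite ReM.
  apply: (is_derive_cast (is_deriveB' (is_deriveM' h1 h3) (is_deriveM' h2 h4))).
  by rewrite ReD !ReM; ring.
rewrite (_ : (fun _ => _) = (fun x => complex.Re (f x) * complex.Im (g x) +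
    complex.Im (f x) * complex.Re (g x))); last by apply/funext => x; rewrite ImM.
apply: (is_derive_cast (is_deriveD' (is_deriveM' h1 h4) (is_deriveM' h2 h3))).
by rewrite ImD !ImM; ring.
Qed.

Lemma cderivMl (a : C) f t d : cderiv f t d -> cderiv (fun x => a * f x) t (a * d).
Proof.
by move=> h; apply: cderiv_cast (cderivM (cderiv_cst a t) h) _; rewrite mul0r add0r.
Qed.

Lemma cderivN f t d : cderiv f t d -> cderiv (fun x => - f x) t (- d).
Proof.
move=> h; rewrite -mulN1r; apply: cderiv_ext (cderivMl (-1) h) => x.
by rewrite mulN1r.
Qed.

Lemma cderivB f g t d d' : cderiv f t d -> cderiv g t d' ->
  cderiv (fun x => f x - g x) t (d - d').
Proof. by move=> h h'; apply: cderivD => //; apply: cderivN. Qed.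

Lemma cderiv_sum (I : Type) (r : seq I) (f : I -> R -> C) (d : I -> C) t :
  (forall i, cderiv (f i) t (d i)) ->
  cderiv (fun x => \sum_(i <- r) f i x) t (\sum_(i <- r) d i).
Proof.
move=> h; elim: r => [|i r IH].
  rewrite big_nil; apply: cderiv_ext (cderiv_cst 0 t) => x; by rewrite big_nil.
rewrite big_cons; apply: cderiv_ext (cderivD (h i) IH) => x; by rewrite big_cons.
Qed.

Lemma cderivX t k : cderiv (fun x => x%:C ^+ k) t (k%:R * t%:C ^+ k.-1).
Proof.
elim: k => [|k IH]; first by rewrite mul0r; apply: cderiv_cst.
apply: (cderiv_ext (f := fun x => x%:C * x%:C ^+ k)).
  by move=> x; rewrite exprS.
apply: cderiv_cast (cderivM (cderiv_id t) IH) _.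
case: k {IH} => [|k] /=; first by rewrite !mul0r mulr0 addr0.
by rewrite mulrCA -exprS mul1r !mulr_natl -mulrS.
Qed.

Lemma is_derive_pow t k : is_derive t 1 (fun x => x ^+ k) (k%:R * t ^+ k.-1 : R).
Proof.
have [h _] := cderivX t k.
have e (x : R) j : complex.Re (x%:C ^+ j) = x ^+ j by rewrite -rmorphXn.
rewrite (_ : (fun _ => _) = (fun x => complex.Re (x%:C ^+ k))); last first.
  by apply/funext => x; rewrite e.
apply: is_derive_cast h _.
by rewrite -(rmorph_nat (real_complex R)) -rmorphXn -rmorphM.
Qed.

Lemma cderiv_cexp f t d : cderiv f t d ->
  cderiv (fun x => cexp (f x)) t (d * cexp (f t)).
Proof.
move=> [h1 h2].
have he : is_derive t 1 (fun x => expR (complex.Re (f x)))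
    (expR (complex.Re (f t)) * complex.Re d).
  have := @is_derive1_comp R expR (fun x => complex.Re (f x)) t _ _ _ h1.
  by move=> /(_ _ (is_derive_expR _)) h; apply: is_derive_cast h _; rewrite /GRing.scale /=.
have hc : is_derive t 1 (fun x => cos (complex.Im (f x)))
    (- sin (complex.Im (f t)) * complex.Im d).
  have := @is_derive1_comp R cos (fun x => complex.Im (f x)) t _ _ _ h2.
  by move=> /(_ _ (is_derive_cos _)) h; apply: is_derive_cast h _; rewrite /GRing.scale /=.
have hs : is_derive t 1 (fun x => sin (complex.Im (f x)))
    (cos (complex.Im (f t)) * complex.Im d).
  have := @is_derive1_comp R sin (fun x => complex.Im (f x)) t _ _ _ h2.
  by move=> /(_ _ (is_derive_sin _)) h; apply: is_derive_cast h _; rewrite /GRing.scale /=.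
split.
  rewrite (_ : (fun _ => _) = (fun x => expR (complex.Re (f x)) * cos (complex.Im (f x)))).
    apply: (is_derive_cast (is_deriveM' he hc)).
    by rewrite /cexp !ReM !ImM /=; ring.
  by apply/funext => x; rewrite /cexp ReM /= mul0r subr0.
rewrite (_ : (fun _ => _) = (fun x => expR (complex.Re (f x)) * sin (complex.Im (f x)))).
  apply: (is_derive_cast (is_deriveM' he hs)).
  by rewrite /cexp !(ReM, ImM) /=; ring.
by apply/funext => x; rewrite /cexp ImM /= mul0r addr0.
Qed.

Lemma MVT_ge0 (p dp : R -> R) (b : R) : 0 <= b ->
  (forall t, 0 <= t <= b -> is_derive t 1 p (dp t)) ->
  (forall t, 0 <= t <= b -> 0 <= dp t) -> p 0 <= p b.
Proof.
move=> b0 hp dp0; have [b1|b1] := eqVneq b 0; first by rewrite b1.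
have hb : 0 < b by rewrite lt_def b1.
have [||c hc e] := @MVT R p dp 0 b hb.
- by move=> t; rewrite in_itv /= => /andP[t0 tb]; apply: hp; rewrite !ltW.
- apply: derivable_within_continuous => t; rewrite in_itv /= => ht.
  by have [] := hp _ ht.
move: hc; rewrite in_itv /= => /andP[c0 cb].
by rewrite -subr_ge0 e mulr_ge0 ?subr0 // dp0 // !ltW.
Qed.

(** Multiplying by a number of modulus at most 1 makes the increment of f real and
nonnegative; the real mean value theorem then applies without loss in the constant. *)
Lemma mean_value f (df : R -> C) (g dg : R -> R) (b : R) : 0 <= b ->
  (forall t, 0 <= t <= b -> cderiv f t (df t)) ->
  (forall t, 0 <= t <= b -> is_derive t 1 g (dg t)) ->
  (forall t, 0 <= t <= b -> cmod (df t) <= dg t) ->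
  cmod (f b - f 0) <= g b - g 0.
Proof.
move=> b0 hf hg hle; set z := f b - f 0.
have [c c1 cz] : exists2 c : C, cmod c <= 1 & complex.Re (c * z) = cmod z.
  have [->|z0] := eqVneq z 0; first by exists 0; rewrite ?mul0r cmod0 ?ler01.
  exists ((cmod z)%:C / z).
    by rewrite cmodM cmodV cmodR ger0_norm ?cmod_ge0 // divff ?cmod_eq0.
  by rewrite -mulrA mulVf // mulr1.
rewrite -cz mulrBr ReD ReN.
pose p t := g t - complex.Re (c * f t).
suff : p 0 <= p b by rewrite /p; lra.
apply: (@MVT_ge0 _ (fun t => dg t - complex.Re (c * df t))) => // t ht.
  by apply: is_deriveB'; [exact: hg|have [] := cderivMl c (hf t ht)].
rewrite subr_ge0; apply: le_trans (hle _ ht); apply: le_trans (ler_norm _) _.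
apply: le_trans (Re_le_cmod _) _; rewrite cmodM.
by apply: ler_piMl => //; apply: cmod_ge0.
Qed.

Lemma mean_value_cst f (df : R -> C) (B : R) :
  (forall t, 0 <= t <= 1 -> cderiv f t (df t)) ->
  (forall t, 0 <= t <= 1 -> cmod (df t) <= B) ->
  cmod (f 1 - f 0) <= B.
Proof.
move=> hf hB.
have := @mean_value f df (fun t => t * B) (fun=> B) 1 ler01 hf.
rewrite mul0r mul1r subr0; apply => // t ht.
apply: (is_derive_cast (is_deriveM' (is_derive_id t 1) (is_derive_cst B t 1))).
by rewrite mulr0 mulr1 add0r.
Qed.

(** The remainder of order K + 1 of exp(t z) has derivative z times the remainder of order K,
so [mean_value] gives the bound by induction; the factor t ^+ K is what the induction integrates. *)
Lemma cexp_taylor (z : C) K (t : R) : 0 <= t <= 1 ->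
  cmod (cexp (t%:C * z) - \sum_(k < K) t%:C ^+ k * (z ^+ k / k`!%:R))
    <= expR (cmod z) * (cmod z ^+ K / K`!%:R * t ^+ K).
Proof.
elim: K t => [|K IH] t /andP[t0 t1].
  rewrite big_ord0 subr0 !expr0 divr1 !mulr1.
  apply: le_trans (cmod_cexp_le _) _.
  rewrite ler_expR cmodM cmodR ger0_norm //.
  by rewrite ler_piMl // cmod_ge0.
pose f x := cexp (x%:C * z) - \sum_(k < K.+1) x%:C ^+ k * (z ^+ k / k`!%:R).
pose df x := z * (cexp (x%:C * z) - \sum_(k < K) x%:C ^+ k * (z ^+ k / k`!%:R)).
have f0 : f 0 = 0.
  rewrite /f mul0r cexp0 big_ord_recl expr0 mul1r expr0 fact0 divr1 big1 ?addr0 ?subrr //.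
  by move=> i _; rewrite /= exprS mul0r mul0r.
have -> : cexp (t%:C * z) - \sum_(k < K.+1) t%:C ^+ k * (z ^+ k / k`!%:R) = f t - f 0.
  by rewrite f0 subr0.
pose B := expR (cmod z) * (cmod z ^+ K.+1 / K.+1`!%:R).
have := @mean_value f df (fun x => B * x ^+ K.+1)
  (fun x => B * (K.+1%:R * x ^+ K)) t t0.
rewrite expr0n mulr0 subr0 [X in _ -> _ <= X]mulrA; apply.
- move=> x /andP[x0 xt]; rewrite /df mulrBr; apply: cderivB.
    apply: cderiv_cast (cderiv_cexp (cderivM (cderiv_id x) (cderiv_cst z x))) _.
    by rewrite mulr0 addr0 mul1r.
  rewrite (_ : z * _ = \sum_(k < K.+1) (k%:R * x%:C ^+ k.-1) * (z ^+ k / k`!%:R)).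
    apply: (@cderiv_sum _ _ (fun (k : 'I_K.+1) x => x%:C ^+ k * (z ^+ k / k`!%:R))) => k.
    apply: cderiv_cast (cderivM (cderivX x k) (cderiv_cst _ x)) _.
    by rewrite mulr0 addr0.
  rewrite big_ord_recl !mul0r add0r mulr_sumr; apply: eq_bigr => k _.
  rewrite /= /bump /= add1n factS natrM exprS.
  have h1 : (k.+1%:R : C) != 0 by rewrite pnatr_eq0.
  have h2 : (k`!%:R : C) != 0 by rewrite pnatr_eq0 -lt0n fact_gt0.
  by move: (k.+1%:R : C) (k`!%:R : C) h1 h2 => a b a0 b0; field; rewrite a0 b0.
- move=> x hx.
  apply: is_derive_cast (is_deriveM' (is_derive_cst _ x 1) (is_derive_pow x K.+1)) _.
  by rewrite mulr0 addr0.
- move=> x /andP[x0 xt]; have xx : 0 <= x <= 1 by rewrite x0 (le_trans xt).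
  rewrite /df cmodM; apply: le_trans (ler_wpM2l (cmod_ge0 _) (IH _ xx)) _.
  rewrite le_eqVlt; apply/orP; left; apply/eqP.
  rewrite /B factS natrM exprS /=.
  have h1 : (K.+1%:R : R) != 0 by rewrite pnatr_eq0.
  have h2 : (K`!%:R : R) != 0 by rewrite pnatr_eq0 -lt0n fact_gt0.
  by move: (K.+1%:R : R) (K`!%:R : R) h1 h2 => a b a0 b0; field; rewrite a0 b0.
Qed.

Lemma cexp_series (z : C) : climit (fun K => \sum_(k < K) z ^+ k / k`!%:R) (cexp z).
Proof.
apply: (@climit_squeeze _ 0 _ _ (fun K => expR (cmod z) * (cmod z ^+ K / K`!%:R))).
  move=> K _; rewrite cmodB.
  have := @cexp_taylor z K 1; rewrite ler01 lexx expr1n mulr1 mul1r => /(_ isT).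
  by under eq_bigr do rewrite expr1n mul1r.
rewrite -[X in _ --> X](mulr0 (expR (cmod z))); apply: cvgM; first exact: cvg_cst.
have := cvg_series_cvg_0 (is_cvg_series_exp_coeff (cmod z)).
by rewrite /exp_coeff.
Qed.

End RealParameter.

(** * The logarithm near 1 *)

Section Logarithm.
Variable R : realType.
Notation C := R[i].
Implicit Types (z w p : C) (x t : R).

Definition clog z : C := ln (cmod z) +i* carg z.

Lemma cpowE z s : cpow z s = cexp (s * clog z).
Proof. by []. Qed.

Lemma cmod_sqr z : cmod z ^+ 2 = complex.Re z ^+ 2 + complex.Im z ^+ 2.
Proof. by rewrite cmodE sqr_sqrtr // addr_ge0 // sqr_ge0. Qed.

Lemma Re_div_cmod z : -1 <= complex.Re z / cmod z <= 1.
Proof.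
have [->|z0] := eqVneq z 0; first by rewrite /= mul0r lerN10 ler01.
have z1 : 0 < cmod z by rewrite cmod_gt0.
rewrite -ler_norml normrM normfV (ger0_norm (ltW z1)) ler_pdivrMr // mul1r.
exact: Re_le_cmod.
Qed.

Lemma norm_carg z : `|carg z| = acos (complex.Re z / cmod z).
Proof.
rewrite /carg; have h := acos_ge0 (Re_div_cmod z).
by case: ifP => _; rewrite ?normrN ger0_norm.
Qed.

Lemma cos_carg z : cos (carg z) = complex.Re z / cmod z.
Proof.
have e : cos (carg z) = cos (acos (complex.Re z / cmod z)).
  by rewrite /carg; case: ifP => _ //; rewrite cosN.
by rewrite e acosK // in_itv /= Re_div_cmod.
Qed.

Lemma sin_carg z : z != 0 -> sin (carg z) = complex.Im z / cmod z.
Proof.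
move=> z0; have z1 : 0 < cmod z by rewrite cmod_gt0.
have e : sin (acos (complex.Re z / cmod z)) = `|complex.Im z| / cmod z.
  rewrite sin_acos ?Re_div_cmod // expr_div_n -[1](@divff _ (cmod z ^+ 2)) ?expf_neq0 ?gt_eqF //.
  rewrite -mulrBl {1}cmod_sqr addrAC subrr add0r -expr_div_n sqrtr_sqr.
  by rewrite normrM normfV (gtr0_norm z1).
rewrite /carg; case: ifPn => h; first by rewrite e ger0_norm.
by rewrite sinN e ltr0_norm ?mulNr ?opprK // ltNge.
Qed.

Lemma clogK z : z != 0 -> cexp (clog z) = z.
Proof.
move=> z0; have z1 : 0 < cmod z by rewrite cmod_gt0.
rewrite /cexp /= lnK ?posrE // cos_carg sin_carg //.
have n0 : cmod z != 0 by rewrite gt_eqF.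
apply: complex_ext; rewrite ?ReM ?ImM /=; field => //.
Qed.

(** This is how logarithms of products are computed: it suffices to bound an imaginary part. *)
Lemma clog_unique z w : cexp w = z -> - pi < complex.Im w <= pi -> clog z = w.
Proof.
case: w => a b <- /= /andP[b1 b2].
rewrite /clog cmod_cexp /= expRK; congr (_ +i* _).
rewrite /carg cmod_cexp /cexp !(ReM, ImM) /= !mul0r subr0 addr0.
rewrite mulrAC divff ?gt_eqF ?expR_gt0 // mul1r.
rewrite pmulr_rge0 ?expR_gt0 //.
have [b0|b0] := leP 0 b.
  by rewrite sin_ge0_pi ?b0 // cosK // in_itv /= b0.
rewrite ifF; first by rewrite cosKN ?opprK // !ltW.
apply/negP/negP; rewrite -ltNge -oppr_gt0 -sinN sin_gt0_pi //.
by rewrite oppr_gt0 b0 /= ltrNl.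
Qed.

(** The same branch as [clog] on the disc of radius 1/2, but with an arctangent in place of the
arc cosine of [carg], hence with an obvious derivative. *)
Definition clog1p z : C := ln (cmod (1 + z)) +i* atan (complex.Im z / (1 + complex.Re z)).

Lemma clog1p0 : clog1p 0 = 0.
Proof. by rewrite /clog1p addr0 cmod1 ln1 /= mul0r atan0. Qed.

Lemma Re1p_gt0 z : cmod z <= 2^-1 -> 0 < 1 + complex.Re z.
Proof.
move=> h; have := le_trans (Re_le_cmod z) h; rewrite ler_norml => /andP[a _].
have : (2^-1 : R) < 1 by rewrite invf_lt1 // ltr1n.
by lra.
Qed.

Lemma cexp_clog1p z : cmod z <= 2^-1 -> cexp (clog1p z) = 1 + z.
Proof.
move=> /Re1p_gt0; case: z => u v /= p0.
set p := 1 + u in p0 *.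
have n1 : p != 0 by rewrite gt_eqF.
have e : cmod (1 + (u +i* v)) = p * Num.sqrt (1 + (v / p) ^+ 2).
  rewrite cmodE /= add0r -/p -{2}(gtr0_norm p0) -sqrtr_sqr -sqrtrM ?sqr_ge0 //.
  by congr Num.sqrt; field.
have s0 : 0 < Num.sqrt (1 + (v / p) ^+ 2).
  by rewrite sqrtr_gt0 ltr_wpDr ?sqr_ge0.
have sn : Num.sqrt (1 + (v / p) ^+ 2) != 0 by rewrite gt_eqF.
have hs : sin (atan (v / p)) = (v / p) * cos (atan (v / p)).
  rewrite -[X in _ = X * _]atanK /tan mulfVK // cos_atan invr_neq0 //.
rewrite /cexp /= -/p e lnK ?posrE ?mulr_gt0 // hs cos_atan.
move: (Num.sqrt _) sn => s sn.
by apply: complex_ext; rewrite ?ReM ?ImM /= ?add0r -/p; field; rewrite sn n1.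
Qed.

Lemma is_derive_comp' (f g : R -> R) t (a b : R) : is_derive (g t) 1 f a ->
  is_derive t 1 g b -> is_derive t 1 (fun x => f (g x)) (a * b).
Proof. by move=> h1 h2; exact: (is_derive1_comp h1 h2). Qed.

Lemma cderiv_clog1p z t : cmod (t%:C * z) <= 2^-1 ->
  cderiv (fun x => clog1p (x%:C * z)) t (z / (1 + t%:C * z)).
Proof.
case: z => u v /Re1p_gt0 h.
have {h} p0 : 0 < 1 + t * u by move: h; rewrite /= mul0r subr0.
have dp : is_derive t 1 (fun x => 1 + x * u) u.
  apply: is_derive_cast (is_deriveD' (is_derive_cst (1 : R) t 1)
    (is_deriveM' (is_derive_id t 1) (is_derive_cst u t 1))) _.
  by rewrite mulr0 mulr1 !add0r.
have dq : is_derive t 1 (fun x => x * v) v.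
  apply: is_derive_cast (is_deriveM' (is_derive_id t 1) (is_derive_cst v t 1)) _.
  by rewrite mulr0 mulr1 add0r.
have q0 : 0 < (1 + t * u) ^+ 2 + (t * v) ^+ 2.
  by rewrite ltr_wpDr ?sqr_ge0 // exprn_gt0.
have n1 : 1 + t * u != 0 by rewrite gt_eqF.
have n2 : (1 + t * u) * (1 + t * u) + (t * v) * (t * v) != 0 by rewrite -!expr2 gt_eqF.
have val : (u +i* v) / (1 + t%:C * (u +i* v)) =
   ((u * (1 + t * u) + v * (t * v)) / ((1 + t * u) * (1 + t * u) + (t * v) * (t * v)))
   +i* ((v * (1 + t * u) - u * (t * v)) / ((1 + t * u) * (1 + t * u) + (t * v) * (t * v))).
  have nz : 1 + t%:C * (u +i* v) != 0.
    apply/eqP => /(congr1 (@complex.Re R)) /=; rewrite mul0r subr0; exact/eqP.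
  apply: (mulIf nz); rewrite divfK //.
  by apply: complex_ext; rewrite /= ?mul0r ?subr0 ?addr0 ?add0r; field.
rewrite val; split => /=.
  rewrite (_ : (fun _ => _) = (fun x => 2^-1 * ln ((1 + x * u) * (1 + x * u) + (x * v) * (x * v)))).
    pose g x := (1 + x * u) * (1 + x * u) + (x * v) * (x * v).
    have hg := is_deriveD' (is_deriveM' dp dp) (is_deriveM' dq dq).
    have gp : 0 < g t by rewrite /g -!expr2.
    have hl := is_derive_comp' (g := g) (is_derive1_ln gp) hg.
    apply: is_derive_cast (is_deriveM' (is_derive_cst (2^-1 : R) t 1) hl) _.
    by rewrite /g mulr0 addr0 /=; field.
  apply/funext => x; rewrite cmodE /= !(mul0r, subr0, addr0, add0r) -!expr2.
  have : 0 <= (1 + x * u) ^+ 2 + (x * v) ^+ 2 by rewrite addr_ge0 ?sqr_ge0.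
  move: ((1 + x * u) ^+ 2 + (x * v) ^+ 2) => q.
  rewrite le_eqVlt => /orP[/eqP <-|qp]; first by rewrite sqrtr0 ln0 ?mulr0.
  by rewrite -{2}(sqr_sqrtr (ltW qp)) lnXn ?sqrtr_gt0 //; field.
rewrite (_ : (fun _ => _) = (fun x => atan ((x * v) * (1 + x * u)^-1))).
  pose g x := (x * v) * (1 + x * u)^-1.
  have hg := is_deriveM' dq (is_deriveV (f := fun x => 1 + x * u) (x := t) n1 dp).
  have ha := is_derive_comp' (g := g) (is_derive1_atan (g t)) hg.
  apply: is_derive_cast ha _; rewrite /g /GRing.scale /=.
  field; rewrite n1 /=; apply/andP; split => //.
by apply/funext => x; rewrite /= !(mul0r, subr0, addr0, add0r).
Qed.

End Logarithm.

(** * Binomial expansion with remainder *)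

Section Binomial.
Variable R : realType.
Notation C := R[i].
Implicit Types (z w p : C) (x t : R).

Lemma cmod_scale_le z t : 0 <= t <= 1 -> cmod (t%:C * z) <= cmod z.
Proof.
move=> /andP[t0 t1]; rewrite cmodM cmodR ger0_norm //.
by rewrite ler_piMl // cmod_ge0.
Qed.

Lemma cmod_1p_ge z : cmod z <= 2^-1 -> 2^-1 <= cmod (1 + z).
Proof.
move=> h; have := cmod_leD 1 z; rewrite cmod1; apply: le_trans.
by rewrite lerBrDr; lra.
Qed.

Lemma cmod_V1p_le z : cmod z <= 2^-1 -> cmod (1 + z)^-1 <= 2.
Proof.
move=> /cmod_1p_ge h; rewrite cmodV -[leRHS]invrK lef_pV2 ?posrE ?invr_gt0 //.
by apply: lt_le_trans h; rewrite invr_gt0.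
Qed.

Lemma onep_neq0 z : cmod z <= 2^-1 -> 1 + z != 0.
Proof.
by move=> /cmod_1p_ge h; rewrite -cmod_gt0; apply: lt_le_trans h; rewrite invr_gt0.
Qed.

Lemma cmod_clog1p_le z : cmod z <= 2^-1 -> cmod (clog1p z) <= 2 * cmod z.
Proof.
move=> h.
have -> : clog1p z = clog1p (1%:C * z) - clog1p (0%:C * z).
  by rewrite mul0r mul1r clog1p0 subr0.
have hz t : 0 <= t <= 1 -> cmod (t%:C * z) <= 2^-1.
  by move=> ht; apply: le_trans (cmod_scale_le _ ht) h.
apply: (@mean_value_cst _ (fun t => clog1p (t%:C * z)) (fun t => z / (1 + t%:C * z))).
  by move=> t /hz /cderiv_clog1p.
move=> t /hz ht; rewrite cmodM mulrC ler_wpM2r ?cmod_ge0 //.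
exact: cmod_V1p_le.
Qed.

Lemma cmod_clog1p_sub_le z : cmod z <= 2^-1 -> cmod (clog1p z - z) <= 2 * cmod z ^+ 2.
Proof.
move=> h.
have -> : clog1p z - z = (clog1p (1%:C * z) - 1%:C * z) - (clog1p (0%:C * z) - 0%:C * z).
  by rewrite !mul0r mul1r clog1p0 !subr0.
have hz t : 0 <= t <= 1 -> cmod (t%:C * z) <= 2^-1.
  by move=> ht; apply: le_trans (cmod_scale_le _ ht) h.
apply: (@mean_value_cst _ (fun t => clog1p (t%:C * z) - t%:C * z)
  (fun t => z / (1 + t%:C * z) - z)).
  move=> t /hz ht; apply: cderivB; first exact: cderiv_clog1p.
  apply: cderiv_cast (cderivM (cderiv_id t) (cderiv_cst z t)) _.
  by rewrite mulr0 addr0 mul1r.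
move=> t ht; have := hz _ ht => ht'.
have -> : z / (1 + t%:C * z) - z = (1 + t%:C * z)^-1 * (- (t%:C * z) * z).
  have n0 := onep_neq0 ht'; apply: (mulIf n0).
  by rewrite mulrBl divfK // [in RHS]mulrAC mulVf // mul1r; ring.
rewrite cmodM; apply: ler_pM; rewrite ?cmod_ge0 //; first exact: cmod_V1p_le.
rewrite cmodM cmodN expr2; apply: ler_pM; rewrite ?cmod_ge0 //.
exact: cmod_scale_le.
Qed.

(** Binomial coefficients with a complex upper index. *)
Fixpoint cbin p k : C := if k is k'.+1 then p / k'.+1%:R * cbin (p - 1) k' else 1.

(** Remainder of the binomial expansion of (1 + z) ^ p. *)
Definition binrem K p z : C := cexp (p * clog1p z) - \sum_(k < K) cbin p k * z ^+ k.

Lemma binrem0 K p : binrem K.+1 p 0 = 0.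
Proof.
rewrite /binrem clog1p0 mulr0 cexp0 big_ord_recl expr0 mulr1 big1 ?addr0 ?subrr //.
by move=> i _; rewrite exprS mul0r mulr0.
Qed.

(** Differentiation lowers both the exponent and the order of the remainder by one. *)
Lemma cderiv_binrem K p z t : cmod (t%:C * z) <= 2^-1 ->
  cderiv (fun x => binrem K.+1 p (x%:C * z)) t (p * z * binrem K (p - 1) (t%:C * z)).
Proof.
move=> h; rewrite /binrem mulrBr; apply: cderivB.
  apply: cderiv_cast (cderiv_cexp (cderivMl p (cderiv_clog1p h))) _.
  rewrite mulrBl mul1r cexpB (cexp_clog1p h); ring.
rewrite mulr_sumr.
apply: (cderiv_ext (f := fun x => \sum_(k < K.+1) (cbin p k * z ^+ k) * x%:C ^+ k)).
  by move=> x; apply: eq_bigr => k _; rewrite exprMn; ring.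
apply: (cderiv_cast (d := \sum_(k < K.+1) (cbin p k * z ^+ k) * (k%:R * t%:C ^+ k.-1))).
  by apply: (@cderiv_sum _ _ _ (fun (k : 'I_K.+1) x => (cbin p k * z ^+ k) * x%:C ^+ k)) => k;
     apply: cderivMl; apply: cderivX.
rewrite big_ord_recl mul0r mulr0 add0r; apply: eq_bigr => k _.
rewrite lift0 [cbin p _]/= exprS exprMn [_.-1]/=.
have h1 : (k.+1%:R : C) != 0 by rewrite pnatr_eq0.
by move: (k.+1%:R : C) h1 => a a0; field.
Qed.

(** The constant is uniform in p, as p will be an affine function of the variable of the zeta
functions. *)
Lemma binrem_bound K (P : R) : 0 <= P -> exists2 B : R, 0 <= B & forall p z,
  cmod p <= P -> cmod z <= 2^-1 -> cmod (binrem K p z) <= B * cmod z ^+ K.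
Proof.
elim: K P => [|K IH] P P0.
  exists (expR P) => [|p z hp hz]; first exact: expR_ge0.
  rewrite /binrem big_ord0 subr0 expr0 mulr1; apply: le_trans (cmod_cexp_le _) _.
  rewrite ler_expR cmodM -[leRHS]mulr1; apply: ler_pM; rewrite ?cmod_ge0 //.
  apply: le_trans (cmod_clog1p_le hz) _.
  by lra.
have [B B0 hB] := IH (P + 1) (addr_ge0 P0 ler01).
exists (P * B) => [|p z hp hz]; first exact: mulr_ge0.
have -> : binrem K.+1 p z = binrem K.+1 p (1%:C * z) - binrem K.+1 p (0%:C * z).
  by rewrite mul0r mul1r binrem0 subr0.
have hz' t : 0 <= t <= 1 -> cmod (t%:C * z) <= 2^-1.
  by move=> ht; apply: le_trans (cmod_scale_le _ ht) hz.
apply: (@mean_value_cst _ (fun t => binrem K.+1 p (t%:C * z))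
  (fun t => p * z * binrem K (p - 1) (t%:C * z))).
  by move=> t /hz' /cderiv_binrem.
move=> t ht; rewrite cmodM cmodM exprS.
have -> : P * B * (cmod z * cmod z ^+ K) = P * cmod z * (B * cmod z ^+ K) by ring.
apply: ler_pM; rewrite ?mulr_ge0 ?cmod_ge0 //; first by rewrite ler_wpM2r ?cmod_ge0.
apply: le_trans (hB _ _ _ (hz' _ ht)) _.
  by apply: le_trans (cmodD _ _) _; rewrite cmodN cmod1 lerD.
by rewrite ler_wpM2l // lerXn2r ?nnegrE ?cmod_ge0 // cmod_scale_le.
Qed.

(** The factor 1 + z turns the argument by at most 2 |z|, too little to reach the cut. *)
Lemma clogM1p y z : y != 0 -> cmod z <= 2^-1 ->
  `|carg y| + 2 * cmod z < pi -> clog (y * (1 + z)) = clog y + clog1p z.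
Proof.
move=> y0 hz h; apply: clog_unique.
  by rewrite cexpD clogK // cexp_clog1p.
have h2 : `|complex.Im (clog y + clog1p z)| < pi.
  rewrite ImD; apply: le_lt_trans (ler_normD _ _) _; apply: le_lt_trans h.
  rewrite lerD2l; apply: le_trans (Im_le_cmod _) _; exact: cmod_clog1p_le.
by move: h2; rewrite ltr_norml => /andP[-> /ltW ->].
Qed.

(** The closed half plane Re (conj u y) >= 0 with Re u > 0 meets the negative real axis only
at 0, so the arguments of its points stay at a fixed distance from pi. *)
Lemma carg_sector (u y : C) : 0 < complex.Re u ->
  0 <= complex.Re (u^* * y) -> y != 0 ->
  `|carg y| <= acos (- (`|complex.Im u| / cmod u)).
Proof.
move=> u0 h y0; rewrite norm_carg.
have yp : 0 < cmod y by rewrite cmod_gt0.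
have up : 0 < cmod u by apply: lt_le_trans (Re_le_cmod u); rewrite gtr0_norm.
have h1 : `|complex.Im u| / cmod u <= 1.
  by rewrite ler_pdivrMr // mul1r Im_le_cmod.
have h0 : 0 <= `|complex.Im u| / cmod u by rewrite divr_ge0 // ltW.
have key : - (`|complex.Im u| / cmod u) <= complex.Re y / cmod y.
  rewrite ler_pdivlMr // mulNr mulrAC -mulNr ler_pdivrMr //.
  have [y1|y1] := leP 0 (complex.Re y).
    by apply: (@le_trans _ _ 0); rewrite ?mulNr ?oppr_le0 mulr_ge0 ?cmod_ge0.
  rewrite lerNl -mulNr -(@ler_pXn2r _ 2) ?nnegrE ?mulr_ge0 ?oppr_ge0 ?cmod_ge0 ?(ltW y1) //.
  rewrite !exprMn !cmod_sqr sqrrN real_normK ?num_real //.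
  move: h; rewrite ReM; case: (u) u0 => a b /= u0; case: (y) y1 => c d /= y1 h.
  have e1 : 0 <= (- c) * a by rewrite mulr_ge0 // ?oppr_ge0 ltW.
  have e2 : (- c) * a <= b * d by lra.
  have e3 : ((- c) * a) ^+ 2 <= (b * d) ^+ 2.
    by rewrite ler_pXn2r ?nnegrE // (le_trans e1 e2).
  by rewrite !exprMn sqrrN in e3; lra.
have h2 : -1 <= - (`|complex.Im u| / cmod u) <= 1.
  by rewrite lerNl opprK h1 lerNl (le_trans _ h0) // lerN10.
rewrite leNgt -ltr_cos ?in_itv /= ?acos_ge0 ?acos_lepi ?Re_div_cmod //.
by rewrite !acosK ?in_itv /= ?Re_div_cmod // -leNgt.
Qed.

End Binomial.

(** * Power series and Cauchy's estimate *)

Section PowerSeries.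
Variable R : realType.
Notation C := R[i].
Implicit Types (f g : C -> C) (s z w : C) (a b : nat -> C) (e E B : R).

(** [analytic_at] with explicit coefficients and radius. *)
Definition has_ps f s0 a E := forall s, cmod (s - s0) < E ->
  climit (fun K => \sum_(k < K) a k * (s - s0) ^+ k) (f s).

Lemma analytic_atE f s0 :
  analytic_at f s0 <-> exists a E, 0 < E /\ has_ps f s0 a E.
Proof.
split=> -[a [e [e0 h]]]; exists a, e; split=> // s hs.
  by apply: (proj1 (climitP _ _)); exact: h.
by apply: (proj2 (climitP _ _)); exact: h.
Qed.

Lemma has_ps_sub f s0 a E E' : E' <= E -> has_ps f s0 a E -> has_ps f s0 a E'.
Proof. by move=> le h s hs; apply: h; apply: lt_le_trans hs le. Qed.

Lemma has_ps_ext f g s0 a E : (forall s, cmod (s - s0) < E -> f s = g s) ->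
  has_ps f s0 a E -> has_ps g s0 a E.
Proof. by move=> e h s hs; rewrite -e //; apply: h. Qed.

Lemma has_psD f g s0 a b E : has_ps f s0 a E -> has_ps g s0 b E ->
  has_ps (fun s => f s + g s) s0 (fun k => a k + b k) E.
Proof.
move=> h h' s hs; apply: (@climit_eq_from _ 0 _ _ _ _) (climitD (h s hs) (h' s hs)) => //.
by move=> K _; rewrite -big_split /=; apply: eq_bigr => k _; rewrite mulrDl.
Qed.

Lemma has_psMl (c : C) f s0 a E : has_ps f s0 a E ->
  has_ps (fun s => c * f s) s0 (fun k => c * a k) E.
Proof.
move=> h s hs; apply: (@climit_eq_from _ 0 _ _ _ _) (climitMl c (h s hs)) => //.
by move=> K _; rewrite mulr_sumr; apply: eq_bigr => k _; rewrite mulrA.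
Qed.

Lemma has_psN f s0 a E : has_ps f s0 a E ->
  has_ps (fun s => - f s) s0 (fun k => - a k) E.
Proof.
move=> h s hs; apply: (@climit_eq_from _ 0 _ _ _ _) (climitN (h s hs)) => //.
by move=> K _; rewrite -sumrN; apply: eq_bigr => k _; rewrite mulNr.
Qed.

Lemma has_psB f g s0 a b E : has_ps f s0 a E -> has_ps g s0 b E ->
  has_ps (fun s => f s - g s) s0 (fun k => a k - b k) E.
Proof. by move=> h h'; apply: has_psD => //; apply: has_psN. Qed.

Lemma has_ps_sum (I : Type) (r : seq I) (f : I -> C -> C) s0 (a : I -> nat -> C) E :
  (forall i, has_ps (f i) s0 (a i) E) ->
  has_ps (fun s => \sum_(i <- r) f i s) s0 (fun k => \sum_(i <- r) a i k) E.
Proof.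
move=> h s hs; apply: (@climit_eq_from _ 0 _ _ _ _) (climit_sum r (fun i => h i s hs)) => //.
move=> K _; rewrite exchange_big /=; apply: eq_bigr => k _.
by rewrite mulr_suml.
Qed.

Lemma has_ps_cexp (l s0 : C) E :
  has_ps (fun s => cexp (l * s)) s0 (fun k => cexp (l * s0) * l ^+ k / k`!%:R) E.
Proof.
move=> s _; rewrite -(subrK s0 s) addrK mulrDr cexpD [X in climit _ X]mulrC.
apply: (@climit_eq_from _ 0 _ _ _ _) (climitMl _ (cexp_series _)) => //.
move=> K _; rewrite mulr_sumr; apply: eq_bigr => k _.
by rewrite exprMn; ring.
Qed.

Lemma has_ps_coef0 f s0 a E : 0 < E -> has_ps f s0 a E -> f s0 = a 0%N.
Proof.
move=> E0 h; have h0 : cmod (s0 - s0) < E by rewrite subrr cmod0.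
apply: (climit_unique (h s0 h0)); rewrite subrr.
apply: (@climit_eq_from _ 1 _ _ _ _ (climit_cst (a 0%N))) => -[|K] // _.
by rewrite big_ord_recl expr0 mulr1 big1 ?addr0 // => k _; rewrite exprS mul0r mulr0.
Qed.

Lemma prim_root_cexp M : (0 < M)%N ->
  M.-primitive_root (cexp (2 * 'i%C * cpi R / M%:R)).
Proof.
move=> M0; set z := cexp _.
have Mn : (M%:R : R) != 0 by rewrite pnatr_eq0 -lt0n.
have e d : z ^+ d = cexp ('i%C * (2 * (d%:R * pi / M%:R) : R)%:C).
  rewrite -cexpMn; congr cexp.
  rewrite /cpi !(rmorphM, fmorphV, rmorph_nat) /= -mulr_natr; ring.
have zM : z ^+ M = 1.
  rewrite e mulrAC divff // mul1r cexp_i mulrC mulr_natr cos2pi sin2pi.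
  by [].
have [m hm mM] := prim_order_exists M0 zM.
suff -> : M = m by [].
apply/eqP; rewrite eqn_leq (dvdn_leq M0 mM) andbT leqNgt; apply/negP => ltm.
have m0 := prim_order_gt0 hm.
have := prim_expr_order hm; rewrite e cexp_i.
move=> /(congr1 (@complex.Re R)) /=.
set x := _ * pi / _.
have sx : 0 < sin x.
  apply: sin_gt0_pi; rewrite /x divr_gt0 ?mulr_gt0 ?pi_gt0 ?ltr0n //=.
  by rewrite ltr_pdivrMr ?ltr0n // mulrC ltr_pM2l ?pi_gt0 // ltr_nat.
rewrite mulr_natl mulr2n cosD => hc.
have := cos2Dsin2 x; rewrite !expr2.
have : 0 < sin x * sin x by rewrite mulr_gt0.
by lra.
Qed.

Lemma prim_root_sum M z d : M.-primitive_root z ->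
  \sum_(j < M) z ^+ (j * d) = if (M %| d)%N then M%:R else 0 :> C.
Proof.
move=> hz; case: ifPn => hd.
  rewrite (eq_bigr (fun=> 1)) => [|j _]; first by rewrite sumr_const card_ord.
  by apply/eqP; rewrite -(prim_order_dvd hz) dvdn_mull.
have z1 : z ^+ d != 1 by rewrite -(prim_order_dvd hz).
have : (z ^+ d - 1) * \sum_(j < M) z ^+ (j * d) = 0.
  under eq_bigr do rewrite mulnC exprM.
  rewrite -subrX1 -exprM mulnC exprM (prim_expr_order hz) expr1n subrr //.
by move/eqP; rewrite mulf_eq0 subr_eq0 (negbTE z1) => /eqP.
Qed.

Lemma geo_tail (q : R) M L : 0 <= q < 1 ->
  \sum_(M <= l < L) q ^+ l <= q ^+ M / (1 - q).
Proof.
move=> /andP[q0 q1]; have p : 0 < 1 - q by rewrite subr_gt0.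
have [ML|LM] := leqP M L; last first.
  by rewrite big_geq ?(ltnW LM) // divr_ge0 ?exprn_ge0 // ltW.
have -> : \sum_(M <= l < L) q ^+ l = (q ^+ M - q ^+ L) / (1 - q).
  elim: L ML => [|L IH] ML.
    by move: ML; rewrite leqn0 => /eqP ->; rewrite big_geq // subrr mul0r.
  move: ML; rewrite leq_eqVlt => /orP[/eqP <-|ML].
    by rewrite big_geq // subrr mul0r.
  rewrite big_nat_recr //= IH // exprS; field.
  by rewrite gt_eqF.
by rewrite ler_pM2r ?invr_gt0 // gerBl exprn_ge0.
Qed.

Lemma geo_cvg0 (q : R) (c : R) : 0 <= q < 1 ->
  (fun M => q ^+ M * c) @ \oo --> (0 : R).
Proof.
move=> /andP[q0 q1]; rewrite -[X in _ --> X](mul0r c).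
by apply: cvgM; [apply: cvg_expr; rewrite ger0_norm|exact: cvg_cst].
Qed.

(** Averaging f against a power of z over the points s0 + e z ^+ j, for z a primitive root of
unity of large order M, isolates a k e ^+ k up to the terms of index at least M, which are small
because the series converges slightly beyond e. *)
Lemma cauchy_estimate f s0 a E B e : has_ps f s0 a E -> 0 < e -> e < E ->
  (forall s, cmod (s - s0) < E -> cmod (f s) <= B) ->
  forall k, cmod (a k) * e ^+ k <= B.
Proof.
move=> hf e0 eE hB k.
(* The terms of the series tend to 0 at radius e1 < E, so at radius e they decay geometrically. *)
pose e1 := (e + E) / 2.
have [ee1 e1E] : e < e1 /\ e1 < E by rewrite /e1; split; lra.
have e10 : 0 < e1 by apply: lt_trans ee1.
pose q := e / e1.
have q01 : 0 <= q < 1 by rewrite divr_ge0 ?ltW //= ltr_pdivrMr // mul1r.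
have [N hN] : exists N, forall l, (N <= l)%N -> cmod (a l) * e ^+ l <= q ^+ l.
  have h1 : cmod (s0 + e1%:C - s0) < E by rewrite addrC addKr cmodR gtr0_norm.
  have := climitB (climit_shift (hf _ h1)) (hf _ h1).
  rewrite subrr => /(_ _ (@ltr01 R)) [N hN]; exists N => l /hN.
  rewrite big_ord_recr /= subr0 [X in cmod X]addrAC subrr add0r (addrC s0) addrK.
  rewrite cmodM cmodX cmodR gtr0_norm // => /ltW h.
  rewrite /q expr_div_n ler_pdivlMr ?exprn_gt0 // mulrAC.
  by rewrite -[leRHS]mul1r ler_wpM2r ?exprn_ge0 // ltW.
apply/ler_addgt0Pr => eps eps0.
have [M [MN Mk hM]] : exists M, [/\ (N <= M)%N, (k < M)%N & q ^+ M / (1 - q) < eps / 2].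
  have /cvgrPdist_lt := geo_cvg0 (1 - q)^-1 q01.
  have e20 : 0 < eps / 2 by rewrite divr_gt0.
  move=> /(_ _ e20) [M0 _ hM0]; exists (maxn M0 (maxn N k.+1)); split.
  - by rewrite !leq_max leqnn orbT.
  - by rewrite !leq_max leqnn !orbT.
  have := hM0 (maxn M0 (maxn N k.+1)) (leq_maxl _ _).
  by rewrite /= sub0r normrN; apply: le_lt_trans; rewrite ler_norm.
have M0 : (0 < M)%N by apply: leq_trans Mk.
have hz := prim_root_cexp M0; move: (cexp _) hz => z hz.
have z1 : cmod z = 1.
  have := congr1 (@cmod R) (prim_expr_order hz); rewrite cmodX cmod1 => /eqP.
  by rewrite pexpr_eq1 ?cmod_ge0 // => /eqP.
pose pt j := s0 + e%:C * z ^+ j.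
have hpt j : cmod (pt j - s0) < E.
  by rewrite /pt addrC addKr cmodM cmodX z1 expr1n mulr1 cmodR gtr0_norm.
have hS := climit_sum (index_enum 'I_M) (fun j : 'I_M =>
  climitMr (z ^+ (j * (M - k))) (hf _ (hpt j))).
have e20 : 0 < eps / 2 * M%:R by rewrite mulr_gt0 ?divr_gt0 ?ltr0n.
have [L0 hL0] := hS _ e20.
pose L := maxn M L0.
have {hL0 hS} := hL0 L (leq_maxr _ _).
set T := (X in cmod (X - _) < _); set T' := (X in cmod (_ - X) < _) => hT.
have hT' : cmod T' <= M%:R * B.
  apply: le_trans (cmod_sum _ _ _) _.
  rewrite mulr_natl -[X in _ <= _ *+ X]card_ord -sumr_const.
  apply: ler_sum => j _; rewrite cmodM cmodX z1 expr1n mulr1; exact: hB.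
have eT : T = M%:R * (a k * e%:C ^+ k) + \sum_(M <= l < L) a l * e%:C ^+ l *
     (\sum_(j < M) z ^+ (j * (l + (M - k)))).
  rewrite /T; under eq_bigr => j _ do rewrite mulr_suml.
  rewrite exchange_big /=.
  have -> : \sum_(l < L) \sum_(j < M) a l * (pt j - s0) ^+ l * z ^+ (j * (M - k)) =
    \sum_(l < L) a l * e%:C ^+ l * (\sum_(j < M) z ^+ (j * (l + (M - k)))).
    apply: eq_bigr => l _; rewrite mulr_sumr; apply: eq_bigr => j _.
    by rewrite /pt addrC addKr exprMn -exprM mulnDr exprD; ring.
  rewrite -(big_mkord xpredT (fun l => a l * e%:C ^+ l * (\sum_(j < M) z ^+ (j * (l + (M - k)))))).
  rewrite (big_cat_nat (n := M)) //= ?leq_maxl //; congr (_ + _).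
  rewrite big_mkord (bigD1 (Ordinal Mk)) //= (prim_root_sum _ hz).
  rewrite subnKC ?(ltnW Mk) // dvdnn [LHS]addrC big1 ?add0r; first by rewrite mulrC.
  move=> l lk; rewrite (prim_root_sum _ hz) ifF ?mulr0 //.
  apply/negP => /dvdnP [c hc].
  have lM := ltn_ord l; have : (nat_of_ord l != k)%N by apply: contra lk => lk; apply/eqP/val_inj/eqP.
  case: c hc => [|[|c]]; rewrite ?mul0n ?mul1n.
  - move/eqP; rewrite addn_eq0 subn_eq0 leqNgt Mk andbF //.
  - by move=> h; rewrite -(eqn_add2r (M - k)) h subnKC ?eqxx // ltnW.
  - move=> h; have : (l + (M - k) < M + M)%N by rewrite -addSn leq_add ?leq_subr.
    by rewrite h !mulSn addnA ltnNge leq_addr.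
have tail : cmod (\sum_(M <= l < L) a l * e%:C ^+ l *
     (\sum_(j < M) z ^+ (j * (l + (M - k))))) <= M%:R * (q ^+ M / (1 - q)).
  apply: le_trans (cmod_sum _ _ _) _.
  apply: le_trans (ler_wpM2l (ler0n _ _) (geo_tail M L q01)).
  rewrite mulr_sumr big_nat_cond [leRHS]big_nat_cond; apply: ler_sum => l.
  rewrite andbT => /andP[Ml _].
  rewrite cmodM mulrC; apply: ler_pM; rewrite ?cmod_ge0 //.
    rewrite (prim_root_sum _ hz); case: ifP => _; rewrite ?cmod_nat ?cmod0 ?ler0n //.
  by rewrite cmodM cmodX cmodR gtr0_norm //; apply: hN; apply: leq_trans Ml.
have MR : 0 < (M%:R : R) by rewrite ltr0n.
rewrite -(ler_pM2l MR) mulrDr.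
have -> : M%:R * (cmod (a k) * e ^+ k) = cmod (M%:R * (a k * e%:C ^+ k)).
  by rewrite !cmodM cmod_nat cmodX cmodR gtr0_norm.
move: eT tail; set Z := \sum_(M <= l < L) _ => eT tail.
have -> : M%:R * (a k * e%:C ^+ k) = (T - T') + T' - Z by rewrite eT; ring.
apply: le_trans (cmodD _ _) _; rewrite cmodN.
have h1 := cmodD (T - T') T'.
have h2 : M%:R * (q ^+ M / (1 - q)) <= M%:R * (eps / 2).
  by rewrite ler_pM2l // ltW.
have h3 : M%:R * eps = eps / 2 * M%:R + M%:R * (eps / 2) by field.
rewrite h3; lra.
Qed.

End PowerSeries.

(** * Limits of power series and the identity theorem *)

Section Analytic.
Variable R : realType.
Notation C := R[i].
Implicit Types (f g : C -> C) (s z w : C) (a b : nat -> C) (e E B : R).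

(** Weierstrass' theorem. By Cauchy's estimate the uniform rate tau also governs the
coefficients, and the ratio |s - s0| / e < 1 sums the errors over all the coefficients. *)
Lemma ps_unif_limit (F : nat -> C -> C) f (s0 : C) (a : nat -> nat -> C) E (tau : nat -> R) N0 :
  0 < E -> (forall N, has_ps (F N) s0 (a N) E) ->
  (forall s N N', cmod (s - s0) < E -> (N0 <= N)%N -> (N <= N')%N ->
     cmod (F N' s - F N s) <= tau N) ->
  tau @ \oo --> (0 : R) ->
  (forall s, cmod (s - s0) < E -> climit (fun N => F N s) (f s)) ->
  exists A, has_ps f s0 A E /\ forall k, climit (fun N => a N k) (A k).
Proof.
move=> E0 hF hC htau hf.
have est e N N' k : 0 < e -> e < E -> (N0 <= N)%N -> (N <= N')%N ->
    cmod (a N' k - a N k) * e ^+ k <= tau N.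
  move=> e0 eE hN hN'.
  apply: (cauchy_estimate (has_psB (hF N') (hF N)) e0 eE) => s hs.
  exact: hC.
have /choice [A hA] : forall k, exists l, climit (fun N => a N k) l.
  move=> k; have E2 : 0 < E / 2 by rewrite divr_gt0.
  apply: (@climit_cauchy _ _ (fun N => tau N * ((E / 2) ^+ k)^-1) N0).
    move=> n m hn hm; rewrite ler_pdivlMr ?exprn_gt0 //.
    by apply: est => //; lra.
  rewrite -[X in _ --> X](mul0r ((E / 2) ^+ k)^-1).
  by apply: cvgM => //; exact: cvg_cst.
exists A; split=> // s hs.
set h := s - s0 in hs *.
pose e := (cmod h + E) / 2.
have h0 := cmod_ge0 h.
have e0 : 0 < e by rewrite /e divr_gt0 // ltr_wpDl.
have eE : e < E by rewrite /e; lra.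
have he : cmod h < e by rewrite /e; lra.
pose q := cmod h / e.
have q01 : 0 <= q < 1 by rewrite divr_ge0 ?(ltW e0) //= ltr_pdivrMr // mul1r.
have est2 N k : (N0 <= N)%N -> cmod (A k - a N k) * e ^+ k <= tau N.
  move=> hN; rewrite -ler_pdivlMr ?exprn_gt0 //.
  apply: (climit_le (N0 := N) (climitB (hA k) (climit_cst _))) => N' hN' /=.
  by rewrite ler_pdivlMr ?exprn_gt0 //; apply: est.
have est3 N : (N0 <= N)%N -> cmod (f s - F N s) <= tau N.
  move=> hN; apply: (climit_le (N0 := N) (climitB (hf s hs) (climit_cst _))) => N' hN' /=.
  exact: hC.
move=> eps eps0.
have p0 : 0 < 1 - q by case/andP: q01 => _; rewrite subr_gt0.
pose d := eps / 2 / ((1 - q)^-1 + 1).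
have d1 : 0 < (1 - q)^-1 + 1 by rewrite ltr_wpDl ?invr_ge0 // ltW.
have d0 : 0 < d by rewrite !divr_gt0.
move/cvgrPdist_lt : htau => /(_ _ d0) [N1 _ hN1].
pose N := maxn N0 N1.
have tN : tau N < d.
  have := hN1 N (leq_maxr _ _); rewrite /= sub0r normrN; apply: le_lt_trans.
  exact: ler_norm.
have t0 : 0 <= tau N by apply: le_trans (est3 N (leq_maxl _ _)); apply: cmod_ge0.
have e20 : 0 < eps / 2 by rewrite divr_gt0.
have [K0 hK0] := hF N s hs _ e20.
exists K0 => K /hK0 hK.
have -> : \sum_(k < K) A k * h ^+ k - f s =
   \sum_(k < K) (A k - a N k) * h ^+ k + (\sum_(k < K) a N k * h ^+ k - F N s)
   + (F N s - f s).
  have -> : \sum_(k < K) (A k - a N k) * h ^+ k =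
     \sum_(k < K) A k * h ^+ k - \sum_(k < K) a N k * h ^+ k.
    by rewrite -sumrB; apply: eq_bigr => k _; rewrite mulrBl.
  ring.
apply: le_lt_trans (cmodD3 _ _ _) _.
have b1 : cmod (\sum_(k < K) (A k - a N k) * h ^+ k) <= tau N * (1 - q)^-1.
  apply: le_trans (cmod_sum _ _ _) _.
  have := geo_tail 0 K q01; rewrite expr0 mul1r => g.
  apply: le_trans (ler_wpM2l t0 g); rewrite big_mkord mulr_sumr.
  apply: ler_sum => k _; rewrite cmodM cmodX.
  have -> : cmod h ^+ k = e ^+ k * q ^+ k.
    by rewrite -exprMn /q mulrCA mulfV ?mulr1 // gt_eqF.
  rewrite mulrA ler_wpM2r ?exprn_ge0 //; first by case/andP: q01.
  by apply: est2; rewrite leq_maxl.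
have b2 := est3 N (leq_maxl _ _); rewrite cmodB in b2.
have b3 : tau N * ((1 - q)^-1 + 1) < eps / 2 by rewrite -ltr_pdivlMr.
rewrite mulrDr mulr1 in b3; lra.
Qed.

Lemma ps_remainder f (s0 : C) a E m : 0 < E -> has_ps f s0 a E ->
  exists B d : R, [/\ 0 <= B, 0 < d, d <= E & forall s, cmod (s - s0) < d ->
    cmod (f s - \sum_(k < m) a k * (s - s0) ^+ k) <= B * cmod (s - s0) ^+ m].
Proof.
move=> E0 hf; pose e := E / 2.
have [e0 eE] : 0 < e /\ e < E by rewrite /e; split; lra.
have [B B0 hB] : exists2 B : R, 0 <= B & forall l, cmod (a l) * e ^+ l <= B.
  have h1 : cmod (s0 + e%:C - s0) < E by rewrite addrC addKr cmodR gtr0_norm.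
  have := climitB (climit_shift (hf _ h1)) (hf _ h1).
  rewrite subrr => /(_ _ (@ltr01 R)) [N hN].
  have S0 : 0 <= \sum_(l < N) cmod (a l) * e ^+ l.
    by apply: sumr_ge0 => l _; rewrite mulr_ge0 ?cmod_ge0 ?exprn_ge0 // ltW.
  exists (1 + \sum_(l < N) cmod (a l) * e ^+ l) => [|l]; first by rewrite addr_ge0.
  have [/hN|lN] := leqP N l.
    rewrite big_ord_recr /= subr0 [X in cmod X]addrAC subrr add0r (addrC s0) addrK.
    rewrite cmodM cmodX cmodR gtr0_norm // => /ltW h.
    by rewrite -[leLHS]addr0 lerD.
  rewrite (bigD1 (Ordinal lN)) //= addrCA -[leLHS]addr0 lerD2l addr_ge0 //.
  by apply: sumr_ge0 => j _; rewrite mulr_ge0 ?cmod_ge0 ?exprn_ge0 // ltW.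
exists (B / e ^+ m * 2), (e / 2); split=> [|||s hs].
- by rewrite mulr_ge0 // divr_ge0 // exprn_ge0 // ltW.
- by rewrite divr_gt0.
- by rewrite /e; lra.
have hsE : cmod (s - s0) < E by apply: lt_trans hs _; rewrite /e; lra.
apply: (climit_le (N0 := m) (climitB (hf s hsE) (climit_cst _))) => K mK.
set h := s - s0 in hs *.
rewrite -(big_mkord xpredT (fun k => a k * h ^+ k)) (big_cat_nat (n := m)) //= big_mkord.
rewrite [X in cmod X]addrAC subrr add0r; apply: le_trans (cmod_sum _ _ _) _.
pose q := cmod h / e.
have q0 : 0 <= q by rewrite divr_ge0 ?cmod_ge0 // ltW.
have q2 : q <= 2^-1 by rewrite ler_pdivrMr // mulrC ltW.
have q01 : 0 <= q < 1 by rewrite q0 /=; lra.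
have hq k : cmod h ^+ k = q ^+ k * e ^+ k.
  by rewrite -exprMn /q divfK // gt_eqF.
have -> : B / e ^+ m * 2 * cmod h ^+ m = B * (q ^+ m * 2).
  by rewrite hq; field; rewrite gt_eqF // exprn_gt0.
apply: le_trans (_ : B * (q ^+ m / (1 - q)) <= _); last first.
  rewrite ler_wpM2l // ler_wpM2l ?exprn_ge0 // -[leRHS]invrK lef_pV2 ?posrE; lra.
apply: le_trans (ler_wpM2l B0 (geo_tail m K q01)); rewrite mulr_sumr.
apply: ler_sum => k _; rewrite cmodM cmodX hq mulrCA mulrC.
by rewrite ler_wpM2r ?exprn_ge0.
Qed.

Lemma ps_derive1 f (s0 : C) a E : 0 < E -> has_ps f s0 a E ->
  derive1 (f : C^o -> C^o) s0 = a 1%N.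
Proof.
move=> E0 hf; have [B [d [B0 d0 _ hB]]] := ps_remainder 2 E0 hf.
rewrite /derive1; apply/cvg_lim; first exact: norm_hausdorff.
apply/cvgrPdist_le => /= eps eps0.
have epsR : eps = (complex.Re eps)%:C by rewrite RRe_real ?gtr0_real.
have eps1 : 0 < complex.Re eps by rewrite -ltcR -epsR.
pose d' := Num.min d (complex.Re eps / (B + 1)).
have d'0 : 0 < d' by rewrite lt_min d0 divr_gt0 // ltr_wpDl.
have d'C : 0 < d'%:C :> C by rewrite ltcR.
exists d'%:C => //= h; rewrite /ball_ /= sub0r normrN => hh h0.
rewrite epsR -cmodC lecR.
have {hh} : cmod h < d' by rewrite -ltcR cmodC.
rewrite lt_min => /andP[hd he].
have hs : cmod (h + s0 - s0) < d by rewrite addrK.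
have := hB _ hs; rewrite addrK !big_ord_recl big_ord0 /= expr0 mulr1 addr0 expr1.
rewrite -(has_ps_coef0 E0 hf) => hle.
have hp : 0 < cmod h by rewrite cmod_gt0.
have -> : a 1%N - h^-1 *: (f (h + s0) - f s0) =
   - (h^-1 * (f (h + s0) - (f s0 + a 1%N * h))).
  by rewrite /GRing.scale /=; field.
rewrite cmodN cmodM cmodV mulrC ler_pdivrMr //; apply: le_trans hle _.
rewrite expr2 mulrA ler_wpM2r ?cmod_ge0 //.
apply: le_trans (_ : (B + 1) * cmod h <= _); first by rewrite ler_wpM2r ?cmod_ge0 // lerDl.
by rewrite mulrC -ler_pdivlMr ?ltr_wpDl // ltW.
Qed.

(** Otherwise the first nonzero term would dominate the remainder near s0. *)
Lemma ps_zero f (s0 : C) a E : 0 < E -> has_ps f s0 a E ->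
  (forall d, 0 < d -> exists s, [/\ s != s0, cmod (s - s0) < d & f s = 0]) ->
  forall k, a k = 0.
Proof.
move=> E0 hf hz k; elim/ltn_ind: k => k IH.
have [B [d [B0 d0 _ hB]]] := ps_remainder k.+1 E0 hf.
apply/eqP; rewrite -cmod_eq0 eq_le cmod_ge0 andbT.
apply/ler_addgt0Pr => eps eps0; rewrite add0r.
have d'0 : 0 < Num.min d (eps / (B + 1)) by rewrite lt_min d0 divr_gt0 // ltr_wpDl.
have [s [ss0]] := hz _ d'0; rewrite lt_min => /andP[hd he] fs0.
have := hB s hd; rewrite fs0 sub0r cmodN big_ord_recr /= big1 ?add0r; last first.
  by move=> i _; rewrite IH ?mul0r.
have hp : 0 < cmod (s - s0) by rewrite cmod_gt0 subr_eq0.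
rewrite cmodM cmodX exprS mulrA ler_pM2r ?exprn_gt0 // => h; apply: le_trans h _.
apply: le_trans (_ : (B + 1) * cmod (s - s0) <= _); first by rewrite ler_wpM2r ?cmod_ge0 // lerDl.
by rewrite mulrC -ler_pdivlMr ?ltr_wpDl // ltW.
Qed.

Lemma ps_zero_fun f (s0 : C) a E : has_ps f s0 a E -> (forall k, a k = 0) ->
  forall s, cmod (s - s0) < E -> f s = 0.
Proof.
move=> hf a0 s hs; apply: (climit_unique (hf s hs)).
apply: (@climit_eq_from _ 0 _ _ _ _ (climit_cst 0)) => K _.
by rewrite big1 // => k _; rewrite a0 mul0r.
Qed.

Definition near_zero f (s0 : C) := exists2 d : R, 0 < d & forall s, cmod (s - s0) < d -> f s = 0.

(** Let T be the supremum of the times up to which f vanishes around the points of the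
segment. The point at time T is a limit of zeros, so f vanishes around it by [ps_zero]; unless
T = 1, this covers some later times. *)
Lemma identity_segment f (p : C) : p != 0 ->
  (forall t : R, 0 <= t <= 1 -> analytic_at f (t%:C * p)) ->
  near_zero f p -> near_zero f 0.
Proof.
move=> p0 han hp.
pose g (t : R) := ((1 - t)%:C * p).
have gB t u : g t - g u = (u - t)%:C * p.
  by rewrite /g -mulrBl -rmorphB; congr (_%:C * _); ring.
have pp : 0 < cmod p by rewrite cmod_gt0.
have gd t u : cmod (g t - g u) = `|t - u| * cmod p.
  by rewrite gB cmodM cmodR distrC.
have hg t : 0 <= t <= 1 -> analytic_at f (g t).
  by move=> /andP[t0 t1]; apply: han; rewrite subr_ge0 t1 lerBlDr lerDl.
pose S := [set t : R | 0 <= t <= 1 /\ forall u, 0 <= u <= t -> near_zero f (g u)].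
have S0 : S 0.
  split=> [|u]; first by rewrite lexx ler01.
  by rewrite -eq_le => /eqP <-; rewrite /g subr0 mul1r.
have Sub : has_ubound S by exists 1 => t [/andP[]].
have hS : has_sup S by split; [exists 0|].
pose T := sup S.
have T01 : 0 <= T <= 1.
  apply/andP; split; first exact: (ub_le_sup Sub).
  by apply: ge_sup; [exists 0|move=> t [/andP[]]].
have belowT u : 0 <= u < T -> near_zero f (g u).
  move=> /andP[u0 uT].
  have e0 : 0 < T - u by rewrite subr_gt0.
  have [t [_ ht] hlt] := sup_adherent e0 hS.
  apply: ht; rewrite u0 /=; apply: ltW; move: hlt; rewrite -/T; lra.
have nzT : near_zero f (g T).
  have [T0|T0] := eqVneq T 0; first by rewrite T0 /g subr0 mul1r.
  have Tp : 0 < T by rewrite lt_def T0; case/andP: T01.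
  have [a [E [E0 hps]]] := proj1 (analytic_atE _ _) (hg T T01).
  exists E => // s hs; apply: (ps_zero_fun hps) hs.
  apply: (ps_zero E0 hps) => d d0.
  pose e := Num.min (T / 2) (d / 2 / cmod p).
  have e0 : 0 < e by rewrite lt_min !divr_gt0.
  have [eT ed] : e <= T / 2 /\ e <= d / 2 / cmod p by rewrite !ge_min !lexx orbT.
  exists (g (T - e)); have nz := gd (T - e) T; rewrite addrAC subrr add0r normrN gtr0_norm // in nz.
  split.
  - by rewrite -subr_eq0 -cmod_gt0 nz mulr_gt0.
  - by rewrite nz; move: ed; rewrite ler_pdivlMr //; lra.
  - have [d1 d10] : near_zero f (g (T - e)) by apply: belowT; lra.
    by apply; rewrite subrr cmod0.
have T1 : T = 1.
  apply/eqP; rewrite eq_le; case/andP: T01 => T0 -> /=; rewrite leNgt; apply/negP => T1.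
  have [d d0 hd] := nzT.
  pose e := Num.min (1 - T) (d / 2 / cmod p).
  have e0 : 0 < e by rewrite lt_min subr_gt0 T1 /= !divr_gt0.
  have [eT ed] : e <= 1 - T /\ e <= d / 2 / cmod p by rewrite !ge_min !lexx orbT.
  suff hSe : S (T + e).
    have : T + e <= T by apply: (ub_le_sup Sub).
    by rewrite gerDl leNgt e0.
  split=> [|u /andP[u0 uTe]]; first by lra.
  have [uT|Tu] := ltP u T; first by apply: belowT; rewrite u0.
  exists (d / 2) => [|s hs]; first by rewrite divr_gt0.
  apply: hd; apply: le_lt_trans (cmod_subD _ _ (g u)) _.
  have : cmod (g u - g T) <= d / 2.
    rewrite gd -ler_pdivlMr // ger0_norm ?subr_ge0 //; lra.
  by lra.
by move: nzT; rewrite T1 /g subrr mul0r.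
Qed.

Definition shift_coef a (k : nat) : C := if k is k'.+1 then a k' else 0.

Lemma has_ps_mulX f (s0 : C) a E : has_ps f s0 a E ->
  has_ps (fun s => (s - s0) * f s) s0 (shift_coef a) E.
Proof.
move=> hf s hs.
have h := climitMl (s - s0) (hf s hs).
have h2 : climit (fun K => \sum_(k < K.+1) shift_coef a k * (s - s0) ^+ k)
   ((s - s0) * f s).
  apply: (@climit_eq_from _ 0 _ _ _ _ h) => K _.
  rewrite big_ord_recl /= mul0r add0r mulr_sumr; apply: eq_bigr => k _.
  by rewrite /= /bump /= add1n exprS; ring.
move=> e e0; have [N hN] := h2 e e0; exists N.+1 => -[//|n] hn; exact: hN.
Qed.

(** Expand 1 / (c - s) as a geometric series in (s - s0) / (c - s0): the partial sums times f
are power series, and they converge uniformly. *)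
Lemma has_ps_div f (s0 c : C) a E B : 0 < E -> E < cmod (c - s0) ->
  has_ps f s0 a E -> (forall s, cmod (s - s0) < E -> cmod (f s) <= B) ->
  exists b, has_ps (fun s => f s / (c - s)) s0 b E.
Proof.
move=> E0 Ec hf hB.
have cp : 0 < cmod (c - s0) by apply: lt_trans Ec.
have c0 : c - s0 != 0 by rewrite -cmod_gt0.
pose q := E / cmod (c - s0).
have q01 : 0 <= q < 1 by rewrite divr_ge0 ?ltW //= ltr_pdivrMr // mul1r.
have B0 : 0 <= B by apply: le_trans (cmod_ge0 _) (hB s0 _); rewrite subrr cmod0.
have hj j : exists b, has_ps (fun s => (s - s0) ^+ j / (c - s0) ^+ j.+1 * f s) s0 b E.
  suff [b hb] : exists b, has_ps (fun s => (s - s0) ^+ j * f s) s0 b E.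
    eexists; apply: has_ps_ext (has_psMl ((c - s0) ^+ j.+1)^-1 hb) => s _; ring.
  elim: j => [|j [b hb]]; first by exists a; apply: has_ps_ext hf => s _; rewrite mul1r.
  eexists; apply: has_ps_ext (has_ps_mulX hb) => s _; by rewrite exprS mulrA.
have [b hb] := choice hj.
pose F N s := \sum_(j < N) (s - s0) ^+ j / (c - s0) ^+ j.+1 * f s.
have hF N : has_ps (F N) s0 (fun k => \sum_(j < N) b j k) E.
  exact: (@has_ps_sum _ _ (index_enum 'I_N)
    (fun j s => (s - s0) ^+ j / (c - s0) ^+ j.+1 * f s) s0 (fun j => b j) E (fun j => hb j)).
pose tau N := q ^+ N * ((1 - q)^-1 * (B / cmod (c - s0))).
have hC s N N' : cmod (s - s0) < E -> (0 <= N)%N -> (N <= N')%N ->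
     cmod (F N' s - F N s) <= tau N.
  move=> hs _ NN; rewrite /F.
  rewrite -(big_mkord xpredT (fun j => (s - s0) ^+ j / (c - s0) ^+ j.+1 * f s)).
  rewrite (big_cat_nat (n := N)) //= big_mkord [X in cmod X]addrAC subrr add0r.
  apply: le_trans (cmod_sum _ _ _) _; rewrite /tau mulrA.
  apply: le_trans (ler_wpM2r _ (geo_tail N N' q01)); last by rewrite divr_ge0 ?cmod_ge0.
  rewrite mulr_suml; apply: ler_sum => j _.
  rewrite !cmodM cmodV !cmodX exprS.
  have -> : q ^+ j * (B / cmod (c - s0)) = E ^+ j / (cmod (c - s0) * cmod (c - s0) ^+ j) * B.
    by rewrite /q expr_div_n; field; rewrite expf_neq0 gt_eqF.
  apply: ler_pM; rewrite ?cmod_ge0 ?divr_ge0 ?mulr_ge0 ?exprn_ge0 ?cmod_ge0 //; last exact: hB.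
  rewrite ler_wpM2r ?invr_ge0 ?mulr_ge0 ?exprn_ge0 ?cmod_ge0 //.
  by rewrite lerXn2r ?nnegrE ?cmod_ge0 ?ltW.
have hlim s : cmod (s - s0) < E -> climit (fun N => F N s) (f s / (c - s)).
  move=> hs; pose x := (s - s0) / (c - s0).
  have x1 : cmod x < 1.
    by rewrite cmodM cmodV ltr_pdivrMr // mul1r; apply: lt_trans Ec.
  have cs : c - s != 0.
    apply/eqP => e; move: Ec; rewrite (_ : c = s); first by rewrite ltNge ltW.
    by apply/eqP; rewrite -subr_eq0 e.
  apply: (@climit_squeeze _ 0 _ _ (fun N => cmod x ^+ N * (cmod (f s) / cmod (c - s)))).
    move=> N _; rewrite -cmodX -cmodV -!cmodM -cmodN le_eqVlt; apply/orP; left; apply/eqP.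
    congr cmod; rewrite /F -mulr_suml.
    have e1 : \sum_(j < N) (s - s0) ^+ j / (c - s0) ^+ j.+1 = (1 - x ^+ N) / (c - s).
      have e2 : (x - 1) * \sum_(j < N) x ^+ j = x ^+ N - 1 by rewrite -subrX1.
      have e3 : x - 1 = - ((c - s) / (c - s0)) by rewrite /x; field.
      apply: (mulIf cs); rewrite divfK // -[RHS]opprB -e2 e3 mulNr opprK.
      rewrite mulrC -mulrA; congr (_ * _); rewrite mulr_sumr; apply: eq_bigr => j _.
      by rewrite /x expr_div_n exprS; field; rewrite expf_neq0.
    by rewrite e1; field.
  apply: geo_cvg0; by rewrite cmod_ge0.
have [A [hA _]] := ps_unif_limit E0 hF hC (geo_cvg0 _ q01) hlim.
by exists A.
Qed.

End Analytic.

(** * Sequences with summable increments, complex powers *)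

Section Growth.
Variable R : realType.
Notation C := R[i].
Implicit Types (s z w y p : C) (e E B : R).

Lemma exists_nat_ge (K : R) : exists m0, forall m, (m0 <= m)%N -> K <= m%:R.
Proof.
exists (Num.trunc K).+1 => m hm; apply: le_trans (_ : (Num.trunc K).+1%:R <= _); last by rewrite ler_nat.
by apply/ltW/truncnS_gt.
Qed.

Lemma expR_ln_cvg0 (d : R) : 0 < d ->
  (fun m => expR (- d * ln m.+1%:R)) @ \oo --> (0 : R).
Proof.
move=> d0; apply/cvgrPdist_lt => e e0.
have [m0 hm0] := exists_nat_ge (expR (- (ln e / d))).
exists m0 => // m /= hm; rewrite sub0r normrN gtr0_norm ?expR_gt0 //.
rewrite -[ltRHS](lnK (x := e)) ?posrE // ltr_expR mulNr ltrNl.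
rewrite mulrC -ltr_pdivrMr // mulNr.
have h1 : expR (- (ln e / d)) < m.+1%:R by apply: le_lt_trans (hm0 m hm) _; rewrite ltr_nat.
by rewrite -[ltLHS]expRK ltr_ln ?posrE ?expR_gt0 ?ltr0n.
Qed.

(** Powers of integers are written with [expR] and [ln]: this compares (m + 1) ^ (- 1 - d)
with the increment of - m ^ (- d) / d, which makes errors of that size summable. *)
Lemma telescope_bound (d : R) m : 0 < d -> (0 < m)%N ->
  expR (- (1 + d) * ln m.+1%:R) <=
  (expR (- d * ln m%:R) - expR (- d * ln m.+1%:R)) / d.
Proof.
move=> d0 m0; rewrite ler_pdivlMr //.
have mp : 0 < (m%:R : R) by rewrite ltr0n.
have mp1 : 0 < (m.+1%:R : R) by rewrite ltr0n.
set L := ln m%:R; set L' := ln m.+1%:R.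
have hL : (m.+1%:R : R)^-1 <= L' - L.
  have : -1 < - (m.+1%:R : R)^-1 by rewrite ltrN2 invf_lt1 // ltr1n.
  move=> /le_ln1Dx.
  have -> : 1 + - (m.+1%:R : R)^-1 = m%:R / m.+1%:R.
    by rewrite -natr1; field; rewrite natr1 gt_eqF.
  by rewrite ln_div ?posrE // lerNr opprB.
have -> : - d * L = - d * L' + d * (L' - L) by ring.
have -> : - (1 + d) * L' = - L' + - d * L' by ring.
rewrite !expRD expRN lnK ?posrE //.
have h1 := expR_ge1Dx (d * (L' - L)).
have h2 : d * m.+1%:R^-1 <= d * (L' - L) by rewrite ler_wpM2l // ltW.
have h3 : d * m.+1%:R^-1 <= expR (d * (L' - L)) - 1.
  by rewrite lerBrDl; apply: le_trans h1; rewrite lerD2l.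
have -> : expR (- d * L') * expR (d * (L' - L)) - expR (- d * L') =
  expR (- d * L') * (expR (d * (L' - L)) - 1) by ring.
have -> : m.+1%:R^-1 * expR (- d * L') * d = expR (- d * L') * (d * m.+1%:R^-1).
  by rewrite mulrAC mulrC [_^-1 * d]mulrC.
by rewrite ler_wpM2l ?expR_ge0.
Qed.

Section SeqLimit.
Variables (F : nat -> C -> C) (s0 : C) (E B d : R) (m0 : nat) (a : nat -> nat -> C).
Hypotheses (E0 : 0 < E) (d0 : 0 < d) (B0 : 0 <= B).
Hypothesis hF : forall N, has_ps (F N) s0 (a N) E.
Hypothesis hI : forall s m, cmod (s - s0) < E -> (m0 <= m)%N ->
  cmod (F m.+1 s - F m s) <= B * expR (- (1 + d) * ln m.+1%:R).

Let tau N := B / d * expR (- d * ln N%:R).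

Let hC s N N' : cmod (s - s0) < E -> (maxn 1 m0 <= N)%N -> (N <= N')%N ->
  cmod (F N' s - F N s) <= tau N.
Proof.
move=> hs; rewrite geq_max => /andP[N0 mN] NN'.
suff : cmod (F N' s - F N s) <= B / d * (expR (- d * ln N%:R) - expR (- d * ln N'%:R)).
  move=> h; apply: le_trans h _; rewrite /tau ler_wpM2l ?divr_ge0 ?(ltW d0) //.
  by rewrite gerBl expR_ge0.
elim: N' NN' => [|N' IH]; first by rewrite leqn0 => /eqP ->; rewrite !subrr cmod0 mulr0.
rewrite leq_eqVlt => /orP[/eqP <-|NN']; first by rewrite !subrr cmod0 mulr0.
have h1 := IH NN'.
have h2 := hI hs (leq_trans mN NN').
have h3 := telescope_bound d0 (leq_trans N0 NN').
have h4 := ler_wpM2l B0 h3.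
apply: le_trans (cmod_subD _ _ (F N' s)) _.
have -> : B / d * (expR (- d * ln N%:R) - expR (- d * ln N'.+1%:R)) =
   B * ((expR (- d * ln N'%:R) - expR (- d * ln N'.+1%:R)) / d) +
   B / d * (expR (- d * ln N%:R) - expR (- d * ln N'%:R)).
  by field; rewrite gt_eqF.
by apply: lerD => //; apply: le_trans h2 h4.
Qed.

Let htau : tau @ \oo --> (0 : R).
Proof.
rewrite -[X in _ --> X](mulr0 (B / d)); apply: cvgM; first exact: cvg_cst.
apply/cvgrPdist_lt => e e0; have /cvgrPdist_lt /(_ e e0) [N _ hN] := expR_ln_cvg0 d0.
by exists N.+1 => // -[//|n] hn; apply: hN.
Qed.

Lemma seq_limit_ex s : cmod (s - s0) < E -> exists l, climit (fun N => F N s) l.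
Proof.
move=> hs; apply: (@climit_cauchy _ _ tau (maxn 1 m0)) => // n m hn hm; exact: hC.
Qed.

Lemma seq_limit_ps f : (forall s, cmod (s - s0) < E -> climit (fun N => F N s) (f s)) ->
  exists A, has_ps f s0 A E /\ forall k, climit (fun N => a N k) (A k).
Proof. by move=> hf; apply: (ps_unif_limit E0 hF hC htau hf). Qed.

End SeqLimit.

Lemma cpowD y p q : cpow y (p + q) = cpow y p * cpow y q.
Proof. by rewrite !cpowE mulrDl cexpD. Qed.

Lemma cpow_nat y k : y != 0 -> cpow y k%:R = y ^+ k.
Proof. by move=> y0; rewrite cpowE mulr_natl cexpMn clogK. Qed.

Lemma carg_le_pi y : `|carg y| <= pi.
Proof. by rewrite norm_carg acos_lepi // Re_div_cmod. Qed.

Lemma cmod_cpow_le y p P : cmod p <= P ->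
  cmod (cpow y p) <= expR (pi * P) * expR (complex.Re p * ln (cmod y)).
Proof.
move=> hP; rewrite cpowE cmod_cexp -expRD ler_expR ReM /= [leRHS]addrC lerD2l.
apply: le_trans (ler_norm _) _; rewrite normrN normrM mulrC.
apply: ler_pM => //; first exact: carg_le_pi.
exact: le_trans (Im_le_cmod _) hP.
Qed.

Lemma has_ps_cpow y (c s0 : C) E : exists a,
  has_ps (fun s => cpow y (c - s)) s0 a E.
Proof.
have h := has_psMl (cexp (c * clog y)) (@has_ps_cexp R (- clog y) s0 E).
eexists; apply: has_ps_ext h => s _; rewrite cpowE -cexpD; congr cexp; ring.
Qed.

Lemma has_ps_cpow_div y (c c' s0 : C) E : 0 < E -> E < cmod (c' - s0) -> exists a,
  has_ps (fun s => cpow y (c - s) / (c' - s)) s0 a E.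
Proof.
move=> E0 Ec; have [a ha] := has_ps_cpow y c s0 E.
apply: (has_ps_div (B := expR ((cmod c + cmod s0 + E) * cmod (clog y))) E0 Ec ha) => s hs.
rewrite cpowE; apply: le_trans (cmod_cexp_le _) _; rewrite ler_expR cmodM.
rewrite ler_wpM2r ?cmod_ge0 //; apply: le_trans (cmodD _ _) _.
rewrite cmodN -addrA lerD2l.
by have := cmod_subD s 0 s0; rewrite !subr0; lra.
Qed.

(** Stays on the principal branch by [clogM1p]. *)
Lemma cpow_shift y w p : y != 0 -> cmod (w / y) <= 2^-1 ->
  `|carg y| + 2 * cmod (w / y) < pi ->
  cpow (y + w) p = cpow y p * cexp (p * clog1p (w / y)).
Proof.
move=> y0 h1 h2; have -> : y + w = y * (1 + w / y) by field.
by rewrite !cpowE clogM1p // mulrDr cexpD.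
Qed.

End Growth.

(** * Euler-Maclaurin corrections *)

Section EulerMaclaurin.
Variable R : realType.
Notation C := R[i].
Implicit Types (s z w y p : C).

(** Approximate sum of y ^ (- s) over y, y + w, y + 2 w, ... (Euler-Maclaurin): the
coefficients are those of t^-1 and t^0 in 1 / (1 - exp (- w t)). *)
Definition phi1 w s y : C :=
  - w^-1 * (cpow y (1 - s) / (1 - s)) + 2^-1 * cpow y (- s).

(** Approximate sum of y ^ (- s) over the quarter plane y + n1 w1 + n2 w2: the coefficients are
those of t^-2, t^-1 and t^0 in 1 / ((1 - exp (- w1 t)) (1 - exp (- w2 t))). *)
Definition phi2 (w1 w2 : C) s y : C :=
  (w1 * w2)^-1 * (cpow y (2 - s) / ((1 - s) * (2 - s)))
  - (w1 + w2) / (2 * (w1 * w2)) * (cpow y (1 - s) / (1 - s))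
  + (w1 ^+ 2 + 3 * (w1 * w2) + w2 ^+ 2) / (12 * (w1 * w2)) * cpow y (- s).

(** What [phi1] misses of the first term of its sum. *)
Definition err1 w s y : C := cpow y (- s) - (phi1 w s y - phi1 w s (y + w)).

(** What [phi2] misses of the corner of its quarter plane, isolated by inclusion and exclusion. *)
Definition err2 (w1 w2 : C) s y : C := cpow y (- s) -
  (phi2 w1 w2 s y - phi2 w1 w2 s (y + w1) - phi2 w1 w2 s (y + w2)
   + phi2 w1 w2 s (y + (w1 + w2))).

Lemma binrem2E p z : cexp (p * clog1p z) = 1 + p * z + binrem 2 p z.
Proof. by rewrite /binrem !big_ord_recr big_ord0 /=; field. Qed.

Lemma binrem3E p z : cexp (p * clog1p z) =
  1 + p * z + p * (p - 1) / 2 * z ^+ 2 + binrem 3 p z.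
Proof. by rewrite /binrem !big_ord_recr big_ord0 /=; field. Qed.

Lemma binrem4E p z : cexp (p * clog1p z) =
  1 + p * z + p * (p - 1) / 2 * z ^+ 2 + p * (p - 1) * (p - 2) / 6 * z ^+ 3
  + binrem 4 p z.
Proof. by rewrite /binrem !big_ord_recr big_ord0 /=; field. Qed.

Lemma binrem5E p z : cexp (p * clog1p z) =
  1 + p * z + p * (p - 1) / 2 * z ^+ 2 + p * (p - 1) * (p - 2) / 6 * z ^+ 3
  + p * (p - 1) * (p - 2) * (p - 3) / 24 * z ^+ 4 + binrem 5 p z.
Proof. by rewrite /binrem !big_ord_recr big_ord0 /=; field. Qed.

Lemma cpow_1B y s : y != 0 -> cpow y (1 - s) = y * cpow y (- s).
Proof. by move=> y0; rewrite cpowD (@cpow_nat _ y 1) // expr1. Qed.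

Lemma cpow_2B y s : y != 0 -> cpow y (2 - s) = y ^+ 2 * cpow y (- s).
Proof. by move=> y0; rewrite cpowD (@cpow_nat _ y 2). Qed.

Section Err.
Variables (w1 w2 y s : C).
Hypotheses (w10 : w1 != 0) (w20 : w2 != 0) (y0 : y != 0) (s1 : 1 - s != 0) (s2 : 2 - s != 0).
Hypothesis small : cmod (w1 / y) + cmod (w2 / y) <= 2^-1.
Hypothesis angle : `|carg y| + 2 * (cmod (w1 / y) + cmod (w2 / y)) < pi.

Let sm1 : cmod (w1 / y) <= 2^-1.
Proof. by apply: le_trans small; rewrite lerDl cmod_ge0. Qed.
Let sm2 : cmod (w2 / y) <= 2^-1.
Proof. by apply: le_trans small; rewrite lerDr cmod_ge0. Qed.
Let sm12 : cmod ((w1 + w2) / y) <= 2^-1.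
Proof. by apply: le_trans small; rewrite mulrDl cmodD. Qed.
Let an1 : `|carg y| + 2 * cmod (w1 / y) < pi.
Proof. by apply: le_lt_trans angle; rewrite lerD2l ler_wpM2l // lerDl cmod_ge0. Qed.
Let an2 : `|carg y| + 2 * cmod (w2 / y) < pi.
Proof. by apply: le_lt_trans angle; rewrite lerD2l ler_wpM2l // lerDr cmod_ge0. Qed.
Let an12 : `|carg y| + 2 * cmod ((w1 + w2) / y) < pi.
Proof. by apply: le_lt_trans angle; rewrite lerD2l ler_wpM2l // mulrDl cmodD. Qed.

(** The coefficients of [phi1] are such that only binomial remainders survive. *)
Lemma err1E : err1 w1 s y = cpow y (- s) *
  (2^-1 * binrem 2 (- s) (w1 / y) - (y / w1) * binrem 3 (1 - s) (w1 / y) / (1 - s)).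
Proof.
rewrite /err1 /phi1 !cpow_shift // !cpow_1B // (binrem3E (1 - s)) (binrem2E (- s)).
move: (binrem _ _ _) (binrem _ _ _) (cpow _ _) => r2 r3 X.
by field; rewrite ?w10 ?y0 ?s1 ?s2.
Qed.

Let rem K p : C := binrem K p ((w1 + w2) / y) - binrem K p (w1 / y) - binrem K p (w2 / y).

(** The same cancellation, up to order 4 for the leading part of [phi2]. *)
Lemma err2E : err2 w1 w2 s y = - cpow y (- s) *
  (y ^+ 2 / (w1 * w2) * (rem 5 (2 - s) / ((1 - s) * (2 - s)))
   - (w1 + w2) * y / (2 * (w1 * w2)) * (rem 4 (1 - s) / (1 - s))
   + (w1 ^+ 2 + 3 * (w1 * w2) + w2 ^+ 2) / (12 * (w1 * w2)) * rem 3 (- s)).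
Proof.
rewrite /err2 /phi2 !cpow_shift // !cpow_1B // !cpow_2B // /rem !(binrem5E (2 - s)) !(binrem4E (1 - s)) !(binrem3E (- s)).
move: (binrem 5 _ _) (binrem 5 _ _) (binrem 5 _ _) => r5 r5' r5''.
move: (binrem 4 _ _) (binrem 4 _ _) (binrem 4 _ _) => r4 r4' r4''.
move: (binrem 3 _ _) (binrem 3 _ _) (binrem 3 _ _) (cpow _ _) => r3 r3' r3'' X.
by field; rewrite ?w10 ?w20 ?y0 ?s1 ?s2.
Qed.

End Err.
End EulerMaclaurin.

(** * Bounds on the lattice of periods *)

Section ErrorBounds.
Variable R : realType.
Notation C := R[i].
Implicit Types (s z w y p u x : C) (P Q B : R).

Lemma binrem_div_bound K w P : 0 <= P -> exists2 B : R, 0 <= B & forall p y,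
  cmod p <= P -> cmod (w / y) <= 2^-1 -> cmod (binrem K p (w / y)) <= B / cmod y ^+ K.
Proof.
move=> /(binrem_bound K) [B B0 hB]; exists (B * cmod w ^+ K).
  by rewrite mulr_ge0 // exprn_ge0 // cmod_ge0.
move=> p y hp hw; apply: le_trans (hB _ _ hp hw) _.
by rewrite cmodM cmodV exprMn exprVn mulrA.
Qed.

(** A displacement of y by at most W keeps it in the range of [cpow_shift]. *)
Definition small_angle (W : R) y := W / cmod y <= 2^-1 /\ `|carg y| + 2 * (W / cmod y) < pi.

Lemma small_angleE (w1 w2 : C) y : small_angle (cmod w1 + cmod w2) y ->
  cmod (w1 / y) + cmod (w2 / y) <= 2^-1 /\
  `|carg y| + 2 * (cmod (w1 / y) + cmod (w2 / y)) < pi.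
Proof. by rewrite /small_angle !cmodM !cmodV mulrDl. Qed.

(** Each remainder of order K gains y ^ (- K), against the powers of y in [err1E]. *)
Lemma err1_bound w P Q : w != 0 -> 0 <= P -> 0 <= Q -> exists2 B : R, 0 <= B &
  forall s y, y != 0 -> cmod s <= P -> cmod (1 - s)^-1 <= Q -> 1 - s != 0 ->
    small_angle (cmod w + cmod w) y ->
    cmod (err1 w s y) <= B * cmod (cpow y (- s - 2)).
Proof.
move=> w0 P0 Q0.
have P1 : 0 <= P + 1 by rewrite addr_ge0.
have [B2 B20 hB2] := binrem_div_bound 2 w P1.
have [B3 B30 hB3] := binrem_div_bound 3 w P1.
exists (2^-1 * B2 + (cmod w)^-1 * B3 * Q).
  by rewrite addr_ge0 // ?mulr_ge0 ?invr_ge0 ?cmod_ge0.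
move=> s y y0 hs hQ s1 /small_angleE [h1 h2].
have sm : cmod (w / y) <= 2^-1 by apply: le_trans h1; rewrite lerDl cmod_ge0.
rewrite (err1E w0 y0 s1 h1 h2).
have -> : cpow y (- s - 2) = cpow y (- s) / y ^+ 2.
  by rewrite -(cpow_nat 2 y0) cpowE mulrBl cexpB.
have hs1 : cmod (- s) <= P + 1 by rewrite cmodN; apply: le_trans hs _; rewrite lerDl.
have hs2 : cmod (1 - s) <= P + 1.
  by apply: le_trans (cmodD _ _) _; rewrite cmodN cmod1 addrC lerD2r.
rewrite cmodM [in leRHS]cmodM mulrCA ler_wpM2l ?cmod_ge0 //.
rewrite cmodV cmodX ler_pdivlMr ?exprn_gt0 ?cmod_gt0 //.
have yp : 0 < cmod y by rewrite cmod_gt0.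
rewrite -ler_pdivlMr ?exprn_gt0 //; apply: le_trans (cmodD _ _) _.
rewrite mulrDl; apply: lerD.
  rewrite cmodM cmodV cmod_nat -mulrA ler_wpM2l ?invr_ge0 //; exact: hB2.
rewrite cmodN !cmodM !cmodV.
have -> : (cmod w)^-1 * B3 * Q / cmod y ^+ 2 =
    (cmod y / cmod w) * (B3 / cmod y ^+ 3) * Q.
  by field; rewrite !gt_eqF // cmod_gt0.
apply: ler_pM; rewrite ?mulr_ge0 ?invr_ge0 ?cmod_ge0 //; last by rewrite -cmodV.
by rewrite ler_wpM2l ?mulr_ge0 ?invr_ge0 ?cmod_ge0 //; apply: hB3.
Qed.

(** Each remainder of order K gains y ^ (- K), against the powers of y in [err2E]. *)
Lemma err2_bound (w1 w2 : C) P Q : w1 != 0 -> w2 != 0 -> 0 <= P -> 0 <= Q ->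
  exists2 B : R, 0 <= B &
  forall s y, y != 0 -> cmod s <= P -> cmod (1 - s)^-1 <= Q -> cmod (2 - s)^-1 <= Q ->
    1 - s != 0 -> 2 - s != 0 -> small_angle (cmod w1 + cmod w2) y ->
    cmod (err2 w1 w2 s y) <= B * cmod (cpow y (- s - 3)).
Proof.
move=> w10 w20 P0 Q0.
have P2 : 0 <= P + 2 by rewrite addr_ge0.
have rb K : exists2 B : R, 0 <= B & forall p y, cmod p <= P + 2 ->
    cmod (w1 / y) + cmod (w2 / y) <= 2^-1 ->
    cmod (binrem K p ((w1 + w2) / y) - binrem K p (w1 / y) - binrem K p (w2 / y))
      <= B / cmod y ^+ K.
  have [B Bp hB] := binrem_div_bound K (w1 + w2) P2.
  have [B' Bp' hB'] := binrem_div_bound K w1 P2.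
  have [B'' Bp'' hB''] := binrem_div_bound K w2 P2.
  exists (B + B' + B''); first by rewrite !addr_ge0.
  move=> p y hp hw; apply: le_trans (cmodD3 _ _ _) _; rewrite !cmodN (mulrDl (B + B')) (mulrDl B).
  apply: lerD; first apply: lerD.
  - by apply: hB => //; apply: le_trans hw; rewrite mulrDl cmodD.
  - by apply: hB' => //; apply: le_trans hw; rewrite lerDl cmod_ge0.
  - by apply: hB'' => //; apply: le_trans hw; rewrite lerDr cmod_ge0.
have [B5 B50 hB5] := rb 5; have [B4 B40 hB4] := rb 4; have [B3 B30 hB3] := rb 3.
set c5 := cmod (w1 * w2)^-1.
set c4 := cmod ((w1 + w2) / (2 * (w1 * w2))).
set c3 := cmod ((w1 ^+ 2 + 3 * (w1 * w2) + w2 ^+ 2) / (12 * (w1 * w2))).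
have [c50 c40 c30] : [/\ 0 <= c5, 0 <= c4 & 0 <= c3] by split; apply: cmod_ge0.
exists (c5 * B5 * (Q * Q) + c4 * B4 * Q + c3 * B3).
  by rewrite !addr_ge0 // !mulr_ge0.
move=> s y y0 hs hQ1 hQ2 s1 s2 /small_angleE [h1 h2].
rewrite (err2E w10 w20 y0 s1 s2 h1 h2).
have -> : cpow y (- s - 3) = cpow y (- s) / y ^+ 3.
  by rewrite -(cpow_nat 3 y0) cpowE mulrBl cexpB.
have yp : 0 < cmod y by rewrite cmod_gt0.
have hs3 : cmod (- s) <= P + 2 by rewrite cmodN; apply: le_trans hs _; rewrite lerDl.
have hs4 : cmod (1 - s) <= P + 2.
  apply: le_trans (cmodD _ _) _; rewrite cmodN cmod1 addrC; apply: lerD => //.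
  by rewrite ler1n.
have hs5 : cmod (2 - s) <= P + 2.
  by apply: le_trans (cmodD _ _) _; rewrite cmodN cmod_nat addrC lerD2r.
have hr5 := hB5 _ _ hs5 h1; have hr4 := hB4 _ _ hs4 h1; have hr3 := hB3 _ _ hs3 h1.
move: (_ - binrem 5 (2 - s) (w2 / y)) (_ - binrem 4 (1 - s) (w2 / y))
  (_ - binrem 3 (- s) (w2 / y)) hr5 hr4 hr3 => r5 r4 r3 hr5 hr4 hr3.
rewrite [leLHS]cmodM cmodN [in leRHS]cmodM [leRHS]mulrCA ler_wpM2l ?cmod_ge0 //.
rewrite cmodV cmodX.
apply: le_trans (cmodD3 _ _ _) _; rewrite cmodN (mulrDl (_ + c4 * _ * _)) (mulrDl (c5 * _ * _)).
apply: lerD; first apply: lerD.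
- have -> : y ^+ 2 / (w1 * w2) * (r5 / ((1 - s) * (2 - s))) =
     y ^+ 2 * ((w1 * w2)^-1 * r5) * ((1 - s)^-1 * (2 - s)^-1).
    by field; rewrite ?s1 ?s2 ?w10 ?w20.
  have -> : c5 * B5 * (Q * Q) / cmod y ^+ 3 =
     cmod y ^+ 2 * (c5 * (B5 / cmod y ^+ 5)) * (Q * Q).
    by field; rewrite gt_eqF.
  rewrite [leLHS]cmodM (cmodM (y ^+ 2)) (cmodM (w1 * w2)^-1) (cmodM (1 - s)^-1) (cmodX y 2); apply: ler_pM; rewrite ?mulr_ge0 ?exprn_ge0 ?cmod_ge0 //.
    by rewrite ler_wpM2l ?exprn_ge0 ?cmod_ge0 // ler_wpM2l.
  by apply: ler_pM; rewrite ?cmod_ge0.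
- have -> : (w1 + w2) * y / (2 * (w1 * w2)) * (r4 / (1 - s)) =
     y * ((w1 + w2) / (2 * (w1 * w2)) * r4) * (1 - s)^-1 by ring.
  have -> : c4 * B4 * Q / cmod y ^+ 3 = cmod y * (c4 * (B4 / cmod y ^+ 4)) * Q.
    by field; rewrite gt_eqF.
  rewrite [leLHS]cmodM (cmodM y) (cmodM (_ / _) r4).
  apply: ler_pM; rewrite ?mulr_ge0 ?cmod_ge0 //.
  by rewrite ler_wpM2l ?cmod_ge0 // ler_wpM2l.
- by rewrite cmodM -mulrA ler_wpM2l.
Qed.

(** As the argument of y is bounded, only the modulus of y matters. *)
Lemma cpow_decay (kap eta P : R) : 0 < kap -> 0 <= eta -> exists2 B : R, 0 <= B &
  forall y p m, kap * m.+1%:R <= cmod y -> complex.Re p <= - eta -> cmod p <= P ->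
    cmod (cpow y p) <= B * expR (- eta * ln m.+1%:R).
Proof.
move=> k0 e0; exists (expR (pi * P) * expR (P * `|ln kap|)).
  by rewrite mulr_ge0 // expR_ge0.
move=> y p m hy hp hP; apply: le_trans (cmod_cpow_le y hP) _.
rewrite -mulrA ler_wpM2l ?expR_ge0 // -expRD ler_expR.
have mp : 0 < (m.+1%:R : R) by rewrite ltr0n.
have hl : ln kap + ln m.+1%:R <= ln (cmod y).
  by rewrite -lnM ?posrE // ler_ln ?posrE ?mulr_gt0 // (lt_le_trans _ hy) // mulr_gt0.
have l0 : 0 <= ln (m.+1%:R : R) by rewrite ln_ge0 // ler1n.
have r0 : complex.Re p <= 0 by apply: le_trans hp _; rewrite oppr_le0.
apply: le_trans (ler_wnM2l r0 hl) _; rewrite mulrDr; apply: lerD.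
  apply: le_trans (ler_norm _) _; rewrite normrM ler_wpM2r //.
  exact: le_trans (Re_le_cmod _) hP.
by rewrite ler_wpM2r.
Qed.

Definition lattice_pt (x w1 w2 : C) (n1 n2 : nat) : C := x + n1%:R * w1 + n2%:R * w2.

(** The periods lie in an open half plane which avoids the negative real axis. *)
Definition good_dir u (w1 w2 : C) := [/\ 0 < complex.Re u,
  0 < complex.Re (u^* * w1) & 0 < complex.Re (u^* * w2)].

(** In the direction u the lattice points grow at least linearly in n1 + n2, so they end up
far from 0 and in the half plane Re (conj u y) > 0, where [carg_sector] bounds the argument. *)
Lemma lattice_far u x (w1 w2 : C) (W : R) : good_dir u w1 w2 -> 0 <= W ->
  exists (kap : R) (m0 : nat), 0 < kap /\ forall m n1 n2, (m0 <= m)%N ->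
    (m <= n1 + n2)%N -> let y := lattice_pt x w1 w2 n1 n2 in
    [/\ y != 0, kap * m.+1%:R <= cmod y & small_angle W y].
Proof.
move=> [u0 h1 h2] W0.
pose l y := complex.Re (u^* * y).
have lD y y' : l (y + y') = l y + l y' by rewrite /l mulrDr ReD.
have lM (k : nat) y : l (k%:R * y) = k%:R * l y.
  by rewrite /l mulrCA !mulr_natl raddfMn.
have up : 0 < cmod u by apply: lt_le_trans (Re_le_cmod u); rewrite gtr0_norm.
have uJ : cmod (u^*) = cmod u by rewrite !cmodE; case: (u) => a b /=; rewrite sqrrN.
have ll y : l y <= cmod u * cmod y.
  by apply: le_trans (ler_norm _) _; apply: le_trans (Re_le_cmod _) _; rewrite cmodM uJ.
pose mu := Num.min (l w1) (l w2).
have mu0 : 0 < mu by rewrite lt_min h1.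
have lat_ge n1 n2 : l x + (n1 + n2)%:R * mu <= l (lattice_pt x w1 w2 n1 n2).
  rewrite /lattice_pt !lD !lM -addrA lerD2l natrD mulrDl.
  by apply: lerD; rewrite ler_wpM2l // ge_min lexx ?orbT.
pose q := `|complex.Im u| / cmod u.
have q0 : 0 <= q by rewrite divr_ge0 // cmod_ge0.
have q1 : q < 1.
  rewrite ltr_pdivrMr // mul1r -(@ltr_pXn2r _ 2) ?nnegrE ?cmod_ge0 //.
  by rewrite cmod_sqr real_normK ?num_real // ltrDr exprn_gt0.
pose A := acos (- q).
have Api : A < pi by apply: acos_ltpi; rewrite ltrN2 q1 /=; lra.
(* Beyond modulus K, W / |y| is at most 1 / 2 and 2 (W / |y|) is less than pi - A. *)
pose K := 2 * W + 4 * W / (pi - A) + 1.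
have K0 : 0 < K.
  by rewrite ltr_wpDl // addr_ge0 ?mulr_ge0 // invr_ge0 subr_ge0 ltW.
pose kap := mu / (2 * cmod u).
have k0 : 0 < kap by rewrite divr_gt0 // mulr_gt0.
have [m0 hm0] := exists_nat_ge (`|(- l x + mu) / (mu / 2)| + K / kap + 1).
exists kap, m0; split=> // m n1 n2 mm mn y.
have hm := hm0 m mm.
have p1 : 0 <= K / kap by rewrite divr_ge0 // ltW.
have hl1 : - l x + mu <= mu / 2 * m%:R.
  rewrite mulrC -ler_pdivrMr ?divr_gt0 //.
  have := ler_norm ((- l x + mu) / (mu / 2)); lra.
have ly : mu / 2 * m.+1%:R <= l y.
  apply: le_trans (lat_ge n1 n2).
  have : m%:R * mu <= (n1 + n2)%:R * mu by rewrite ler_wpM2r ?ler_nat // ltW.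
  have -> : mu / 2 * m.+1%:R = mu / 2 + mu / 2 * m%:R by rewrite -natr1; ring.
  have e : m%:R * mu = mu / 2 * m%:R + mu / 2 * m%:R by field.
  move: hl1; rewrite e; move: (l x) (mu / 2 * m%:R) ((n1 + n2)%:R * mu) mu0 => a b d; lra.
have yk : kap * m.+1%:R <= cmod y.
  rewrite /kap mulrAC ler_pdivrMr ?mulr_gt0 //.
  have := ll y; move: ly; rewrite -/y; lra.
have mp : 0 < (m.+1%:R : R) by rewrite ltr0n.
have yp : 0 < cmod y by apply: lt_le_trans yk; rewrite mulr_gt0.
have y0 : y != 0 by rewrite -cmod_gt0.
have Ky : K <= cmod y.
  apply: le_trans yk; rewrite mulrC -ler_pdivrMr // -natr1.
  have := normr_ge0 ((- l x + mu) / (mu / 2)); lra.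
have WK : W / cmod y <= W / K by rewrite ler_wpM2l // lef_pV2 ?posrE.
split=> //; split.
  apply: le_trans WK _; rewrite ler_pdivrMr // /K.
  have : 0 <= 4 * W / (pi - A) by rewrite divr_ge0 ?mulr_ge0 // subr_ge0 ltW.
  lra.
have hc : `|carg y| <= A.
  apply: carg_sector => //; apply: le_trans ly.
  by rewrite mulr_ge0 // divr_ge0 // ltW.
have pA : 0 < pi - A by rewrite subr_gt0.
have : 2 * (W / K) < pi - A.
  have h4 : (pi - A) * (4 * W / (pi - A)) = 4 * W by rewrite mulrC divfK // gt_eqF.
  rewrite mulrA ltr_pdivrMr // /K 2!(mulrDr (pi - A)) h4.
  have : 0 <= (pi - A) * (2 * W) by rewrite !mulr_ge0 // ltW.
  move: ((pi - A) * (2 * W)) => z; lra.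
have : 2 * (W / cmod y) <= 2 * (W / K) by rewrite ler_wpM2l.
lra.
Qed.

End ErrorBounds.

(** * Analytic continuation of the Barnes zeta functions *)

Section Continuation.
Variable R : realType.
Notation C := R[i].
Implicit Types (s z w y p u x : C).

(** The region of [is_zeta2]. *)
Definition zeta_dom s := [/\ -1 < complex.Re s, s != 1 & s != 2].

Lemma zeta_dom_disc (s0 : C) : zeta_dom s0 -> exists E d P Q : R,
  [/\ 0 < E, 0 < d, E < cmod (1 - s0), E < cmod (2 - s0) & 0 <= P /\ 0 <= Q] /\
  forall s, cmod (s - s0) < E ->
  [/\ cmod s <= P, cmod (1 - s)^-1 <= Q /\ cmod (2 - s)^-1 <= Q,
      1 - s != 0, 2 - s != 0 & -1 + d <= complex.Re s].
Proof.
move=> [h0 h1 h2].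
have c1 : 0 < cmod (1 - s0) by rewrite cmod_gt0 subr_eq0 eq_sym.
have c2 : 0 < cmod (2 - s0) by rewrite cmod_gt0 subr_eq0 eq_sym.
pose d := (complex.Re s0 + 1) / 2.
have d0 : 0 < d by rewrite /d; lra.
pose e := Num.min (cmod (1 - s0)) (cmod (2 - s0)) / 2.
have e0 : 0 < e by rewrite /e divr_gt0 // lt_min c1.
have [e1 e2] : e <= cmod (1 - s0) / 2 /\ e <= cmod (2 - s0) / 2.
  by rewrite /e !ler_pM2r ?invr_gt0 // !ge_min !lexx orbT.
pose E := Num.min e d.
have E0 : 0 < E by rewrite lt_min e0.
have [Ee Ed] : E <= e /\ E <= d by rewrite !ge_min !lexx orbT.
exists E, d, (cmod s0 + E), e^-1; split; first by split; try lra; split;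
  rewrite ?addr_ge0 ?cmod_ge0 ?invr_ge0 ?ltW.
move=> s hs.
have inv (c : C) : e <= cmod (c - s0) / 2 -> cmod (c - s)^-1 <= e^-1 /\ c - s != 0.
  move=> hc; have h : e <= cmod (c - s).
    have := cmod_subD c s0 s; lra.
  by rewrite -cmod_gt0 cmodV lef_pV2 ?posrE ?(lt_le_trans e0 h).
have [q1 n1] := inv 1 e1; have [q2 n2] := inv 2 e2.
split=> //.
  by have := cmod_subD s 0 s0; rewrite !subr0; lra.
have := Re_le_cmod (s - s0); rewrite ReD ReN ler_norml => /andP[].
by move: Ed hs; rewrite /d; lra.
Qed.

(** Locally uniform convergence on the region, with summable increments. The expansions of all
the terms are on a common disc, because their coefficients will have to converge too. *)
Definition good_seq (F : nat -> C -> C) := forall s0, zeta_dom s0 ->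
  exists E d B m0 a, [/\ 0 < E, 0 < d, 0 <= B,
    forall N, has_ps (F N) s0 (a N) E &
    forall s m, cmod (s - s0) < E -> (m0 <= m)%N ->
      cmod (F m.+1 s - F m s) <= B * expR (- (1 + d) * ln m.+1%:R)].

Definition seq_lim (F : nat -> C -> C) s : C := xget 0 [set l | climit (fun N => F N s) l].

Lemma seq_limP F s l : climit (fun N => F N s) l -> climit (fun N => F N s) (seq_lim F s).
Proof. by rewrite /seq_lim; move=> h; case: xgetP => [x -> //|/(_ l)]; case. Qed.

Lemma seq_lim_ps F (s0 : C) : good_seq F -> zeta_dom s0 -> exists E a A,
  [/\ 0 < E, forall N, has_ps (F N) s0 (a N) E, has_ps (seq_lim F) s0 A E &
    forall k, climit (fun N => a N k) (A k)].
Proof.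
move=> hF /hF [E [d [B [m0 [a [E0 d0 B0 ha hI]]]]]].
have [|A [hA hk]] := seq_limit_ps E0 d0 B0 ha hI (f := seq_lim F).
  move=> s hs; have [l hl] := seq_limit_ex d0 B0 hI hs; exact: seq_limP hl.
by exists E, a, A.
Qed.

Lemma seq_lim_lim F s : good_seq F -> zeta_dom s -> climit (fun N => F N s) (seq_lim F s).
Proof.
move=> hF /hF [E [d [B [m0 [a [E0 d0 B0 ha hI]]]]]].
have hs : cmod (s - s) < E by rewrite subrr cmod0.
have [l hl] := seq_limit_ex d0 B0 hI hs; exact: seq_limP hl.
Qed.

Lemma ps_cpowN y (s0 : C) E : exists a, has_ps (fun s => cpow y (- s)) s0 a E.
Proof. by have [a ha] := has_ps_cpow y 0 s0 E; exists a; apply: has_ps_ext ha => s _; rewrite sub0r. Qed.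

Lemma ps_phi1 w y (s0 : C) E : 0 < E -> E < cmod (1 - s0) ->
  exists a, has_ps (fun s => phi1 w s y) s0 a E.
Proof.
move=> E0 E1; have [a ha] := ps_cpowN y s0 E.
have [b hb] := has_ps_cpow_div y 1 E0 E1.
eexists; exact: has_psD (has_psMl (- w^-1) hb) (has_psMl 2^-1 ha).
Qed.

Lemma ps_phi2 (w1 w2 : C) y (s0 : C) E : 0 < E -> E < cmod (1 - s0) -> E < cmod (2 - s0) ->
  exists a, has_ps (fun s => phi2 w1 w2 s y) s0 a E.
Proof.
move=> E0 E1 E2; have [a ha] := ps_cpowN y s0 E.
have [b hb] := has_ps_cpow_div y 1 E0 E1.
have [b1 hb1] := has_ps_cpow_div y 2 E0 E1.
have [b2 hb2] := has_ps_cpow_div y 2 E0 E2.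
have [b3 hb3] : exists b3, has_ps (fun s => cpow y (2 - s) / ((1 - s) * (2 - s))) s0 b3 E.
  eexists; apply: has_ps_ext (has_psB hb1 hb2) => s hs /=.
  have n c : E < cmod (c - s0) -> c - s != 0.
    move=> Ec; apply/eqP => e; move: Ec; rewrite (_ : c = s); first by rewrite ltNge ltW.
    by apply/eqP; rewrite -subr_eq0 e.
  by field; rewrite !n.
eexists; exact: has_psD (has_psB (has_psMl _ hb3) (has_psMl _ hb)) (has_psMl _ ha).
Qed.

Lemma ps_sum N (f : nat -> C -> C) (s0 : C) E :
  (forall n, exists a, has_ps (f n) s0 a E) ->
  exists a, has_ps (fun s => \sum_(n < N) f n s) s0 a E.
Proof.
move=> /choice [a ha]; eexists.
exact: (@has_ps_sum _ _ (index_enum 'I_N) (fun n => f n) s0 (fun n => a n) E (fun n => ha n)).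
Qed.

(** Partial sums of the simple zeta series, completed by an approximation of the tail. *)
Definition F1 x w (m : nat) s : C :=
  \sum_(n < m) cpow (x + n%:R * w) (- s) + phi1 w s (x + m%:R * w).

(** Partial sums of the double zeta series over a square. The rest of the quarter plane is the
union of the quarter planes starting at (m, 0) and at (0, m), which intersect in the one starting
at (m, m). *)
Definition F2 x (w1 w2 : C) (m : nat) s : C :=
  \sum_(n1 < m) \sum_(n2 < m) cpow (lattice_pt x w1 w2 n1 n2) (- s)
  + (phi2 w1 w2 s (lattice_pt x w1 w2 m 0) + phi2 w1 w2 s (lattice_pt x w1 w2 0 m)
     - phi2 w1 w2 s (lattice_pt x w1 w2 m m)).

Lemma F1_step x w m s : F1 x w m.+1 s - F1 x w m s = err1 w s (x + m%:R * w).
Proof.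
rewrite /F1 big_ord_recr /= /err1.
have -> : x + m.+1%:R * w = x + m%:R * w + w by rewrite -natr1; ring.
ring.
Qed.

Lemma sum_square (V : zmodType) (g : nat -> nat -> V) m :
  \sum_(n1 < m.+1) \sum_(n2 < m.+1) g n1 n2 =
  \sum_(n1 < m) \sum_(n2 < m) g n1 n2 + (\sum_(n < m) g n m + \sum_(n < m) g m n + g m m).
Proof.
rewrite big_ord_recr /= [X in _ + X]big_ord_recr /=.
under eq_bigr do rewrite big_ord_recr /=.
by rewrite big_split /= !addrA.
Qed.

(** Passing from the square of side m to that of side m + 1 adds a shell, and every point of
this shell contributes its error term. *)
Lemma F2_step x (w1 w2 : C) m s : F2 x w1 w2 m.+1 s - F2 x w1 w2 m s =
  \sum_(n < m) err2 w1 w2 s (lattice_pt x w1 w2 n m) + \sum_(n < m) err2 w1 w2 s (lattice_pt x w1 w2 m n)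
  + err2 w1 w2 s (lattice_pt x w1 w2 m m).
Proof.
pose c n1 n2 := cpow (lattice_pt x w1 w2 n1 n2) (- s).
pose f n1 n2 := phi2 w1 w2 s (lattice_pt x w1 w2 n1 n2).
have e n1 n2 : err2 w1 w2 s (lattice_pt x w1 w2 n1 n2) =
   c n1 n2 - (f n1 n2 - f n1.+1 n2 - f n1 n2.+1 + f n1.+1 n2.+1).
  rewrite /err2 /c /f.
  have -> : lattice_pt x w1 w2 n1 n2 + w1 = lattice_pt x w1 w2 n1.+1 n2 by rewrite /lattice_pt -natr1; ring.
  have -> : lattice_pt x w1 w2 n1 n2 + w2 = lattice_pt x w1 w2 n1 n2.+1 by rewrite /lattice_pt -natr1; ring.
  have -> : lattice_pt x w1 w2 n1 n2 + (w1 + w2) = lattice_pt x w1 w2 n1.+1 n2.+1.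
    by rewrite /lattice_pt -!natr1; ring.
  by [].
have s1 k : \sum_(n < k) err2 w1 w2 s (lattice_pt x w1 w2 n m) =
   \sum_(n < k) c n m - (f 0%N m - f k m - f 0%N m.+1 + f k m.+1).
  elim: k => [|k IH]; first by rewrite !big_ord0; ring.
  by rewrite !big_ord_recr /= IH e; ring.
have s2 k : \sum_(n < k) err2 w1 w2 s (lattice_pt x w1 w2 m n) =
   \sum_(n < k) c m n - (f m 0%N - f m k - f m.+1 0%N + f m.+1 k).
  elim: k => [|k IH]; first by rewrite !big_ord0; ring.
  by rewrite !big_ord_recr /= IH e; ring.
rewrite s1 s2 e /F2 (sum_square c) -/(f _ _) -/(f _ _) -/(f _ _) -/(f _ _) -/(f _ _) -/(f _ _).
ring.
Qed.

(** The m-th increment is one error term, of order m ^ (- s - 2) with Re s > -1. *)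
Lemma good_seq1 u x w : good_dir u w w -> good_seq (F1 x w).
Proof.
move=> hu s0 /zeta_dom_disc [E [d [P [Q [[E0 d0 E1 E2 [P0 Q0]] hE]]]]].
have w0 : w != 0 by case: hu => _ + _; apply: contraTneq => ->; rewrite mulr0 ltxx.
have [B B0 hB] := err1_bound w0 P0 Q0.
have W0 : 0 <= cmod w + cmod w by rewrite addr_ge0 ?cmod_ge0.
have [kap [m0 [k0 hk]]] := lattice_far x hu W0.
have [B' B'0 hB'] := cpow_decay (P + 2) k0 (addr_ge0 (@ler01 R) (ltW d0)).
have /choice [a ha] : forall N, exists a, has_ps (F1 x w N) s0 a E.
  move=> N; have [a ha] := ps_sum N (fun n => ps_cpowN (x + n%:R * w) s0 E).
  have [b hb] := ps_phi1 w (x + N%:R * w) E0 E1.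
  by eexists; exact: has_psD ha hb.
exists E, d, (B * B'), m0, a; split=> //; first exact: mulr_ge0.
move=> s m hs hm; rewrite F1_step.
have [h1 [h2 h3] h4 h5 h6] := hE s hs.
have [] := hk m m 0%N hm; first by rewrite addn0.
rewrite /lattice_pt mul0r addr0 => y0 ky sm.
apply: le_trans (hB _ _ y0 h1 h2 h4 sm) _; rewrite -mulrA ler_wpM2l //.
apply: hB' => //; first by rewrite !(ReD, ReN) /=; lra.
by apply: le_trans (cmodD _ _) _; rewrite !cmodN cmod_nat lerD2r.
Qed.

(** The m-th increment consists of 2 m + 1 error terms of order m ^ (- s - 3), with
Re s > -1. *)
Lemma good_seq2 u x (w1 w2 : C) : good_dir u w1 w2 -> good_seq (F2 x w1 w2).
Proof.
move=> hu s0 /zeta_dom_disc [E [d [P [Q [[E0 d0 E1 E2 [P0 Q0]] hE]]]]].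
have w10 : w1 != 0 by case: hu => _ + _; apply: contraTneq => ->; rewrite mulr0 ltxx.
have w20 : w2 != 0 by case: hu => _ _; apply: contraTneq => ->; rewrite mulr0 ltxx.
have [B B0 hB] := err2_bound w10 w20 P0 Q0.
have W0 : 0 <= cmod w1 + cmod w2 by rewrite addr_ge0 ?cmod_ge0.
have [kap [m0 [k0 hk]]] := lattice_far x hu W0.
have [B' B'0 hB'] := cpow_decay (P + 3) k0 (addr_ge0 (ler0n R 2) (ltW d0)).
have /choice [a ha] : forall N, exists a, has_ps (F2 x w1 w2 N) s0 a E.
  move=> N.
  have [a ha] := ps_sum N (fun n1 => ps_sum N (fun n2 => ps_cpowN (lattice_pt x w1 w2 n1 n2) s0 E)).
  have [b1 hb1] := ps_phi2 w1 w2 (lattice_pt x w1 w2 N 0) E0 E1 E2.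
  have [b2 hb2] := ps_phi2 w1 w2 (lattice_pt x w1 w2 0 N) E0 E1 E2.
  have [b3 hb3] := ps_phi2 w1 w2 (lattice_pt x w1 w2 N N) E0 E1 E2.
  by eexists; exact: has_psD ha (has_psB (has_psD hb1 hb2) hb3).
exists E, d, (2 * (B * B')), m0, a; split=> //; first by rewrite !mulr_ge0.
move=> s m hs hm; rewrite F2_step.
have [h1 [h2 h3] h4 h5 h6] := hE s hs.
set L := ln m.+1%:R.
have key n1 n2 : (m <= n1 + n2)%N ->
    cmod (err2 w1 w2 s (lattice_pt x w1 w2 n1 n2)) <= B * B' * expR (- (2 + d) * L).
  move=> /(hk m n1 n2 hm) [y0 ky sm].
  apply: le_trans (hB _ _ y0 h1 h2 h3 h4 h5 sm) _; rewrite -mulrA ler_wpM2l //.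
  apply: hB' => //; first by rewrite !(ReD, ReN) /=; lra.
  by apply: le_trans (cmodD _ _) _; rewrite !cmodN cmod_nat lerD2r.
set K := B * B' * _ in key.
have K0 : 0 <= K by rewrite !mulr_ge0 // expR_ge0.
have line (g : nat -> C) : (forall n, cmod (g n) <= K) -> cmod (\sum_(n < m) g n) <= m%:R * K.
  move=> hg; apply: le_trans (cmod_sum _ _ _) _.
  by rewrite mulr_natl -[X in _ *+ X]card_ord -sumr_const; apply: ler_sum.
apply: le_trans (cmodD3 _ _ _) _.
have l1 := line (fun n => err2 w1 w2 s (lattice_pt x w1 w2 n m)) (fun n => key n m (leq_addl _ _)).
have l2 := line (fun n => err2 w1 w2 s (lattice_pt x w1 w2 m n)) (fun n => key m n (leq_addr _ _)).
have l3 := key m m (leq_addr _ _).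
have -> : 2 * (B * B') * expR (- (1 + d) * L) = 2 * (m.+1%:R * K).
  have -> : - (1 + d) * L = L + - (2 + d) * L by ring.
  by rewrite expRD lnK ?posrE ?ltr0n // /K; ring.
by rewrite -natr1; lra.
Qed.

End Continuation.

(** * From the zeta functions to the Gamma functions *)

Section BarnesZeta.
Variable R : realType.
Notation C := R[i].
Implicit Types (s z w y p u x : C).

Lemma expR_decay_climit (eta B : R) (v : nat -> C) m0 : 0 < eta -> 
  (forall m, (m0 <= m)%N -> cmod (v m) <= B * expR (- eta * ln m.+1%:R)) ->
  climit v 0.
Proof.
move=> e0 h; apply: (@climit_squeeze _ m0 _ _ (fun m => B * expR (- eta * ln m.+1%:R))).
  by move=> m hm; rewrite subr0; apply: h.
rewrite -[X in _ --> X](mulr0 B); apply: cvgM; first exact: cvg_cst.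
exact: expR_ln_cvg0.
Qed.

Lemma cpow_climit0 (kap : R) m0 (y : nat -> C) p : 0 < kap -> complex.Re p < 0 ->
  (forall m, (m0 <= m)%N -> kap * m.+1%:R <= cmod (y m)) ->
  climit (fun m => cpow (y m) p) 0.
Proof.
move=> k0 p0 hy; have e0 : 0 < - complex.Re p by rewrite oppr_gt0.
have [B B0 hB] := cpow_decay (cmod p) k0 (ltW e0).
by apply: (expR_decay_climit (eta := - complex.Re p) (B := B) (m0 := m0)) => // m hm;
   apply: hB; rewrite ?hy ?opprK.
Qed.

Lemma zeta_dom_gt2 s : 2 < complex.Re s -> zeta_dom s.
Proof.
move=> h; split; first by lra.
  by apply/eqP => e; move: h; rewrite e /=; lra.
by apply/eqP => e; move: h; rewrite e /=; lra.
Qed.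

(** For Re s > 2 the approximation of the tail tends to 0. *)
Lemma zeta1_sum u x w s : good_dir u w w -> 2 < complex.Re s ->
  climit (fun m => \sum_(n < m) cpow (x + n%:R * w) (- s)) (seq_lim (F1 x w) s).
Proof.
move=> hu hs; have hF := seq_lim_lim (good_seq1 x hu) (zeta_dom_gt2 hs).
have [kap [m0 [k0 hk]]] := lattice_far x hu (lexx 0).
have hy m : (m0 <= m)%N -> kap * m.+1%:R <= cmod (x + m%:R * w).
  by move=> hm; have [|_] := hk m m 0%N hm; rewrite ?addn0 // /lattice_pt mul0r addr0.
have l1 : climit (fun m => cpow (x + m%:R * w) (1 - s)) 0.
  by apply: (cpow_climit0 k0 _ hy); rewrite ReD ReN /=; lra.
have l0 : climit (fun m => cpow (x + m%:R * w) (- s)) 0.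
  by apply: (cpow_climit0 k0 _ hy); rewrite ReN /=; lra.
have l2 : climit (fun m => phi1 w s (x + m%:R * w)) 0.
  have := climitD (climitMl (- w^-1) (climitMr (1 - s)^-1 l1)) (climitMl 2^-1 l0).
  by rewrite mul0r !mulr0 addr0.
have := climitB hF l2; rewrite subr0.
by apply: (@climit_eq_from _ 0) => m _; rewrite /F1 addrK.
Qed.

(** For Re s > 2 the approximation of the tail tends to 0. *)
Lemma zeta2_sum u x (w1 w2 : C) s : good_dir u w1 w2 -> 2 < complex.Re s ->
  climit (fun m => \sum_(n1 < m) \sum_(n2 < m) cpow (lattice_pt x w1 w2 n1 n2) (- s))
    (seq_lim (F2 x w1 w2) s).
Proof.
move=> hu hs; have hF := seq_lim_lim (good_seq2 x hu) (zeta_dom_gt2 hs).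
have [kap [m0 [k0 hk]]] := lattice_far x hu (lexx 0).
have l (y : nat -> C) : (forall m, (m0 <= m)%N -> kap * m.+1%:R <= cmod (y m)) ->
    climit (fun m => phi2 w1 w2 s (y m)) 0.
  move=> hy.
  have l2 : climit (fun m => cpow (y m) (2 - s)) 0.
    by apply: (cpow_climit0 k0 _ hy); rewrite ReD ReN /=; lra.
  have l1 : climit (fun m => cpow (y m) (1 - s)) 0.
    by apply: (cpow_climit0 k0 _ hy); rewrite ReD ReN /=; lra.
  have l0 : climit (fun m => cpow (y m) (- s)) 0.
    by apply: (cpow_climit0 k0 _ hy); rewrite ReN /=; lra.
  have := climitD (climitB (climitMl (w1 * w2)^-1 (climitMr ((1 - s) * (2 - s))^-1 l2))
    (climitMl ((w1 + w2) / (2 * (w1 * w2))) (climitMr (1 - s)^-1 l1)))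
    (climitMl ((w1 ^+ 2 + 3 * (w1 * w2) + w2 ^+ 2) / (12 * (w1 * w2))) l0).
  by rewrite !mul0r !mulr0 subr0 addr0.
have h1 := l (fun m => lattice_pt x w1 w2 m 0) (fun m hm =>
  ltac:(by have [|_] := hk m m 0%N hm; rewrite ?addn0)).
have h2 := l (fun m => lattice_pt x w1 w2 0 m) (fun m hm =>
  ltac:(by have [|_] := hk m 0%N m hm)).
have h3 := l (fun m => lattice_pt x w1 w2 m m) (fun m hm =>
  ltac:(by have [|_] := hk m m m hm; rewrite ?leq_addl)).
have := climitB hF (climitB (climitD h1 h2) h3); rewrite addr0 !subr0.
by apply: (@climit_eq_from _ 0) => m _; rewrite /F2 addrK.
Qed.

Lemma seq_lim_analytic F s : good_seq F -> zeta_dom s -> analytic_at (seq_lim F) s.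
Proof.
move=> hF /(seq_lim_ps hF) [E [_ [A [E0 _ hA _]]]].
by apply/analytic_atE; exists A, E.
Qed.

Lemma is_zeta2_ex u x (w1 w2 : C) : good_dir u w1 w2 -> is_zeta2 x w1 w2 (seq_lim (F2 x w1 w2)).
Proof.
move=> hu; split=> [s h1 h2 h3|s hs].
  by apply: seq_lim_analytic; [exact: good_seq2 hu|split].
by apply: (proj2 (climitP _ _)); exact: zeta2_sum hu hs.
Qed.

Lemma analytic_atB f g s : analytic_at f s -> analytic_at g s -> analytic_at (fun z => f z - g z : C) s.
Proof.
move=> /analytic_atE [a [E [E0 ha]]] /analytic_atE [b [E' [E'0 hb]]].
apply/analytic_atE; exists (fun k => a k - b k), (Num.min E E'); split.
  by rewrite lt_min E0.
by apply: has_psB; [apply: has_ps_sub ha|apply: has_ps_sub hb]; rewrite ge_min lexx ?orbT.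
Qed.

Lemma analytic_atD f g s : analytic_at f s -> analytic_at g s -> analytic_at (fun z => f z + g z : C) s.
Proof.
move=> /analytic_atE [a [E [E0 ha]]] /analytic_atE [b [E' [E'0 hb]]].
apply/analytic_atE; exists (fun k => a k + b k), (Num.min E E'); split.
  by rewrite lt_min E0.
by apply: has_psD; [apply: has_ps_sub ha|apply: has_ps_sub hb]; rewrite ge_min lexx ?orbT.
Qed.

(** The segment from 3 + 3 i to 0 stays in the region, off the poles 1 and 2, and
starts in the half plane Re s > 2. *)
Lemma zeta_dom_identity f : (forall s, zeta_dom s -> analytic_at f s) ->
  (forall s, 2 < complex.Re s -> f s = 0) -> near_zero f 0.
Proof.
move=> han h0; pose p : C := 3 +i* 3.
apply: (@identity_segment _ f p).
- by apply/eqP => /(congr1 (@complex.Re R)) /= /eqP; rewrite pnatr_eq0.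
- move=> t /andP[t0 t1]; apply: han.
  have e : t%:C * p = (t * 3) +i* (t * 3).
    by rewrite /p; apply: complex_ext; rewrite /= ?mul0r ?subr0 ?addr0.
  rewrite e; split=> /=; first by lra.
    apply/eqP => h; have hi := congr1 (@complex.Im R) h.
    by have hr := congr1 (@complex.Re R) h; rewrite /= in hi hr; lra.
  apply/eqP => h; have hi := congr1 (@complex.Im R) h.
  by have hr := congr1 (@complex.Re R) h; rewrite /= in hi hr; lra.
exists 1 => // s hs; apply: h0.
have := Re_le_cmod (s - p); rewrite ReD ReN /= ler_norml => /andP[h _]; lra.
Qed.

Lemma has_ps_unique f (s0 : C) a b E : 0 < E -> has_ps f s0 a E -> has_ps f s0 b E -> a =1 b.
Proof.
move=> E0 ha hb k; apply/eqP; rewrite -subr_eq0; apply/eqP.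
apply: (ps_zero E0 (has_psB ha hb)) => d d0.
exists (s0 + (d / 2)%:C); have d20 : 0 < d / 2 by rewrite divr_gt0.
split; last by rewrite subrr.
  by rewrite -subr_eq0 addrC addKr -cmod_gt0 cmodR normr_gt0 gt_eqF.
by rewrite addrC addKr cmodR gtr0_norm // ; lra.
Qed.

Lemma zeta_dom0 : zeta_dom (0 : C).
Proof. by split; rewrite /= ?ltrN10 // eq_sym ?oner_eq0 ?pnatr_eq0. Qed.

Definition dzeta0 (f : C -> C) : C := derive1 (f : C^o -> C^o) 0.

Lemma ps_dzeta0 f a E : 0 < E -> has_ps f 0 a E -> dzeta0 f = a 1%N.
Proof. exact: ps_derive1. Qed.

Lemma derive1_near_zero f g : analytic_at f 0 -> analytic_at g 0 ->
  near_zero (fun s => f s - g s : C) 0 ->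
  dzeta0 f = dzeta0 g.
Proof.
move=> /analytic_atE [a [E [E0 ha]]] /analytic_atE [b [E' [E'0 hb]]] [d d0 hd].
pose e := Num.min d (Num.min E E').
have e0 : 0 < e by rewrite !lt_min d0 E0.
have ha' : has_ps f 0 a e by apply: has_ps_sub ha; rewrite !ge_min lexx !orbT.
have hb' : has_ps f 0 b e.
  have hb' : has_ps g 0 b e by apply: has_ps_sub hb; rewrite !ge_min lexx !orbT.
  apply: has_ps_ext hb' => s hs; apply/esym/eqP; rewrite -subr_eq0 hd //.
  by apply: lt_le_trans hs _; rewrite ge_min lexx.
by rewrite (ps_dzeta0 E0 ha) (ps_dzeta0 E'0 hb) (has_ps_unique e0 ha' hb').
Qed.

(** Every function allowed in the definition of [zeta2] agrees with the limit of [F2] for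
Re s > 2, hence near 0. *)
Lemma Gamma2E u x (w1 w2 : C) : good_dir u w1 w2 ->
  Gamma2 x w1 w2 = cexp (dzeta0 (seq_lim (F2 x w1 w2))).
Proof.
move=> hu.
suff e : dzeta0 (zeta2 x w1 w2) = dzeta0 (seq_lim (F2 x w1 w2)).
  by rewrite -e.
have hz : is_zeta2 x w1 w2 (zeta2 x w1 w2).
  rewrite /zeta2; case: xgetP => [Z -> //|/(_ (seq_lim (F2 x w1 w2)))].
  by case; exact: is_zeta2_ex hu.
have hg := good_seq2 x hu; case: hz => h1 h2.
have an s : zeta_dom s -> analytic_at (zeta2 x w1 w2) s by case; exact: h1.
apply: derive1_near_zero; [exact: an zeta_dom0|exact: seq_lim_analytic zeta_dom0|].
apply: zeta_dom_identity => [s hs|s hs].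
  by apply: analytic_atB; [exact: an|exact: seq_lim_analytic].
apply/eqP; rewrite subr_eq0; apply/eqP.
exact: (climit_unique (proj1 (climitP _ _) (h2 s hs)) (zeta2_sum x hu hs)).
Qed.

Lemma Gamma2_neq0 x (w1 w2 : C) : Gamma2 x w1 w2 != 0.
Proof. exact: cexp_neq0. Qed.

(** The shift by w1 drops the row n1 = 0 and adds the row n1 = m, which tends to 0. *)
Lemma zeta2_diff u x (w1 w2 : C) s : good_dir u w1 w2 -> 2 < complex.Re s ->
  seq_lim (F2 x w1 w2) s - seq_lim (F2 (x + w1) w1 w2) s = seq_lim (F1 x w2) s.
Proof.
move=> hu hs.
have hu2 : good_dir u w2 w2 by case: hu.
have hd := climitB (zeta2_sum x hu hs) (zeta2_sum (x + w1) hu hs).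
have h1 := zeta1_sum x hu2 hs.
pose g n1 n2 := cpow (lattice_pt x w1 w2 n1 n2) (- s).
(* m terms of order m ^ (- Re s), with Re s > 2 *)
have edge : climit (fun m => \sum_(n < m) g m n) 0.
  have [kap [m0 [k0 hk]]] := lattice_far x hu (lexx 0).
  have e0 : 0 <= complex.Re s by lra.
  have [B B0 hB] := cpow_decay (cmod s) k0 e0.
  apply: (expR_decay_climit (eta := complex.Re s - 1) (B := B) (m0 := m0)); first by lra.
  move=> m hm; apply: le_trans (cmod_sum _ _ _) _.
  apply: le_trans (_ : \sum_(n < m) (B * expR (- complex.Re s * ln m.+1%:R)) <= _).
    apply: ler_sum => n _; apply: hB; rewrite ?cmodN ?ReN //.
    by have [|_] := hk m m n hm; rewrite ?leq_addr.
  rewrite sumr_const card_ord -[leLHS]mulr_natl.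
  have -> : - (complex.Re s - 1) * ln m.+1%:R = ln m.+1%:R + - complex.Re s * ln m.+1%:R by ring.
  rewrite expRD lnK ?posrE ?ltr0n // mulrCA ler_wpM2l // ler_wpM2r ?expR_ge0 //.
  by rewrite ler_nat.
have := climitB h1 edge; rewrite subr0 => h2.
apply: (climit_unique hd); apply: (@climit_eq_from _ 0 _ _ _ _ h2) => m _ /=.
have -> : \sum_(n < m) cpow (x + n%:R * w2) (- s) = \sum_(n < m) g 0%N n.
  by apply: eq_bigr => n _; rewrite /g /lattice_pt mul0r addr0.
have key k : \sum_(n1 < k) (\sum_(n2 < m) g n1 n2 - \sum_(n2 < m) g n1.+1 n2) =
    \sum_(n2 < m) g 0%N n2 - \sum_(n2 < m) g k n2.
  elim: k => [|k IH]; first by rewrite big_ord0 subrr.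
  by rewrite big_ord_recr /= IH; ring.
rewrite -key -sumrB; apply: eq_bigr => n1 _; congr (_ - _); apply: eq_bigr => n2 _.
have -> : lattice_pt (x + w1) w1 w2 n1 n2 = lattice_pt x w1 w2 n1.+1 n2 by rewrite /lattice_pt -natr1; ring.
by [].
Qed.

(** Up to an exponential factor and the scaling by w, the usual Gamma function of x / w. *)
Definition Gamma1 x w : C := cexp (dzeta0 (seq_lim (F1 x w))).

(** The identity [zeta2_diff] between zeta functions extends from Re s > 2 to 0. *)
Lemma Gamma2_shift u x (w1 w2 : C) : good_dir u w1 w2 ->
  Gamma2 x w1 w2 = Gamma1 x w2 * Gamma2 (x + w1) w1 w2.
Proof.
move=> hu; have hu2 : good_dir u w2 w2 by case: hu.
suff e : dzeta0 (seq_lim (F2 x w1 w2)) =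
    dzeta0 (seq_lim (F1 x w2)) + dzeta0 (seq_lim (F2 (x + w1) w1 w2)).
  by rewrite (Gamma2E x hu) (Gamma2E (x + w1) hu) /Gamma1 e cexpD.
have [E1 [_ [A1 [E10 _ h1 _]]]] := seq_lim_ps (good_seq2 x hu) zeta_dom0.
have [E2 [_ [A2 [E20 _ h2 _]]]] := seq_lim_ps (good_seq2 (x + w1) hu) zeta_dom0.
have [E3 [_ [A3 [E30 _ h3 _]]]] := seq_lim_ps (good_seq1 x hu2) zeta_dom0.
rewrite (ps_dzeta0 E20 h2) (ps_dzeta0 E30 h3).
pose E := Num.min E2 E3.
have E0 : 0 < E by rewrite lt_min E20.
have hs : has_ps (fun s => seq_lim (F1 x w2) s + seq_lim (F2 (x + w1) w1 w2) s) 0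
   (fun k => A3 k + A2 k) E.
  by apply: has_psD; [apply: has_ps_sub h3|apply: has_ps_sub h2]; rewrite ge_min lexx ?orbT.
rewrite -[RHS](ps_dzeta0 E0 hs).
apply: derive1_near_zero.
- exact: seq_lim_analytic (good_seq2 x hu) zeta_dom0.
- by apply/analytic_atE; exists (fun k => A3 k + A2 k), E; split.
apply: zeta_dom_identity => s hs'.
  apply: analytic_atB; first exact: seq_lim_analytic (good_seq2 x hu) hs'.
  apply: analytic_atD; first exact: seq_lim_analytic (good_seq1 x hu2) hs'.
  exact: seq_lim_analytic (good_seq2 _ hu) hs'.
by rewrite -(zeta2_diff x hu hs') subrK subrr.
Qed.

End BarnesZeta.

(** * Bounds on the sine, limits of products *)

Section SineProduct.
Variable R : realType.
Notation C := R[i].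
Implicit Types (z w u : C) (x t : R).

Lemma cexp_sub1_le w : cmod (cexp w - 1) <= cmod w * expR (cmod w).
Proof.
have := @cexp_taylor R w 1 1; rewrite lexx ler01 => /(_ isT).
by rewrite big_ord1 !expr0 expr1n expr1 rmorph1 !mul1r !mulr1 !divr1 mulrC (_ : (ord0 : 'I_1)`! = 1%N) ?invr1.
Qed.

Lemma cexp_sub1w_le w : cmod (cexp w - 1 - w) <= cmod w ^+ 2 * expR (cmod w).
Proof.
have := @cexp_taylor R w 2 1; rewrite lexx ler01 => /(_ isT).
rewrite !big_ord_recr big_ord0 /= expr1n mulr1 rmorph1 !expr0 !expr1 !mul1r add0r !divr1 opprD addrA (_ : 0`! = 1%N) // invr1.
move=> h; apply: le_trans h _; rewrite mulrC ler_wpM2r ?expR_ge0 //.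
by rewrite -[leRHS]mulr1 ler_wpM2l ?exprn_ge0 ?cmod_ge0 // invf_le1 ?ltr0n // ler1n.
Qed.

Lemma climit_cexp (v : nat -> C) l : climit v l -> climit (fun n => cexp (v n)) (cexp l).
Proof.
move=> hv; have h0 := climit_norm0 hv.
have [N hN] := hv 1 ltr01.
apply: (@climit_squeeze _ N _ _ (fun n => cmod (cexp l) * expR 1 * cmod (v n - l))).
  move=> n hn; have -> : cexp (v n) - cexp l = cexp l * (cexp (v n - l) - 1).
    by rewrite cexpB; field; exact: cexp_neq0.
  rewrite cmodM -mulrA ler_wpM2l ?cmod_ge0 //; apply: le_trans (cexp_sub1_le _) _.
  by rewrite mulrC ler_wpM2r ?cmod_ge0 // ler_expR ltW // hN.
rewrite -[X in _ --> X](mulr0 (cmod (cexp l) * expR 1)).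
by apply: cvgM => //; exact: cvg_cst.
Qed.

Lemma csin_le z : cmod (csin z) <= cmod z * expR (cmod z).
Proof.
rewrite /csin cmodM cmodV cmodM cmod_nat cmod_i mulr1 ler_pdivrMr ?ltr0n //.
have h1 := cexp_sub1_le ('i%C * z); have h2 := cexp_sub1_le (- ('i%C * z)).
rewrite cmodN cmodM cmod_i mul1r in h1 h2.
have := cmod_subD (cexp ('i%C * z)) (cexp (- ('i%C * z))) 1.
rewrite (cmodB 1); lra.
Qed.

Lemma csin_sub_le z : cmod (csin z - z) <= cmod z ^+ 2 * expR (cmod z).
Proof.
have i0 : ('i%C : C) != 0 by rewrite -cmod_gt0 cmod_i.
have -> : csin z - z = ((cexp ('i%C * z) - 1 - 'i%C * z) -
   (cexp (- ('i%C * z)) - 1 - (- ('i%C * z)))) / (2 * 'i%C).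
  by rewrite /csin; field.
rewrite cmodM cmodV cmodM cmod_nat cmod_i mulr1 ler_pdivrMr ?ltr0n //.
have h1 := cexp_sub1w_le ('i%C * z); have h2 := cexp_sub1w_le (- ('i%C * z)).
rewrite cmodN cmodM cmod_i mul1r in h1 h2.
apply: le_trans (cmodD _ _) _; rewrite cmodN; lra.
Qed.

Lemma csinR x : csin (x%:C : C) = (sin x)%:C.
Proof.
have i0 : ('i%C : C) != 0 by rewrite -cmod_gt0 cmod_i.
rewrite /csin cexp_i.
have -> : - ('i%C * x%:C) = 'i%C * (- x)%:C :> C by rewrite rmorphN mulrN.
rewrite cexp_i cosN sinN.
have i2 : 2 * 'i%C != 0 :> C by rewrite mulf_neq0 // pnatr_eq0.
by apply: (mulIf i2); rewrite divfK //; apply: complex_ext; rewrite !(ReD, ImD, ReM, ImM) /=; ring.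
Qed.

Lemma csinN z : csin (- z) = - csin z.
Proof. by rewrite /csin mulrN opprK; ring. Qed.

(** A weak form of Jordan's inequality. *)
Lemma sin_ge_half t : 0 <= t <= pi / 2 -> t / 2 <= sin t.
Proof.
move=> /andP[t0 t1]; pose s := t / 2.
have pi4 : cos (pi / 4 : R) ^+ 2 = 2^-1.
  have := cos_pihalf R; have -> : pi / 2 = pi / 4 + pi / 4 :> R by field.
  rewrite cosD -!expr2; have := cos2Dsin2 (pi / 4 : R); lra.
have p4 : 0 <= cos (pi / 4 : R).
  by apply: ltW; apply: cos_gt0_pihalf; have := pi_gt0 R; lra.
have cosge v : 0 <= v <= s -> cos (pi / 4) <= cos v.
  move=> /andP[v0 vs]; have pg := pi_gt0 R.
  have vp : v <= pi / 4 by rewrite /s in vs; lra.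
  by rewrite leNgt ltr_cos ?in_itv /= -?leNgt //; lra.
have s0 : 0 <= s by rewrite /s; lra.
have sins : s * cos (pi / 4) <= sin s.
  have := @MVT_ge0 R (fun v => sin v - v * cos (pi / 4)) (fun v => cos v - cos (pi / 4)) s s0.
  rewrite sin0 mul0r subrr subr_ge0; apply => v hv.
    have hl : is_derive v 1 (fun x => x * cos (pi / 4)) (cos (pi / 4) : R).
      apply: is_derive_cast (is_deriveM' (is_derive_id v 1) (is_derive_cst (cos (pi / 4)) v 1)) _.
      by rewrite mulr0 add0r mulr1.
    exact: (is_deriveB' (is_derive_sin v) hl).
  by rewrite subr_ge0 cosge.
have -> : sin t = 2 * (sin s * cos s).
  have -> : t = s + s by rewrite /s; field.
  by rewrite sinD; ring.
have := ler_pM (mulr_ge0 s0 p4) p4 sins (cosge s (ltac:(by rewrite s0 lexx))).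
have -> : s * cos (pi / 4) * cos (pi / 4) = s * (cos (pi / 4) ^+ 2) by ring.
rewrite pi4 /s; lra.
Qed.

Lemma prod_sub1_le (I : Type) (r : seq I) (P : pred I) (F : I -> C) :
  cmod (\prod_(i <- r | P i) (1 - F i) - 1) <= expR (\sum_(i <- r | P i) cmod (F i)) - 1.
Proof.
elim: r => [|i r IH]; first by rewrite !big_nil subrr cmod0 expR0 subrr.
rewrite !big_cons; case: ifP => // _.
set p := \prod_(_ <- _ | _) _ in IH *; set S := \sum_(_ <- _ | _) _ in IH *.
have -> : (1 - F i) * p - 1 = (1 - F i) * (p - 1) - F i by ring.
apply: le_trans (cmodD _ _) _; rewrite cmodM cmodN expRD.
have h1 := expR_ge1Dx (cmod (F i)).
have h2 : cmod (1 - F i) <= 1 + cmod (F i).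
  by apply: le_trans (cmodD _ _) _; rewrite cmodN cmod1.
have h3 : 0 <= expR S - 1 by apply: le_trans IH; apply: cmod_ge0.
apply: (@le_trans _ _ (expR (cmod (F i)) * (expR S - 1) + (expR (cmod (F i)) - 1))).
  apply: lerD; last by lra.
  by apply: ler_pM; rewrite ?cmod_ge0 // (le_trans h2).
by rewrite mulrBr mulr1 addrA subrK.
Qed.

Lemma prod_le (I : Type) (r : seq I) (P : pred I) (F : I -> C) :
  cmod (\prod_(i <- r | P i) (1 - F i)) <= expR (\sum_(i <- r | P i) cmod (F i)).
Proof.
have h := prod_sub1_le r P F.
have := cmod_subD (\prod_(i <- r | P i) (1 - F i)) 0 1.
rewrite !subr0 cmod1; lra.
Qed.

Lemma sum_inv_sqr J k : (0 < J)%N ->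
  \sum_(J <= j < k) (j.+1%:R ^+ 2)^-1 <= (J%:R : R)^-1.
Proof.
move=> J0; have [Jk|kJ] := leqP J k; last first.
  by rewrite big_geq ?(ltnW kJ) // invr_ge0.
suff : \sum_(J <= j < k) (j.+1%:R ^+ 2 : R)^-1 <= J%:R^-1 - k%:R^-1.
  by move=> h; apply: le_trans h _; rewrite gerBl invr_ge0.
elim: k Jk => [|k IH]; first by rewrite leqn0 => /eqP e; rewrite e in J0.
rewrite leq_eqVlt => /orP[/eqP <-|Jk]; first by rewrite big_geq // subrr.
rewrite big_nat_recr //=; have := IH Jk.
have k0 : 0 < (k%:R : R) by rewrite ltr0n (leq_trans J0).
have k1 : 0 < (k.+1%:R : R) by rewrite ltr0n.
have : (k.+1%:R ^+ 2 : R)^-1 <= k%:R^-1 - k.+1%:R^-1.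
  have -> : (k%:R : R)^-1 - k.+1%:R^-1 = (k%:R * k.+1%:R)^-1.
    by rewrite -natr1; field; rewrite natr1 !gt_eqF.
  rewrite lef_pV2 ?posrE ?exprn_gt0 ?mulr_gt0 // expr2 ler_pM2r // ler_nat //.
move: (k.+1%:R^-1) ((k.+1%:R ^+ 2)^-1) (\sum_(J <= j < k) _) => a b c; lra.
Qed.

(** Dominated convergence for products: the factors of index at least J contribute at most
a multiple of 1 / J, uniformly in k. *)
Lemma tannery_prod (t : nat -> nat -> C) (c : nat -> C) (D : R) : 0 <= D ->
  (forall k j, (j < k)%N -> cmod (t k j) <= D / j.+1%:R ^+ 2) ->
  (forall j, climit (fun k => t k j) (c j)) ->
  climit (fun k => \prod_(j < k) (1 - t k j) - \prod_(j < k) (1 - c j)) 0.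
Proof.
move=> D0 ht hc.
have hcD j : cmod (c j) <= D / j.+1%:R ^+ 2.
  by apply: (climit_le (N0 := j.+1) (hc j)) => k hk; apply: ht.
have split (a : nat -> C) J k : (forall j, (j < k)%N -> cmod (a j) <= D / j.+1%:R ^+ 2) ->
    (0 < J)%N -> (J <= k)%N ->
    cmod (\prod_(j < k) (1 - a j) - \prod_(j < J) (1 - a j)) <=
      expR (2 * D) * (D / J%:R * expR D).
  move=> ha J0 Jk.
  rewrite -!(big_mkord xpredT (fun j => 1 - a j)) (big_cat_nat (n := J)) //=.
  set p := \prod_(0 <= _ < J) _; set q := \prod_(J <= _ < k) _.
  have -> : p * q - p = p * (q - 1) by ring.
  have tailS : \sum_(J <= j < k) cmod (a j) <= D / J%:R.
    apply: le_trans (_ : \sum_(J <= j < k) D * (j.+1%:R ^+ 2)^-1 <= _).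
      rewrite big_nat_cond [leRHS]big_nat_cond; apply: ler_sum => j /andP[/andP[_ jk] _]; exact: ha.
    by rewrite -mulr_sumr ler_wpM2l // sum_inv_sqr.
  have headS : \sum_(0 <= j < J) cmod (a j) <= 2 * D.
    apply: le_trans (_ : \sum_(0 <= j < J) D * (j.+1%:R ^+ 2)^-1 <= _).
      rewrite big_nat_cond [leRHS]big_nat_cond; apply: ler_sum => j /andP[/andP[_ jk] _].
      by apply: ha; apply: leq_trans Jk.
    rewrite -mulr_sumr mulrC ler_wpM2r // big_ltn // expr1n invr1.
    have := sum_inv_sqr J (ltn0Sn 0); rewrite invr1; lra.
  rewrite cmodM; apply: ler_pM; rewrite ?cmod_ge0 //.
    by apply: le_trans (prod_le _ _ _) _; rewrite ler_expR.
  apply: le_trans (prod_sub1_le _ _ _) _.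
  set S := \sum_(_ <= _ < _) _ in tailS *.
  have S0 : 0 <= S by apply: sumr_ge0 => j _; apply: cmod_ge0.
  have SD : S <= D.
    apply: le_trans tailS _; rewrite ler_pdivrMr ?ltr0n // -[leLHS]mulr1 ler_wpM2l //.
    by rewrite ler1n.
  have h : expR S - 1 <= S * expR S.
    have := expR_ge1Dx (- S); have e := expR_gt0 S.
    rewrite -(ler_pM2l e) -expRD subrr expR0 mulrDr; lra.
  apply: le_trans h _; apply: ler_pM; rewrite ?expR_ge0 //.
  by rewrite ler_expR.
move=> eps eps0.
pose K := expR (2 * D) * (D * expR D).
have K0 : 0 <= K by rewrite !mulr_ge0 ?expR_ge0.
have [J0 hJ0] := exists_nat_ge (4 * K / eps + 1).
pose J := J0.+1.
have hJ : expR (2 * D) * (D / J%:R * expR D) <= eps / 4.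
  have -> : expR (2 * D) * (D / J%:R * expR D) = K / J%:R by rewrite /K; ring.
  rewrite ler_pdivrMr ?ltr0n //.
  have := hJ0 J (leqnSn _); rewrite -lerBrDr ler_pdivrMr //.
  have : 0 < eps * (J%:R - 1) \/ eps * (J%:R - 1) <= 0 by case: (ltP 0 (eps * (J%:R - 1))); [left|right].
  lra.
have e4 : 0 < eps / 4 by rewrite divr_gt0.
have := climit_prod (index_enum 'I_J) (fun j : 'I_J => climitB (climit_cst 1) (hc j)).
move=> /(_ _ e4) [N hN]; exists (maxn J N) => k; rewrite geq_max => /andP[Jk /hN hk].
rewrite subr0.
have h1 := split (t k) J k (ht k) (ltn0Sn _) Jk.
have h2 := split c J k (fun j _ => hcD j) (ltn0Sn _) Jk.
have -> : \prod_(j < k) (1 - t k j) - \prod_(j < k) (1 - c j) =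
  (\prod_(j < k) (1 - t k j) - \prod_(j < J) (1 - t k j)) +
  (\prod_(j < J) (1 - t k j) - \prod_(j < J) (1 - c j)) +
  (- (\prod_(j < k) (1 - c j) - \prod_(j < J) (1 - c j))) by ring.
apply: le_lt_trans (cmodD3 _ _ _) _; rewrite cmodN; lra.
Qed.

End SineProduct.

(** * Euler's product for the sine *)

Section EulerProduct.
Variable R : realType.
Notation C := R[i].
Implicit Types (z w u X Y : C) (x t : R).

Lemma i_neq0 : ('i%C : C) != 0.
Proof. by rewrite -cmod_gt0 cmod_i. Qed.

Lemma i2_neq0 : (2 * 'i%C : C) != 0.
Proof. by rewrite mulf_neq0 ?i_neq0 // pnatr_eq0. Qed.

Lemma csinE z : cexp ('i%C * z) - cexp (- ('i%C * z)) = 2 * 'i%C * csin z.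
Proof. by rewrite /csin [RHS]mulrC divfK // i2_neq0. Qed.

Lemma prim_root_prod1 M (om : C) : M.-primitive_root om ->
  \prod_(1 <= j < M) (1 - om ^+ j) = M%:R.
Proof.
move=> h; have M0 := prim_order_gt0 h.
have := factor_Xn_sub_1 h; rewrite big_ltn // expr0.
rewrite subrX1 -polyC1 => /(mulfI _) e.
have {}e := e (negbT (polyXsubC_eq0 _)).
have := congr1 (fun p => p.[1]) e; rewrite /= horner_sum horner_prod.
under eq_bigr do rewrite hornerXsubC.
move=> ->; under eq_bigr do rewrite hornerXn expr1n.
by rewrite sumr_const card_ord.
Qed.

Lemma prim_root_prodXY M (om : C) X Y : Y != 0 -> M.-primitive_root om ->
  X ^+ M - Y ^+ M = (X - Y) * \prod_(1 <= j < M) (X - om ^+ j * Y).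
Proof.
move=> Y0 h; have M0 := prim_order_gt0 h.
have := congr1 (fun p => p.[X / Y]) (factor_Xn_sub_1 h).
rewrite horner_prod -polyC1 hornerD hornerN hornerXn hornerC => e.
have -> : X ^+ M - Y ^+ M = Y ^+ M * ((X / Y) ^+ M - 1).
  by rewrite mulrBr mulr1 -exprMn mulrCA mulfV ?mulr1.
rewrite -e; under eq_bigr do rewrite hornerXsubC.
have -> : Y ^+ M = \prod_(0 <= j < M) Y by rewrite prodr_const_nat subn0.
rewrite -big_split /= big_ltn // expr0 mulrBr mulrCA mulfV // !mulr1; congr (_ * _).
by apply: eq_bigr => j _; rewrite mulrBr mulrCA mulfV // mulr1 [Y * _]mulrC.
Qed.

(** The indices j and 2 k + 1 - j are grouped. *)
Lemma prod_fold (g : nat -> C) k :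
  \prod_(1 <= j < k.*2.+1) g j = \prod_(j < k) (g j.+1 * g (k.*2 - j)%N).
Proof.
rewrite big_add1 /= big_mkord -addnn big_split_ord big_split /=; congr (_ * _).
rewrite (reindex_inj rev_ord_inj) /=; apply: eq_bigr => j _; congr g.
have := ltn_ord j => hj.
by rewrite -addnS subnSK // addnBA // ltnW.
Qed.

Definition sin_frac (M a : nat) : R := sin (pi * a%:R / M%:R).

(** The roots om ^+ a and om ^+ (M - a) are conjugate. *)
Lemma prod_pair M a X Y : X * Y = 1 -> (0 < M)%N -> (a <= M)%N ->
  let om := cexp (2 * 'i%C * cpi R / M%:R) in
  (X - om ^+ a * Y) * (X - om ^+ (M - a) * Y) = (X - Y) ^+ 2 + 4 * ((sin_frac M a)%:C) ^+ 2.
Proof.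
move=> XY M0 aM om.
have hM := prim_root_cexp R M0.
have Mn : (M%:R : C) != 0 by rewrite pnatr_eq0 -lt0n.
pose v := cexp ('i%C * (pi * a%:R / M%:R : R)%:C).
have v0 : v != 0 by apply: cexp_neq0.
have va : om ^+ a = v ^+ 2.
  rewrite /om /v -!cexpMn -mulr_natr -[in RHS]mulr_natr; apply: congr1.
  by rewrite /cpi !rmorphM fmorphV !rmorph_nat /=; field.
have vb : om ^+ (M - a) = (v ^+ 2)^-1.
  apply: (mulfI (expf_neq0 a (cexp_neq0 _ : om != 0))).
  by rewrite -exprD subnKC // (prim_expr_order hM) va divff // expf_neq0.
have hs : v - v^-1 = 2 * 'i%C * (sin_frac M a)%:C.
  by rewrite /sin_frac -csinR -csinE cexpN.
have -> : 4 * ((sin_frac M a)%:C) ^+ 2 = - (v - v^-1) ^+ 2.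
  rewrite hs !exprMn; have -> : ('i%C : C) ^+ 2 = -1 by rewrite sqr_i.
  by ring.
rewrite va vb.
have -> : (X - v ^+ 2 * Y) * (X - (v ^+ 2)^-1 * Y) =
  X ^+ 2 + Y ^+ 2 - (v ^+ 2 + (v ^+ 2)^-1) * (X * Y) by field.
have -> : (X - Y) ^+ 2 = X ^+ 2 + Y ^+ 2 - 2 * (X * Y) by ring.
by rewrite XY; field.
Qed.

Lemma sin_frac_ge k j : (j < k)%N -> j.+1%:R <= k.*2.+1%:R * sin_frac k.*2.+1 j.+1.
Proof.
move=> jk; set M := k.*2.+1.
have M0 : 0 < (M%:R : R) by rewrite ltr0n.
have pg := pi_gt0 R; have p2 := pi_ge2 R.
have hj : (2 * j.+1%:R : R) <= M%:R.
  by rewrite -natrM ler_nat mul2n ltnW // /M ltnS leq_double.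
pose x : R := pi * j.+1%:R / M%:R.
have h : 0 <= x <= pi / 2.
  rewrite /x; apply/andP; split.
    by apply: divr_ge0; rewrite // mulr_ge0 // ltW.
  rewrite ler_pdivrMr // -mulrA ler_wpM2l ?(ltW pg) //.
  by rewrite mulrC ler_pdivlMr // mulrC.
have := sin_ge_half h; rewrite -/(sin_frac M j.+1) => hs.
have e : x / 2 = (pi / 2 * j.+1%:R) / M%:R by rewrite /x; field; rewrite gt_eqF.
rewrite e ler_pdivrMr // in hs; rewrite mulrC; apply: le_trans hs.
by rewrite -[leLHS]mul1r ler_wpM2r // ler_pdivlMr ?mul1r.
Qed.

Lemma sin_frac_neq0 k j : (j < k)%N -> ((sin_frac k.*2.+1 j.+1)%:C : C) != 0.
Proof.
move=> /sin_frac_ge h; rewrite -cmod_gt0 cmodR normr_gt0; apply/eqP => e.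
by move: h; rewrite e mulr0 leNgt ltr0n.
Qed.

(** With X = exp(i u) and Y = exp(- i u), the left-hand side is (X^M - Y^M) / (2 i) for
M = 2 k + 1. Factor it over the M-th roots of unity and group conjugate factors; the constant comes
from M = prod (1 - om^j). *)
Lemma csin_finite_prod k u :
  csin (k.*2.+1%:R * u) = k.*2.+1%:R * csin u *
    \prod_(j < k) (1 - csin u ^+ 2 / (sin_frac k.*2.+1 j.+1)%:C ^+ 2).
Proof.
set M := k.*2.+1; have M0 : (0 < M)%N by [].
have h := prim_root_cexp R M0; set om := cexp _ in h.
pose X := cexp ('i%C * u); pose Y := cexp (- ('i%C * u)).
have XY : X * Y = 1 by rewrite /X /Y -cexpD subrr cexp0.
have hk j : (j < k)%N -> (j.+1 <= M)%N by move=> jk; rewrite /M ltnW // ltnS -addnn ltn_addl.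
have fold X' Y' : X' * Y' = 1 -> \prod_(1 <= j < M) (X' - om ^+ j * Y') =
    \prod_(j < k) ((X' - Y') ^+ 2 + 4 * ((sin_frac M j.+1)%:C) ^+ 2).
  move=> XY'; rewrite prod_fold; apply: eq_bigr => j _.
  by rewrite -(prod_pair XY' M0 (hk _ (ltn_ord j))) /M subSS.
have hM : (M%:R : C) = \prod_(j < k) (4 * ((sin_frac M j.+1)%:C) ^+ 2).
  rewrite -(prim_root_prod1 h); under eq_bigr do rewrite -[X in 1 - X]mulr1.
  rewrite fold ?mulr1 //; apply: eq_bigr => j _.
  by rewrite subrr expr0n add0r.
have e : 2 * 'i%C * csin (M%:R * u) = 2 * 'i%C * csin u *
    \prod_(j < k) ((X - Y) ^+ 2 + 4 * ((sin_frac M j.+1)%:C) ^+ 2).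
  rewrite -!csinE -/X -/Y -(fold _ _ XY) -(prim_root_prodXY _ (cexp_neq0 _) h).
  have eM v : cexp (M%:R * v : C) = cexp v ^+ M by rewrite -cexpMn mulr_natl.
  by rewrite /X /Y -!eM mulrN mulrCA.
have e2 : \prod_(j < k) ((X - Y) ^+ 2 + 4 * ((sin_frac M j.+1)%:C) ^+ 2) =
    \prod_(j < k) (4 * ((sin_frac M j.+1)%:C) ^+ 2) *
    \prod_(j < k) (1 - csin u ^+ 2 / (sin_frac M j.+1)%:C ^+ 2).
  rewrite -big_split /=; apply: eq_bigr => j _.
  have s0 := sin_frac_neq0 (ltn_ord j); rewrite -/M in s0.
  have -> : (X - Y) ^+ 2 = - 4 * csin u ^+ 2.
    by rewrite csinE !exprMn sqr_i; ring.
  by move: ((sin_frac M j.+1)%:C) s0 => v v0; field.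
rewrite e2 -hM in e.
by apply: (mulfI i2_neq0); rewrite e; ring.
Qed.

Lemma climit_scaled_csin (a : C) :
  climit (fun k => k.*2.+1%:R * csin (a / k.*2.+1%:R)) a.
Proof.
apply: (@climit_squeeze _ 0 _ _ (fun k => cmod a ^+ 2 * expR (cmod a) * k.+1%:R^-1)).
  move=> k _; set M := k.*2.+1.
  have M0 : (M%:R : C) != 0 by rewrite pnatr_eq0.
  have Mp : 0 < (M%:R : R) by rewrite ltr0n.
  have -> : M%:R * csin (a / M%:R) - a = M%:R * (csin (a / M%:R) - a / M%:R).
    by move: (csin _) => v; field.
  have ha : cmod (a / M%:R) = cmod a / M%:R by rewrite cmodM cmodV cmod_nat.
  rewrite cmodM cmod_nat; apply: le_trans (ler_wpM2l (ltW Mp) (csin_sub_le _)) _.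
  rewrite ha.
  have -> : M%:R * ((cmod a / M%:R) ^+ 2 * expR (cmod a / M%:R)) =
     cmod a ^+ 2 * expR (cmod a / M%:R) * M%:R^-1 by field; rewrite gt_eqF.
  apply: ler_pM; rewrite ?mulr_ge0 ?exprn_ge0 ?expR_ge0 ?cmod_ge0 ?invr_ge0 //.
    rewrite ler_wpM2l ?exprn_ge0 ?cmod_ge0 // ler_expR ler_pdivrMr //.
    by rewrite -[leLHS]mulr1 ler_wpM2l ?cmod_ge0 // ler1n.
  by rewrite lef_pV2 ?posrE ?ltr0n // ler_nat /M ltnS -addnn leq_addl.
rewrite -[X in _ --> X](mulr0 (cmod a ^+ 2 * expR (cmod a))).
by apply: cvgM; [exact: cvg_cst|exact: cvg_harmonic].
Qed.

(** The limit of [csin_finite_prod] at u = pi z / (2 k + 1); [sin_frac_ge] provides the domination. *)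
Lemma euler_sine z :
  climit (fun k => cpi R * z * \prod_(j < k) (1 - z ^+ 2 / j.+1%:R ^+ 2)) (csin (cpi R * z)).
Proof.
set a := cpi R * z.
pose t k j : C := csin (a / k.*2.+1%:R) ^+ 2 / (sin_frac k.*2.+1 j.+1)%:C ^+ 2.
pose D := (cmod a * expR (cmod a)) ^+ 2.
have D0 : 0 <= D by rewrite exprn_ge0 // mulr_ge0 ?cmod_ge0 ?expR_ge0.
have ht k j : (j < k)%N -> cmod (t k j) <= D / j.+1%:R ^+ 2.
  move=> jk; set M := k.*2.+1.
  have Mp : 0 < (M%:R : R) by rewrite ltr0n.
  have hs := sin_frac_ge jk; rewrite -/M in hs.
  have sp : 0 < M%:R * sin_frac M j.+1 by apply: lt_le_trans hs; rewrite ltr0n.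
  have s1 : 0 < sin_frac M j.+1 by rewrite pmulr_rgt0 in sp.
  have -> : cmod (t k j) = (M%:R * cmod (csin (a / M%:R))) ^+ 2 / (M%:R * sin_frac M j.+1) ^+ 2.
    rewrite /t cmodM cmodV !cmodX cmodR gtr0_norm //; field.
    by rewrite !gt_eqF.
  apply: ler_pM; rewrite ?exprn_ge0 ?mulr_ge0 ?cmod_ge0 ?invr_ge0 ?exprn_ge0 // ?(ltW sp) //.
    rewrite lerXn2r ?nnegrE ?mulr_ge0 ?cmod_ge0 ?expR_ge0 //.
    apply: le_trans (ler_wpM2l (ltW Mp) (csin_le _)) _.
    rewrite cmodM cmodV cmod_nat mulrA mulrCA mulfV ?gt_eqF // mulr1.
    rewrite ler_wpM2l ?cmod_ge0 // ler_expR ler_pdivrMr //.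
    by rewrite -[leLHS]mulr1 ler_wpM2l ?cmod_ge0 // ler1n.
  by rewrite lef_pV2 ?posrE ?exprn_gt0 ?ltr0n // lerXn2r ?nnegrE // ltW.
have p0 : (cpi R : C) != 0 by rewrite -cmod_gt0 /cpi cmodR normr_gt0 gt_eqF // pi_gt0.
have hc j : climit (fun k => t k j) (z ^+ 2 / j.+1%:R ^+ 2).
  have h1 := climit_scaled_csin a.
  have h2 := climit_scaled_csin (cpi R * j.+1%:R).
  have j0 : (cpi R * j.+1%:R : C) != 0 by rewrite mulf_neq0 // pnatr_eq0.
  have j1 : (j.+1%:R : C) != 0 by rewrite pnatr_eq0.
  have -> : z ^+ 2 / j.+1%:R ^+ 2 = (a * a) * ((cpi R * j.+1%:R)^-1 * (cpi R * j.+1%:R)^-1).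
    by rewrite /a; move: (cpi R : C) (j.+1%:R : C) p0 j1 => q v q0 v0; field; rewrite q0 v0.
  have h3 := climitV j0 h2.
  apply: (@climit_eq_from _ 0 _ _ _ _ (climitM (climitM h1 h1) (climitM h3 h3))) => k _.
  have es : csin (cpi R * j.+1%:R / k.*2.+1%:R : C) = (sin_frac k.*2.+1 j.+1)%:C.
    by rewrite /sin_frac -csinR /cpi !rmorphM fmorphV !rmorph_nat.
  rewrite /t es.
  have M0 : (k.*2.+1%:R : C) != 0 by rewrite pnatr_eq0.
  have [s0|s0] := eqVneq ((sin_frac k.*2.+1 j.+1)%:C : C) 0.
    by rewrite s0 mulr0 expr0n !invr0 !mulr0.
  by move: (k.*2.+1%:R : C) M0 => v v0; field; rewrite s0.
have htan := tannery_prod D0 ht hc.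
set p := fun k : nat => \prod_(j < k) (1 - z ^+ 2 / j.+1%:R ^+ 2) : C.
pose q k : C := \prod_(j < k) (1 - t k j).
pose m k : C := k.*2.+1%:R * csin (a / k.*2.+1%:R).
have hmq k : m k * q k = csin a.
  have M0 : (k.*2.+1%:R : C) != 0 by rewrite pnatr_eq0.
  have e : k.*2.+1%:R * (a / k.*2.+1%:R) = a by rewrite mulrC divfK.
  by rewrite /m /q -csin_finite_prod e.
have qb k : cmod (q k) <= expR (2 * D).
  apply: le_trans (prod_le _ _ _) _; rewrite ler_expR.
  apply: le_trans (_ : \sum_(j < k) D * (j.+1%:R ^+ 2)^-1 <= _).
    by apply: ler_sum => j _; apply: ht.
  rewrite -mulr_sumr mulrC ler_wpM2r //.
  rewrite -(big_mkord xpredT (fun j => (j.+1%:R ^+ 2 : R)^-1)).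
  case: k => [|k]; first by rewrite big_geq.
  rewrite big_ltn // expr1n invr1.
  have := sum_inv_sqr R k.+1 (ltn0Sn 0); rewrite invr1; lra.
have h1 : climit (fun k => (m k - a) * q k) 0.
  apply: (@climit_squeeze _ 0 _ _ (fun k => cmod (m k - a) * expR (2 * D))).
    by move=> k _; rewrite subr0 cmodM ler_wpM2l ?cmod_ge0.
  rewrite -[X in _ --> X](mul0r (expR (2 * D))).
  by apply: cvgM; [exact: climit_norm0 (climit_scaled_csin a)|exact: cvg_cst].
have := climitB (climitB (climit_cst (csin a)) h1) (climitMl a htan).
rewrite mulr0 !subr0; apply: (@climit_eq_from _ 0) => k _.
by rewrite -(hmq k) -/(p k) -/(q k); ring.
Qed.

End EulerProduct.

(** * Reflection formula and shift of the double sine *)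

Section Reflection.
Variable R : realType.
Notation C := R[i].
Implicit Types (s z w y p u x : C).

(** The coefficient of s in the expansion of [phi1] at s = 0. *)
Definition psi1 w y : C := w^-1 * (y * clog y - y) - 2^-1 * clog y.

Lemma phi1_coef w y E : y != 0 -> 0 < E -> E < 1 ->
  exists a, has_ps (fun s => phi1 w s y) 0 a E /\ a 1%N = psi1 w y.
Proof.
move=> y0 E0 E1.
have E1' : E < cmod (1 - 0 : C) by rewrite subr0 cmod1.
have [b hb] := has_ps_cpow_div y 1 E0 E1'.
have h0 := @has_ps_cexp R (- clog y) 0 E.
have hN : has_ps (fun s => cpow y (- s)) 0
    (fun k => cexp (- clog y * 0) * (- clog y) ^+ k / k`!%:R) E.
  by apply: has_ps_ext h0 => s _; rewrite cpowE !mulNr [s * _]mulrC.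
have b0 : b 0%N = y.
  by rewrite -(has_ps_coef0 E0 hb) !subr0 divr1 (@cpow_nat _ y 1) // expr1.
have b1 : b 1%N = y - y * clog y.
  have h1 := has_psB hb (has_ps_mulX hb).
  have h2 := has_psMl y hN.
  have h3 : has_ps (fun s => y * cpow y (- s)) 0 (fun k => b k - shift_coef b k) E.
    apply: has_ps_ext h1 => s hs; rewrite subr0 in hs.
    have s1 : 1 - s != 0.
      apply/eqP => e; move: hs; have -> : s = 1 by apply/esym/eqP; rewrite -subr_eq0 e.
      by rewrite cmod1 ltNge ltW.
    by rewrite subr0 cpow_1B //; field.
  have := has_ps_unique E0 h3 h2 1%N.
  rewrite /= mulr0 cexp0 mul1r expr1 divr1 b0 => e.
  by rewrite -[LHS](subrK y) e; ring.
exists (fun k => - w^-1 * b k + 2^-1 * (cexp (- clog y * 0) * (- clog y) ^+ k / k`!%:R)).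
split; first exact: has_psD (has_psMl _ hb) (has_psMl _ hN).
by rewrite b1 mulr0 cexp0 mul1r expr1 divr1 /psi1; ring.
Qed.

Lemma F1_coef x w N E : x + N%:R * w != 0 -> 0 < E -> E < 1 ->
  exists a, has_ps (F1 x w N) 0 a E /\
    a 1%N = \sum_(n < N) - clog (x + n%:R * w) + psi1 w (x + N%:R * w).
Proof.
move=> y0 E0 E1; have [a [ha a1]] := phi1_coef w y0 E0 E1.
pose c (y : C) (k : nat) : C := cexp (- clog y * 0) * (- clog y) ^+ k / k`!%:R.
have hc y : has_ps (fun s => cpow y (- s)) 0 (c y) E.
  by apply: has_ps_ext (@has_ps_cexp R (- clog y) 0 E) => s _; rewrite cpowE !mulNr [s * _]mulrC.
have hs := @has_ps_sum _ _ (index_enum 'I_N) (fun n s => cpow (x + n%:R * w) (- s)) 0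
  (fun n => c (x + n%:R * w)) E (fun n => hc _).
exists (fun k => \sum_(n < N) c (x + n%:R * w) k + a k); split; first exact: has_psD.
rewrite a1; apply: congr2 => //; apply: eq_bigr => n _.
by rewrite /c mulr0 cexp0 mul1r expr1 divr1.
Qed.

(** Locally uniform limits of power series commute with taking coefficients, here the one of
order 1 at s = 0. *)
Lemma Gamma1_lim u x w : good_dir u w w ->
  climit (fun N => cexp (\sum_(n < N) - clog (x + n%:R * w) + psi1 w (x + N%:R * w)))
    (Gamma1 x w).
Proof.
move=> hu; have [E [a [A [E0 ha hA hk]]]] := seq_lim_ps (good_seq1 x hu) (@zeta_dom0 R).
rewrite /Gamma1 (ps_dzeta0 E0 hA); apply: climit_cexp.
have [kap [m0 [k0 hm]]] := lattice_far x hu (lexx 0).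
apply: (@climit_eq_from _ m0 _ _ _ _ (hk 1%N)) => N hN.
have [|y0 _ _] := hm N N 0%N hN; first by rewrite addn0.
rewrite /lattice_pt mul0r addr0 in y0.
pose e := Num.min E 2^-1.
have e0 : 0 < e by rewrite lt_min E0 invr_gt0 ltr0n.
have e1 : e < 1 by apply: le_lt_trans (_ : 2^-1 < 1); rewrite ?ge_min ?lexx ?orbT // invf_lt1 // ltr1n.
have [b [hb <-]] := F1_coef y0 e0 e1.
apply: has_ps_unique e0 _ hb _; apply: has_ps_sub (ha N).
by rewrite ge_min lexx.
Qed.

Section Far.
Variables (u w a : C).
Hypothesis hu : good_dir u w w.
Let Y (m : nat) : C := m%:R * w.
Let l m : C := clog1p (a / Y m).

Lemma clog_far : exists m0, forall m, (m0 <= m)%N ->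
  [/\ Y m != 0, cmod (a / Y m) <= 2^-1 & clog (Y m + a) = clog (Y m) + l m].
Proof.
have [kap [m0 [k0 hm]]] := lattice_far 0 hu (cmod_ge0 a).
exists m0 => m mm; have [|y0 _ [s1 s2]] := hm m m 0%N mm; first by rewrite addn0.
rewrite /lattice_pt add0r mul0r addr0 -/(Y m) in y0 s1 s2.
have e : cmod (a / Y m) = cmod a / cmod (Y m) by rewrite cmodM cmodV.
split=> //; first by rewrite e.
have -> : Y m + a = Y m * (1 + a / Y m) by field.
by rewrite clogM1p ?e.
Qed.

Lemma far_bound : exists kap m0, 0 < kap /\ forall m, (m0 <= m)%N ->
  Y m != 0 /\ (cmod (Y m))^-1 <= kap * m.+1%:R^-1.
Proof.
have [kap [m0 [k0 hm]]] := lattice_far 0 hu (lexx 0).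
exists kap^-1, m0; split=> [|m mm]; first by rewrite invr_gt0.
have [|y0 hy _] := hm m m 0%N mm; first by rewrite addn0.
rewrite /lattice_pt add0r mul0r addr0 -/(Y m) in y0 hy; split=> //.
rewrite -invfM lef_pV2 ?posrE ?mulr_gt0 ?cmod_gt0 //.
Qed.

Lemma climit_inv_far (D : R) (v : nat -> C) m0 : 0 <= D ->
  (forall m, (m0 <= m)%N -> cmod (v m) <= D / cmod (Y m)) -> climit v 0.
Proof.
move=> D0 hv; have [kap [m1 [k0 hm]]] := far_bound.
apply: (@climit_squeeze _ (maxn m0 m1) _ _ (fun m => D * kap * m.+1%:R^-1)).
  move=> m; rewrite geq_max subr0 => /andP[h0 h1]; apply: le_trans (hv m h0) _.
  by rewrite -mulrA ler_wpM2l //; have [] := hm m h1.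
rewrite -[X in _ --> X](mulr0 (D * kap)); apply: cvgM; first exact: cvg_cst.
exact: cvg_harmonic.
Qed.

Lemma clog1p_far : climit l 0.
Proof.
have [m0 hm] := clog_far.
apply: (climit_inv_far (D := 2 * cmod a) (m0 := m0)) => [|m /hm [_ h _]].
  by rewrite mulr_ge0 ?cmod_ge0.
by apply: le_trans (cmod_clog1p_le h) _; rewrite cmodM cmodV mulrA.
Qed.

(** log(1 + z) = z + O(z^2). *)
Lemma clog1p_far_scaled : climit (fun m => (Y m + a) * l m - a) 0.
Proof.
have [m0 hm] := clog_far.
have h1 : climit (fun m => Y m * l m - a) 0.
  apply: (climit_inv_far (D := 2 * cmod a ^+ 2) (m0 := m0)) => [|m /hm [y0 h _]].
    by rewrite mulr_ge0 ?exprn_ge0 ?cmod_ge0.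
  have -> : Y m * l m - a = Y m * (l m - a / Y m) by field.
  have yp : 0 < cmod (Y m) by rewrite cmod_gt0.
  rewrite cmodM; apply: le_trans (ler_wpM2l (ltW yp) (cmod_clog1p_sub_le h)) _.
  rewrite cmodM cmodV; have -> : cmod (Y m) * (2 * (cmod a / cmod (Y m)) ^+ 2) =
    2 * cmod a ^+ 2 / cmod (Y m) by field; rewrite gt_eqF.
  by [].
have := climitD h1 (climitMl a clog1p_far); rewrite mulr0 addr0.
by apply: (@climit_eq_from _ 0) => m _; ring.
Qed.

End Far.

(** The main part, common to all x, of [psi1] at x + m w plus [psi1] at w - x + m w. *)
Definition psi_growth w (m : nat) : C := 2 * w^-1 * (m%:R * w * clog (m%:R * w) - m%:R * w).

Lemma psi1_reflect u x w : good_dir u w w ->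
  climit (fun m => cexp (psi1 w (x + m%:R * w) + psi1 w (w - x + m%:R * w) - psi_growth w m)) 1.
Proof.
move=> hu; have w0 : w != 0 by case: hu => _ + _; apply: contraTneq => ->; rewrite mulr0 ltxx.
have [m0 hm0] := clog_far x hu; have [m1 hm1] := clog_far (w - x) hu.
rewrite -[X in climit _ X](cexp0 R); apply: climit_cexp.
have h1 := climitMl w^-1 (climitD (clog1p_far_scaled x hu) (clog1p_far_scaled (w - x) hu)).
have h2 := climitMl 2^-1 (climitD (clog1p_far x hu) (clog1p_far (w - x) hu)).
have := climitB h1 h2; rewrite !addr0 !mulr0 subr0.
apply: (@climit_eq_from _ (maxn m0 m1)) => m; rewrite geq_max => /andP[/hm0 [y0 _ e0] /hm1 [_ _ e1]].
rewrite /psi1 /psi_growth [x + _]addrC [w - x + _]addrC. rewrite e0 e1.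
move: (clog (m%:R * w)) (clog1p (x / (m%:R * w))) (clog1p ((w - x) / (m%:R * w))) => c l1 l2.
by move: (m%:R * w) => Y; field.
Qed.

Definition off_lattice w x := forall k : int, x != k%:~R * w.

Lemma off_lattice_refl w x : off_lattice w x -> off_lattice w (w - x).
Proof.
move=> h k; apply/eqP => e; have := h (1 - k); rewrite -subr_eq0.
have -> : x - (1 - k)%:~R * w = - (w - x - k%:~R * w) by rewrite rmorphB /=; ring.
by rewrite e subrr oppr0 eqxx.
Qed.

Lemma off_lattice_shift w x n : off_lattice w x -> x + n%:R * w != 0.
Proof.
move=> h; apply/eqP => e; have := h (- n%:Z); rewrite -subr_eq0.
have -> : x - (- n%:Z)%:~R * w = x + n%:R * w by rewrite rmorphN /= pmulrn; ring.
by rewrite e eqxx.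
Qed.

(** The approximations of the reflection product, freed from x. *)
Definition reflection_term w (k : nat) : C := cexp (psi_growth w k.+1) /
  (k.+1%:R * w * \prod_(j < k) (j.+1%:R * w) ^+ 2) * (cpi R / w).

(** By [Gamma1_lim], the two Gamma functions contribute the inverses of the products of the
x + n w and of the (n + 1) w - x, and Euler's product for sin(pi x / w) cancels the dependence on x. *)
Lemma reflection_limit u x w : good_dir u w w -> off_lattice w x ->
  climit (reflection_term w) (Gamma1 x w * Gamma1 (w - x) w * csin (cpi R * (x / w))).
Proof.
move=> hu hx; have w0 : w != 0 by case: hu => _ + _; apply: contraTneq => ->; rewrite mulr0 ltxx.
have p0 : (cpi R : C) != 0 by rewrite -cmod_gt0 /cpi cmodR normr_gt0 gt_eqF // pi_gt0.
have hx' := off_lattice_refl hx.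
have h1 := climitM (Gamma1_lim x hu) (Gamma1_lim (w - x) hu).
have h2 := climitM h1 (climitV (oner_neq0 _) (psi1_reflect x hu)).
have h3 : climit (fun k => 1 - x / (k.+1%:R * w)) 1.
  rewrite -[X in climit _ X](subr0 1); apply: climitB; first exact: climit_cst.
  apply: (@climit_squeeze _ 0 _ _ (fun k => cmod (x / w) * k.+1%:R^-1)).
    by move=> k _; rewrite subr0 invfM mulrCA [leLHS]cmodM [leLHS]mulrC cmodV cmod_nat.
  rewrite -[X in _ --> X](mulr0 (cmod (x / w))); apply: cvgM; first exact: cvg_cst.
  exact: cvg_harmonic.
have := climitM (climitM (climit_shift h2) (euler_sine (x / w))) h3.
rewrite invr1 !mulr1; apply: (@climit_eq_from _ 0) => k _.
have exps (z : C) : off_lattice w z -> cexp (\sum_(n < k.+1) - clog (z + n%:R * w)) =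
    \prod_(n < k.+1) (z + n%:R * w)^-1.
  move=> hz; rewrite cexp_sum; apply: eq_bigr => n _.
  by rewrite cexpN clogK // off_lattice_shift.
rewrite (cexpB (psi1 w _ + psi1 w _)) (cexpD (psi1 w _)) 2!(cexpD (\sum_(n < k.+1) _)) !exps // /reflection_term.
set P1 := \prod_(n < k.+1) _; set P2 := \prod_(n < k.+1) _.
have eP : P1 * P2 = (x * (k.+1%:R * w - x) * \prod_(j < k) (j.+1%:R * w) ^+ 2 *
    \prod_(j < k) (1 - (x / w) ^+ 2 / j.+1%:R ^+ 2))^-1.
  rewrite /P1 /P2 big_ord_recl [X in _ * X = _]big_ord_recr /= mul0r addr0.
  have -> : w - x + k%:R * w = k.+1%:R * w - x by rewrite -natr1; ring.
  have key : \prod_(j < k) (x + j.+1%:R * w)^-1 * \prod_(j < k) (w - x + j%:R * w)^-1 =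
      (\prod_(j < k) (j.+1%:R * w) ^+ 2)^-1 *
      (\prod_(j < k) (1 - (x / w) ^+ 2 / j.+1%:R ^+ 2))^-1.
    rewrite -!prodfV -!big_split /=; apply: eq_bigr => j _.
    have j0 : (j.+1%:R : C) != 0 by rewrite pnatr_eq0.
    have -> : w - x + j%:R * w = j.+1%:R * w - x by rewrite -natr1; ring.
    rewrite -!invfM; apply: congr1.
    by move: (j.+1%:R : C) j0 => v v0; field; rewrite v0 w0.
  have -> : \prod_(j < k) (x + (bump 0 j)%:R * w)^-1 = \prod_(j < k) (x + j.+1%:R * w)^-1 by [].
  rewrite [RHS]invfM [X in _ = X * _]invfM [X in _ = X * _ * _]invfM.
  rewrite -[RHS]mulrA -key; ring.
have k0 : (k.+1%:R : C) != 0 by rewrite pnatr_eq0.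
have [x0 x1] : x != 0 /\ k.+1%:R * w - x != 0.
  split; first by have := hx 0; rewrite mul0r.
  by rewrite subr_eq0 eq_sym; have := hx k.+1.
have A0 : \prod_(j < k) (j.+1%:R * w) ^+ 2 != 0.
  by apply/prodf_neq0 => j _; rewrite expf_neq0 // mulf_neq0 // pnatr_eq0.
have Q0 : \prod_(j < k) (1 - (x / w) ^+ 2 / j.+1%:R ^+ 2) != 0.
  apply/prodf_neq0 => j _.
  have j0 : (j.+1%:R : C) != 0 by rewrite pnatr_eq0.
  have -> : 1 - (x / w) ^+ 2 / j.+1%:R ^+ 2 =
    (x + j.+1%:R * w) * (j.+1%:R * w - x) / (j.+1%:R * w) ^+ 2.
    by move: (j.+1%:R : C) j0 => v v0; field; rewrite v0 w0.
  rewrite mulf_neq0 ?invr_neq0 ?expf_neq0 ?mulf_neq0 ?off_lattice_shift //.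
  by rewrite subr_eq0 eq_sym; have := hx j.+1.
move: eP; set B := cexp (psi1 _ _); set B' := cexp (psi1 _ _); set T := cexp (psi_growth _ _).
have B0 : B != 0 by apply: cexp_neq0.
have B'0 : B' != 0 by apply: cexp_neq0.
have T0 : T != 0 by apply: cexp_neq0.
move=> eP.
have -> : P1 * B * (P2 * B') / (B * B' / T) = P1 * P2 * T by field; rewrite B0 B'0 T0.
rewrite eP; move: (\prod_(j < k) _) (\prod_(j < k) _) (k.+1%:R : C) A0 Q0 k0 x1 => A Q v A0 Q0 v0 v1.
by field; rewrite A0 Q0 v0 w0 v1 x0.
Qed.

Lemma Gamma1_reflection u x x' w : good_dir u w w -> off_lattice w x -> off_lattice w x' ->
  Gamma1 x w * Gamma1 (w - x) w * csin (cpi R * (x / w)) =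
  Gamma1 x' w * Gamma1 (w - x') w * csin (cpi R * (x' / w)).
Proof. by move=> hu hx hx'; apply: (climit_unique (reflection_limit hu hx) (reflection_limit hu hx')). Qed.

(** In the quotient S2 (x + w1) / S2 x both Gamma2 functions are shifted by w1, which leaves
Gamma1 (w2 - x) Gamma1 x, and [Gamma1_reflection] applies. *)
Lemma S2_shift u (w1 w2 : C) : good_dir u w1 w2 -> exists K, forall x, off_lattice w2 x ->
  S2 (x + w1) w1 w2 * csin (cpi R * (x / w2)) = K * S2 x w1 w2.
Proof.
move=> hu; have hu2 : good_dir u w2 w2 by case: hu.
(* The constant is read off at any point outside the lattice. *)
have [[x0 hx0]|no] := pselect (exists x, off_lattice w2 x); last first.
  by exists 0 => x hx; case: no; exists x.
exists (Gamma1 x0 w2 * Gamma1 (w2 - x0) w2 * csin (cpi R * (x0 / w2))) => x hx.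
rewrite (Gamma1_reflection hu2 hx0 hx) /S2.
have -> : w1 + w2 - (x + w1) = w2 - x by ring.
rewrite (Gamma2_shift (w2 - x) hu) (Gamma2_shift x hu).
have -> : w2 - x + w1 = w1 + w2 - x by ring.
have g1 := Gamma2_neq0 (x + w1) w1 w2.
have g2 : Gamma1 x w2 != 0 by apply: cexp_neq0.
move: (Gamma2 (x + w1) w1 w2) (Gamma2 (w1 + w2 - x) w1 w2) (Gamma1 x w2) (Gamma1 (w2 - x) w2)
  (csin _) g1 g2 => a b c d e a0 c0.
by field; rewrite a0 c0.
Qed.

Lemma S2_neq0 x (w1 w2 : C) : S2 x w1 w2 != 0.
Proof.
apply: mulf_neq0; first exact: Gamma2_neq0.
apply: invr_neq0; exact: Gamma2_neq0.
Qed.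

End Reflection.

(** * Zeros of the sine and generic points *)

Section Scalars.
Variable R : realType.
Notation C := R[i].
Implicit Types (s z w y p u x r c : C).

Lemma cpi_neq0 : (cpi R : C) != 0.
Proof. by rewrite -cmod_gt0 /cpi cmodR normr_gt0 gt_eqF // pi_gt0. Qed.

Lemma cexp_ipi : cexp ('i%C * cpi R) = -1 :> C.
Proof. by rewrite /cpi cexp_i cospi sinpi; apply: complex_ext; rewrite /= ?oppr0. Qed.

Lemma csinDpi z : csin (z + cpi R) = - csin z.
Proof.
have h : cexp (- ('i%C * cpi R)) = -1 :> C by rewrite cexpN cexp_ipi invrN1.
by rewrite /csin mulrDr opprD !cexpD h cexp_ipi; ring.
Qed.

(** Reduce modulo pi to [0, pi[ and use the sign of the sine there. *)
Lemma sin_eq0 (t : R) : sin t = 0 -> exists k : int, t = k%:~R * pi.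
Proof.
have sh (x : R) n : sin (x + n%:R * pi) = 0 <-> sin x = 0.
  elim: n x => [|n IH] x; first by rewrite mul0r addr0.
  rewrite -natr1 mulrDl mul1r addrA sinDpi -IH.
  by split=> [/eqP|->]; rewrite ?oppr0 // oppr_eq0 => /eqP.
move=> h; pose k := Num.floor (t / pi); exists k.
have pg := pi_gt0 R.
have [k1 k2] : k%:~R * pi <= t /\ t < k%:~R * pi + pi.
  rewrite -[X in _ + X]mul1r -mulrDl -ler_pdivlMr // -ltr_pdivrMr //.
  by split; [exact: ge_floor|have := floorD1_gt (t / pi); rewrite rmorphD].
have s0 : sin (t - k%:~R * pi) = 0.
  case: (k) => n.
    by rewrite -pmulrn; apply/(sh (t - n%:R * pi) n); rewrite subrK.
  by rewrite NegzE rmorphN /= mulNr opprK; apply/(sh t n.+1).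
apply/eqP; rewrite -subr_eq0; apply/eqP; apply/eqP; rewrite eq_le; apply/andP; split; last first.
  by rewrite subr_ge0.
rewrite leNgt; apply/negP => tp.
have : 0 < sin (t - k%:~R * pi) by apply: sin_gt0_pi; rewrite tp ltrBlDl.
by rewrite s0 ltxx.
Qed.

(** The modulus of exp(i z) = exp(- i z) shows that z is real. *)
Lemma csin_eq0 z : csin z = 0 -> exists k : int, z = k%:~R * cpi R.
Proof.
move=> h; have := csinE z; rewrite h mulr0 => /eqP; rewrite subr_eq0 => /eqP e.
have b0 : complex.Im z = 0.
  have := congr1 (@cmod R) e; rewrite !cmod_cexp ReN ReM /= mul0r mul1r sub0r opprK.
  move=> /expR_inj; lra.
have zE : z = (complex.Re z)%:C by apply: complex_ext.
have : (sin (complex.Re z))%:C = 0 :> C by rewrite -csinR -zE.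
move=> /complexI /sin_eq0 [k hk]; exists k.
by rewrite zE hk rmorphM /= rmorph_int.
Qed.

Definition sn w y : C := csin (cpi R * (y / w)).

Lemma sn_neq0 w y : w != 0 -> off_lattice w y -> sn w y != 0.
Proof.
move=> w0 hy; apply/eqP => /csin_eq0 [k]; rewrite mulrC => /(mulIf cpi_neq0) e.
by have := hy k; rewrite -e divfK ?eqxx.
Qed.

Lemma snN w y : sn w (- y) = - sn w y.
Proof. by rewrite /sn mulNr mulrN csinN. Qed.

Lemma snDw w y : w != 0 -> sn w (y + w) = - sn w y.
Proof. by move=> w0; rewrite /sn mulrDl divff // mulrDr mulr1 csinDpi. Qed.

Lemma Gamma2_sym x (w1 w2 : C) : Gamma2 x w1 w2 = Gamma2 x w2 w1.
Proof.
have e (w1' w2' : C) Z : is_zeta2 x w1' w2' Z -> is_zeta2 x w2' w1' Z.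
  move=> [h1 h2]; split=> // s /h2; apply: cvg_trans.
  have -> : (fun m : nat => \sum_(n1 < m) \sum_(n2 < m) cpow (x + n1%:R * w2' + n2%:R * w1') (- s) : C^o) =
    (fun m : nat => \sum_(n1 < m) \sum_(n2 < m) cpow (x + n1%:R * w1' + n2%:R * w2') (- s) : C^o).
    apply/funext => m; rewrite exchange_big /=; apply: eq_bigr => i _; apply: eq_bigr => j _.
    by rewrite addrAC.
  exact: cvg_id.
have ez : is_zeta2 x w1 w2 = is_zeta2 x w2 w1.
  by apply/funext => Z; apply/propext; split; exact: e.
by rewrite /Gamma2 /zeta2 ez.
Qed.

Lemma S2_sym x (w1 w2 : C) : S2 x w1 w2 = S2 x w2 w1.
Proof.
have h y := Gamma2_sym y w1 w2.
by rewrite /S2 h (h x) (addrC w1).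
Qed.

(** The direction |r| + r bisects the angle between r and the positive real axis. *)
Lemma good_dir_nat r (n : nat) : ~~ (r <= 0) -> good_dir ((cmod r)%:C + r) r n.+1%:R.
Proof.
move=> hr; have h : 0 < cmod r + complex.Re r.
  rewrite lt_neqAle; apply/andP; split; last first.
    by have := Re_le_cmod r; rewrite ler_norml => /andP[]; lra.
  apply: contra hr => /eqP e.
  have e1 : complex.Re r = - cmod r by lra.
  have : complex.Im r ^+ 2 = 0 by have := cmod_sqr r; rewrite e1 sqrrN; lra.
  move=> /eqP; rewrite sqrf_eq0 => /eqP i0.
  by rewrite lecE i0 /= eqxx /= e1 oppr_le0 cmod_ge0.
have rp : 0 < cmod r.
  by rewrite cmod_gt0; apply: contraNneq hr => ->.
split; first by rewrite ReD.
  have -> : complex.Re (((cmod r)%:C + r)^* * r) = cmod r * (cmod r + complex.Re r).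
    rewrite mulrDr -[in RHS]expr2 cmod_sqr; case: (r) => a b /=; move: (cmod _) => m; ring.
  exact: mulr_gt0.
have -> : complex.Re (((cmod r)%:C + r)^* * n.+1%:R) = n.+1%:R * (cmod r + complex.Re r).
  have -> : (n.+1%:R : C) = (n.+1%:R : R)%:C by rewrite rmorph_nat.
  by case: (r) => a b /=; move: (cmod _) => m; ring.
by rewrite mulr_gt0.
Qed.

Section Fixed.
Variables (n : nat) (r c : C).
Let N : C := n.+2%:R.
Let N0 : N != 0. Proof. by rewrite pnatr_eq0. Qed.

(** [generic_spec], expressed for x = i b / pi. *)
Definition generic_pt x := forall k l m : int, x != k%:~R + l%:~R * r + m%:~R * c.

Lemma gen_shift x (k l m : int) : generic_pt x -> generic_pt (x + (k%:~R + l%:~R * r + m%:~R * c)).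
Proof.
move=> h k' l' m'; apply/eqP => e; have := h (k' - k) (l' - l) (m' - m).
rewrite -subr_eq0 !rmorphB /=.
have -> : x - (k'%:~R - k%:~R + (l'%:~R - l%:~R) * r + (m'%:~R - m%:~R) * c) =
   (x + (k%:~R + l%:~R * r + m%:~R * c)) - (k'%:~R + l'%:~R * r + m'%:~R * c) by ring.
by rewrite e subrr eqxx.
Qed.

Lemma gen_shift' x y (k l m : int) : y = x + (k%:~R + l%:~R * r + m%:~R * c) -> generic_pt x -> generic_pt y.
Proof. by move=> ->; exact: gen_shift. Qed.

Lemma gen_off x (k l m : int) : generic_pt x -> off_lattice (k%:~R + l%:~R * r + m%:~R * c) x.
Proof.
move=> h j; have := h (j * k) (j * l) (j * m); rewrite !rmorphM /=.
by rewrite -!mulrA -!mulrDr.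
Qed.

Lemma gen_offN x : generic_pt x -> off_lattice N x.
Proof.
move=> h k; have := gen_off n.+2 0 0 h k.
by rewrite !mul0r !addr0 -pmulrn.
Qed.

Lemma gen_off_r x : generic_pt x -> off_lattice r x.
Proof. by move=> h k; have := gen_off 0 1 0 h k; rewrite mul0r addr0 add0r mul1r. Qed.

Lemma gen_off_rc x : generic_pt x -> off_lattice (r - c) x.
Proof.
move=> h k; have := gen_off 0 1 (-1) h k.
by rewrite add0r mul1r rmorphN /= mulN1r.
Qed.

End Fixed.
End Scalars.

(** * Difference equations of the scalar factor *)

Section ScalarShift.
Variable R : realType.
Notation C := R[i].
Implicit Types (x y w r : C).

(** The function [S0] of x = i b / pi. *)
Definition S2_ratio (w1 w2 : C) x : C :=
  (S2 (- x) w1 w2 * S2 (1 + x) w1 w2) / (S2 x w1 w2 * S2 (1 - x) w1 w2).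

Lemma S2_ratio_neq0 (w1 w2 : C) x : S2_ratio w1 w2 x != 0.
Proof.
have h y := S2_neq0 y w1 w2.
apply: mulf_neq0; first by apply: mulf_neq0; apply: h.
by apply: invr_neq0; apply: mulf_neq0; apply: h.
Qed.

Lemma S2_ratio_shift u (w1 w2 : C) x : good_dir u w1 w2 -> w2 != 0 ->
  (forall y, y \in [:: x; x + 1; x + w1; x + w1 - 1] -> off_lattice w2 y) ->
  S2_ratio w1 w2 (x + w1) = S2_ratio w1 w2 x *
    (sn w2 (x + w1) * sn w2 x / (sn w2 (x + 1) * sn w2 (x + w1 - 1))).
Proof.
move=> hu w20 hoff; have [K hK] := S2_shift hu.
have offN y : off_lattice w2 y -> off_lattice w2 (- y).
  by move=> h k; have := h (- k); rewrite rmorphN /= mulNr eqr_oppLR.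
have o1 : off_lattice w2 x by apply: hoff; rewrite !inE eqxx.
have o2 : off_lattice w2 (x + 1) by apply: hoff; rewrite !inE eqxx orbT.
have o3 : off_lattice w2 (x + w1) by apply: hoff; rewrite !inE eqxx !orbT.
have o4 : off_lattice w2 (x + w1 - 1) by apply: hoff; rewrite !inE eqxx !orbT.
have e1 := hK x o1.
have e2 := hK (x + 1) o2.
have e3 := hK (- (x + w1)) (offN _ o3).
have e4 := hK (- (x + w1 - 1)) (offN _ o4).
rewrite -/(sn w2 _) in e1; rewrite -/(sn w2 _) in e2.
rewrite -/(sn w2 (- (x + w1))) snN in e3; rewrite -/(sn w2 (- (x + w1 - 1))) snN in e4.
have p3 : - (x + w1) + w1 = - x by ring.
have p4 : - (x + w1 - 1) + w1 = 1 - x by ring.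
have p2 : x + 1 + w1 = 1 + (x + w1) by ring.
have p2' : x + 1 = 1 + x by ring.
have p4' : - (x + w1 - 1) = 1 - (x + w1) by ring.
rewrite p3 in e3; rewrite p4 p4' in e4; rewrite p2 [in S2 (x + 1)]p2' in e2.
have s1 := sn_neq0 w20 o1; have s2 := sn_neq0 w20 o2.
have s3 := sn_neq0 w20 o3; have s4 := sn_neq0 w20 o4.
rewrite /S2_ratio.
have n1 := S2_neq0 x w1 w2; have n2 := S2_neq0 (1 - x) w1 w2.
have n3 := S2_neq0 (x + w1) w1 w2; have n4 := S2_neq0 (1 - (x + w1)) w1 w2.
move: (sn w2 x) (sn w2 (x + 1)) (sn w2 (x + w1)) (sn w2 (x + w1 - 1)) s1 s2 s3 s4 e1 e2 e3 e4
  => sa sb sc sd s1 s2 s3 s4.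
move: (S2 x w1 w2) (S2 (1 - x) w1 w2) (S2 (x + w1) w1 w2) (S2 (1 - (x + w1)) w1 w2)
  (S2 (- x) w1 w2) (S2 (1 + x) w1 w2) (S2 (- (x + w1)) w1 w2) (S2 (1 + (x + w1)) w1 w2)
  n1 n2 n3 n4 => a b c d e f g h n1 n2 n3 n4 e1 e2 e3 e4.
have K0 : K != 0.
  by apply/eqP => K0; move/eqP: e1; rewrite K0 mul0r mulf_eq0 (negbTE n3) (negbTE s1).
have -> : a = c * sa / K by rewrite e1 mulrC mulKf.
have -> : f = h * sb / K by rewrite e2 mulrC mulKf.
have -> : g = e * - sc / K by rewrite e3 mulrC mulKf.
have -> : d = b * - sd / K by rewrite e4 mulrC mulKf.
by field; rewrite K0 n3 n2 s1 s2 s4.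
Qed.

(** The quotient by which the scalar factor of the R-matrix changes when x is shifted. *)
Definition sin_ratio w x : C := sn w x ^+ 2 / (sn w (x + 1) * sn w (x - 1)).

Definition off_lattice3 w x := [/\ off_lattice w x, off_lattice w (x + 1) & off_lattice w (x - 1)].

Lemma off_lattice3_sn w x : w != 0 -> off_lattice3 w x -> [/\ sn w x != 0, sn w (x + 1) != 0 & sn w (x - 1) != 0].
Proof. by move=> w0 [h1 h2 h3]; split; apply: sn_neq0. Qed.

Lemma sin_ratio_neq0 w x : w != 0 -> off_lattice3 w x -> sin_ratio w x != 0.
Proof.
move=> w0 /(off_lattice3_sn w0) [h1 h2 h3]; rewrite /sin_ratio; apply: mulf_neq0; first exact: expf_neq0.
by apply: invr_neq0; apply: mulf_neq0.
Qed.

Lemma sin_ratioD w x : w != 0 -> sin_ratio w (x + w) = sin_ratio w x.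
Proof.
move=> w0; rewrite /sin_ratio.
have -> : x + w + 1 = x + 1 + w by ring.
have -> : x + w - 1 = x - 1 + w by ring.
by rewrite !snDw // sqrrN mulrNN.
Qed.

(** The scalar factor of the R-matrix of parameter w, up to a constant. *)
Definition Rfactor (N w : C) x : C :=
  S2_ratio w N x * (sn N (1 - x) / sn N x) * (sn w x / sn w (x + 1)).

Lemma Rfactor_neq0 (N w : C) x : N != 0 -> w != 0 -> off_lattice3 N x -> off_lattice3 w x -> Rfactor N w x != 0.
Proof.
move=> N0 w0 /(off_lattice3_sn N0) [h1 h2 h3] /(off_lattice3_sn w0) [h4 h5 h6]; rewrite /Rfactor.
have -> : 1 - x = - (x - 1) by ring.
rewrite snN; apply: mulf_neq0; last by apply: mulf_neq0 => //; apply: invr_neq0.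
apply: mulf_neq0; first exact: S2_ratio_neq0.
by apply: mulf_neq0; [rewrite oppr_eq0|apply: invr_neq0].
Qed.

(** The double sines are shifted by their first period. *)
Lemma Rfactor_shift u (N w : C) x : good_dir u w N -> N != 0 -> w != 0 ->
  off_lattice3 N x -> off_lattice3 N (x + w) -> off_lattice3 w x ->
  Rfactor N w (x + w) = Rfactor N w x * sin_ratio N x.
Proof.
move=> hu N0 w0 oN oN' ow.
have hf : S2_ratio w N (x + w) = S2_ratio w N x *
    (sn N (x + w) * sn N x / (sn N (x + 1) * sn N (x + w - 1))).
  apply: (S2_ratio_shift hu N0) => y; case: oN => a b d; case: oN' => a' b' d'.
  by rewrite !inE => /or4P[] /eqP ->.
have [h1 h2 h3] := off_lattice3_sn N0 oN; have [h4 h5 h6] := off_lattice3_sn N0 oN'.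
have [h7 h8 h9] := off_lattice3_sn w0 ow.
rewrite /Rfactor hf /sin_ratio.
have -> : 1 - (x + w) = - (x + w - 1) by ring.
have -> : 1 - x = - (x - 1) by ring.
have -> : x + w + 1 = x + 1 + w by ring.
rewrite !snN !(snDw _ w0).
move: (S2_ratio _ _ _) (sn N x) (sn N (x + 1)) (sn N (x - 1)) (sn N (x + w)) (sn N (x + w - 1))
  (sn w x) (sn w (x + 1)) h1 h2 h3 h4 h5 h6 h7 h8 => F a b d e f g h h1 h2 h3 h4 h5 h6 h7 h8.
by field; rewrite h1 h2 h3 h4 h6 h8.
Qed.

(** By symmetry of the double sine in its periods, N can play the role of the first one. *)
Lemma Rfactor_shiftN u (N w : C) x : good_dir u w N -> N != 0 -> w != 0 ->
  off_lattice3 w x -> off_lattice3 w (x + N) -> off_lattice3 N x ->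
  Rfactor N w (x + N) = Rfactor N w x * sin_ratio w (x + N).
Proof.
move=> hu N0 w0 ow ow' oN.
have hu' : good_dir u N w by case: hu.
have sym y : S2_ratio w N y = S2_ratio N w y by rewrite /S2_ratio !(S2_sym _ w N).
have hf : S2_ratio w N (x + N) = S2_ratio w N x *
    (sn w (x + N) * sn w x / (sn w (x + 1) * sn w (x + N - 1))).
  rewrite !sym; apply: (S2_ratio_shift hu' w0) => y; case: ow => a b d; case: ow' => a' b' d'.
  by rewrite !inE => /or4P[] /eqP ->.
have [h1 h2 h3] := off_lattice3_sn w0 ow; have [h4 h5 h6] := off_lattice3_sn w0 ow'.
have [h7 h8 h9] := off_lattice3_sn N0 oN.
rewrite /Rfactor hf /sin_ratio.
have -> : 1 - (x + N) = - (x - 1 + N) by ring.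
have -> : 1 - x = - (x - 1) by ring.
rewrite !snN !(snDw _ N0).
move: (S2_ratio _ _ _) (sn w x) (sn w (x + 1)) (sn w (x + N + 1)) (sn w (x + N)) (sn w (x + N - 1))
  (sn N x) (sn N (x - 1)) h1 h2 h4 h5 h6 h7 h9 => F a b d e f g h h1 h2 h4 h5 h6 h7 h9.
by field; rewrite ?h1 ?h2 ?h4 ?h5 ?h6 ?h7 ?h9.
Qed.

End ScalarShift.

(** * The scalar factor at the critical level *)

Section CriticalScalar.
Variable R : realType.
Notation C := R[i].
Variables (n : nat) (r c : C).
Hypothesis generic_rc : generic_params r c.
Let N : C := n.+2%:R.
Implicit Types (x y : C).

Let N0 : N != 0. Proof. by rewrite pnatr_eq0. Qed.

Lemma generic_r_neq0 : r != 0.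
Proof. by case: generic_rc => h _ _ _; apply: contraNneq h => ->. Qed.

Lemma generic_rc_neq0 : r - c != 0.
Proof. by case: generic_rc => _ h _ _; apply: contraNneq h => ->. Qed.

Notation G := (Rfactor N r).
Notation Gs := (Rfactor N (r - c)).
Notation A := (sin_ratio N).
Notation Ar := (sin_ratio r).

Lemma gen_pm1 x : generic_pt r c x -> generic_pt r c (x + 1) /\ generic_pt r c (x - 1).
Proof.
by move=> h; split; [apply: (gen_shift' (k := 1) (l := 0) (m := 0) _ h)|
  apply: (gen_shift' (k := -1) (l := 0) (m := 0) _ h)]; rewrite ?rmorphN /=; ring.
Qed.

Lemma gen_off3N x : generic_pt r c x -> off_lattice3 N x.
Proof. by move=> h; have [h1 h2] := gen_pm1 h; split; apply: gen_offN; eassumption. Qed.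

Lemma gen_off3r x : generic_pt r c x -> off_lattice3 r x.
Proof. by move=> h; have [h1 h2] := gen_pm1 h; split; apply: gen_off_r; eassumption. Qed.

Lemma gen_off3rc x : generic_pt r c x -> off_lattice3 (r - c) x.
Proof. by move=> h; have [h1 h2] := gen_pm1 h; split; apply: gen_off_rc; eassumption. Qed.

Lemma genDr x (k : int) : generic_pt r c x -> generic_pt r c (x + k%:~R * r).
Proof. by apply: (gen_shift' (k := 0) (l := k) (m := 0)); ring. Qed.

Lemma genDrn x (k : nat) : generic_pt r c x -> generic_pt r c (x + k%:R * r).
Proof. by move=> h; have := genDr k h; rewrite -pmulrn. Qed.

Lemma genBrn x (k : nat) : generic_pt r c x -> generic_pt r c (x - k%:R * r).
Proof. by move=> h; have := genDr (- k%:Z) h; rewrite rmorphN /= -pmulrn mulNr. Qed.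

Lemma genDN x : generic_pt r c x -> generic_pt r c (x + N).
Proof. by apply: (gen_shift' (k := n.+2) (l := 0) (m := 0)); rewrite -pmulrn /N; ring. Qed.

Lemma genBN x : generic_pt r c x -> generic_pt r c (x - N).
Proof. by apply: (gen_shift' (k := - n.+2%:Z) (l := 0) (m := 0)); rewrite rmorphN /= -pmulrn /N; ring. Qed.

Lemma genDrs x : generic_pt r c x -> generic_pt r c (x + (r - c)).
Proof. by apply: (gen_shift' (k := 0) (l := 1) (m := -1)); rewrite rmorphN /=; ring. Qed.

Lemma genBrs x : generic_pt r c x -> generic_pt r c (x - (r - c)).
Proof. by apply: (gen_shift' (k := 0) (l := -1) (m := 1)); rewrite rmorphN /=; ring. Qed.

Let hr : good_dir ((cmod r)%:C + r) r N.
Proof. by case: generic_rc => h _ _ _; exact: good_dir_nat. Qed.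

Let hrs : good_dir ((cmod (r - c))%:C + (r - c)) (r - c) N.
Proof. by case: generic_rc => _ h _ _; exact: good_dir_nat. Qed.

Lemma Gs_shift x : generic_pt r c x -> Gs (x + (r - c)) = Gs x * A x.
Proof.
move=> h; apply: (Rfactor_shift hrs N0 generic_rc_neq0).
- exact: gen_off3N.
- exact/gen_off3N/genDrs.
- exact: gen_off3rc.
Qed.

Lemma G_shift x p : generic_pt r c x -> G (x + p%:R * r) = G x * \prod_(j < p) A (x + j%:R * r).
Proof.
move=> h; elim: p => [|p IH]; first by rewrite mul0r addr0 big_ord0 mulr1.
have -> : x + p.+1%:R * r = x + p%:R * r + r by rewrite -natr1; ring.
have h2 := genDrn p h.
rewrite (Rfactor_shift hr N0 generic_r_neq0) ?IH ?big_ord_recr /= ?mulrA //.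
- exact: gen_off3N.
- by apply: gen_off3N; have := genDrn p.+1 h; rewrite -natr1 mulrDl mul1r addrA.
- exact: gen_off3r.
Qed.

Lemma G_shiftN x : generic_pt r c x -> G (x + N) = G x * Ar (x + N).
Proof.
move=> h; apply: (Rfactor_shiftN hr N0 generic_r_neq0).
- exact: gen_off3r.
- exact/gen_off3r/genDN.
- exact: gen_off3N.
Qed.

Lemma A_neq0 x : generic_pt r c x -> A x != 0.
Proof. by move=> h; apply: sin_ratio_neq0 => //; apply: gen_off3N. Qed.

Lemma Ar_neq0 x : generic_pt r c x -> Ar x != 0.
Proof. by move=> h; apply: sin_ratio_neq0; [exact: generic_r_neq0|apply: gen_off3r]. Qed.

Lemma G_neq0 x : generic_pt r c x -> G x != 0.
Proof.
move=> h; apply: Rfactor_neq0; [exact: N0|exact: generic_r_neq0|exact: gen_off3N|exact: gen_off3r].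
Qed.

Lemma Gs_neq0 x : generic_pt r c x -> Gs x != 0.
Proof.
move=> h; apply: Rfactor_neq0; [exact: N0|exact: generic_rc_neq0|exact: gen_off3N|exact: gen_off3rc].
Qed.

Lemma AN x : A (x - N) = A x.
Proof. by rewrite -[in RHS](subrK N x) sin_ratioD. Qed.

Lemma G_back x p : generic_pt r c x -> G x = G (x - p%:R * r) * \prod_(j < p) A (x - j.+1%:R * r).
Proof.
move=> h; have := G_shift p (genBrn p h); rewrite subrK => ->; apply: congr2 => //.
rewrite (reindex_inj rev_ord_inj) /=; apply: eq_bigr => j _; apply: congr1.
by rewrite natrB //; ring.
Qed.

Lemma prodA_neq0 (f : nat -> C) p : (forall j, generic_pt r c (f j)) -> \prod_(j < p) A (f j) != 0.
Proof. by move=> h; apply/prodf_neq0 => j _; apply: A_neq0. Qed.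

(** At the critical level, rs = r - c is (M + 1) r + N. So on the left-hand side G is shifted by
M + 1 multiples of r, which yields the product, and by N, which yields the quotient of Ar. *)
Lemma critical_scalar (M : int) x : M%:~R * r = - c - N -> generic_pt r c x ->
  G (x - (r - c)) * G (x + (r - c)) * (A (x - (r - c)) / A x) =
  G x ^+ 2 * (Ar (x + N) / Ar x) *
  \prod_(1 <= k < (Kbound M).+1) (A (x + k%:R * r) / A (x - k%:R * r)).
Proof.
move=> hM h.
have rsE : r - c = (M + 1)%:~R * r + N by rewrite rmorphD /= mulrDl hM mul1r; ring.
rewrite big_add1 /= big_mkord big_split /= prodfV.
have A0 := A_neq0 h; have Ar0 := Ar_neq0 h; have G0 := G_neq0 h.
have e1 := G_shiftN h.
have e2 : G x = G (x - N) * Ar x.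
  by have := G_shiftN (genBN h); rewrite subrK.
have G0N := G_neq0 (genBN h).
(* The shift by (M + 1) r consists of p steps, in one direction or the other. *)
have pos (p : nat) : (M + 1 = p)%R -> G (x - (r - c)) * G (x + (r - c)) * (A (x - (r - c)) / A x) =
   G x ^+ 2 * (Ar (x + N) / Ar x) *
   (\prod_(j < p) A (x + j%:R * r) / \prod_(j < p) A (x - j.+1%:R * r) * (A (x - p%:R * r) / A x)).
  move=> hp; rewrite rsE hp -pmulrn.
  have -> : x - (p%:R * r + N) = x - p%:R * r - N by ring.
  have -> : x + (p%:R * r + N) = x + N + p%:R * r by ring.
  rewrite AN (G_shift p (genDN h)) e1.
  have e3 := G_back p (genBN h).
  have e4 : x - N - p%:R * r = x - p%:R * r - N by ring.
  rewrite e4 in e3.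
  have e5 : \prod_(j < p) A (x - N - j.+1%:R * r) = \prod_(j < p) A (x - j.+1%:R * r).
    by apply: eq_bigr => j _; rewrite -[RHS]AN; apply: congr1; ring.
  have e6 : \prod_(j < p) A (x + N + j%:R * r) = \prod_(j < p) A (x + j%:R * r).
    by apply: eq_bigr => j _; rewrite -[LHS]AN; apply: congr1; ring.
  have P0 := prodA_neq0 (f := fun j => x - j.+1%:R * r) p (fun j => genBrn j.+1 h).
  rewrite e5 in e3; rewrite e6 e2 e3.
  move: (G (x - p%:R * r - N)) (\prod_(j < p) A (x + j%:R * r)) (\prod_(j < p) A (x - j.+1%:R * r))
    (Ar (x + N)) (Ar x) (A (x - p%:R * r)) (A x) P0 A0 Ar0 => g P Q a b d e P0 A0 Ar0.
  by field; rewrite P0 A0 Ar0.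
have neg (p : nat) : (M + 1 = - p%:Z)%R -> G (x - (r - c)) * G (x + (r - c)) * (A (x - (r - c)) / A x) =
   G x ^+ 2 * (Ar (x + N) / Ar x) *
   (\prod_(j < p) A (x + j%:R * r) / \prod_(j < p) A (x - j.+1%:R * r) * (A (x + p%:R * r) / A x)).
  move=> hp; rewrite rsE hp rmorphN /= -pmulrn.
  have -> : x - (- p%:R * r + N) = x - N + p%:R * r by ring.
  have -> : x + (- p%:R * r + N) = x + N - p%:R * r by ring.
  have e3 := G_back p (genDN h); rewrite e1 in e3.
  have e5 : \prod_(j < p) A (x + N - j.+1%:R * r) = \prod_(j < p) A (x - j.+1%:R * r).
    by apply: eq_bigr => j _; rewrite -[LHS]AN; apply: congr1; ring.
  have e6 : \prod_(j < p) A (x - N + j%:R * r) = \prod_(j < p) A (x + j%:R * r).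
    by apply: eq_bigr => j _; rewrite -[RHS]AN; apply: congr1; ring.
  have e7 : A (x - N + p%:R * r) = A (x + p%:R * r) by rewrite -[RHS]AN; apply: congr1; ring.
  have P0 := prodA_neq0 (f := fun j => x - j.+1%:R * r) p (fun j => genBrn j.+1 h).
  rewrite (G_shift p (genBN h)) e6 e7.
  rewrite e5 in e3.
  have e8 : G (x + N - p%:R * r) = G x * Ar (x + N) / \prod_(j < p) A (x - j.+1%:R * r).
    by rewrite e3 mulfK.
  rewrite e8 e2.
  move: (G (x - N)) (\prod_(j < p) A (x + j%:R * r)) (\prod_(j < p) A (x - j.+1%:R * r))
    (Ar (x + N)) (Ar x) (A (x + p%:R * r)) (A x) P0 A0 Ar0 => g P Q a b d e P0 A0 Ar0.
  by field; rewrite P0 A0 Ar0.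
have P0 p := prodA_neq0 (f := fun j => x - j.+1%:R * r) p (fun j => genBrn j.+1 h).
case: M hM rsE pos neg => q hM rsE pos neg.
  have hq : (q%:Z + 1 = q.+1)%R by rewrite -addn1 PoszD.
  rewrite (pos _ hq) /Kbound; apply: congr1.
  have -> : (if 0 < q%:Z then `|q%:Z|%N else `|q%:Z|.-1) = q by case: (q).
  rewrite big_ord_recl big_ord_recr /= mul0r addr0.
  have -> : \prod_(j < q) A (x + (bump 0 j)%:R * r) = \prod_(j < q) A (x + j.+1%:R * r) by [].
  have Aq := A_neq0 (genBrn q.+1 h); have Pq := P0 q.
  move: (\prod_(j < q) A (x + j.+1%:R * r)) (\prod_(j < q) A (x - j.+1%:R * r))
    (A (x - q.+1%:R * r)) (A x) Aq Pq A0 => a b d e Aq Pq A0.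
  by field; rewrite Aq Pq A0.
have hq : (Negz q + 1 = - q%:Z)%R by rewrite NegzE -addn1 PoszD opprD addrNK.
rewrite (neg _ hq) /Kbound /=; apply: congr1.
case: q {hM rsE pos neg hq} => [|q].
  by rewrite !big_ord0 mul0r addr0 !divff ?oner_neq0 // mulr1.
rewrite big_ord_recl mul0r addr0 [in RHS]big_ord_recr /=.
have -> : \prod_(j < q) A (x + (bump 0 j)%:R * r) = \prod_(j < q) A (x + j.+1%:R * r) by [].
have Pq := P0 q.+1.
move: (\prod_(j < q) A (x + j.+1%:R * r)) (\prod_(j < q.+1) A (x - j.+1%:R * r))
  (A (x + q.+1%:R * r)) (A x) Pq A0 => a b d e Pq A0.
by field; rewrite Pq A0.
Qed.

Lemma Yfun_sin_ratio (M : int) (b : C) : let x := 'i%C * b / cpi R in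
  Yfun n r M (- b) = \prod_(1 <= k < (Kbound M).+1) (A (x + k%:R * r) / A (x - k%:R * r)).
Proof.
move=> x; rewrite /Yfun; apply: eq_bigr => k _.
have p0 := cpi_neq0 R.
have e : 'i%C * - b = cpi R * - x by rewrite /x !mulrN [in RHS]mulrC divfK.
have sE (y z : C) : y = cpi R * z -> csin (y / N) = sn N z.
  by move=> ->; rewrite /sn mulrA.
rewrite e.
rewrite (sE _ (- (x + k%:R * r))); last by ring.
rewrite (sE _ (- (x - k%:R * r))); last by ring.
rewrite (sE _ (- (x - k%:R * r - 1))); last by ring.
rewrite (sE _ (- (x + k%:R * r - 1))); last by ring.
rewrite (sE _ (- (x - k%:R * r + 1))); last by ring.
rewrite (sE _ (- (x + k%:R * r + 1))); last by ring.
rewrite !snN /sin_ratio.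
move: (sn N _) (sn N _) (sn N _) (sn N _) (sn N _) (sn N _) => a b1 b2 b3 b4 b5.
by rewrite !invrN !sqrrN !mulrNN !invfM !invrK; ring.
Qed.

End CriticalScalar.

(** * Cotangents and sums over roots of unity *)

Section Cotangent.
Variable R : realType.
Notation C := R[i].
Implicit Types (z w u A B t : C).

Definition ccos z : C := (cexp ('i%C * z) + cexp (- ('i%C * z))) / 2.
Definition ccot z : C := ccos z / csin z.

Lemma csinD A B : csin (A + B) = csin A * ccos B + ccos A * csin B.
Proof.
have i0 := i_neq0 R.
rewrite /csin /ccos mulrDr opprD !cexpD.
by move: (cexp _) (cexp _) (cexp _) (cexp _) => a b c d; field.
Qed.

Lemma ccosD A B : ccos (A + B) = ccos A * ccos B - csin A * csin B.
Proof.
have i0 := i_neq0 R.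
rewrite /csin /ccos mulrDr opprD !cexpD.
move: (cexp ('i%C * A)) (cexp ('i%C * B)) (cexp (- ('i%C * A))) (cexp (- ('i%C * B))) => a b c d.
have -> : (a - c) / (2 * 'i%C) * ((b - d) / (2 * 'i%C)) = (a - c) * (b - d) / (4 * 'i%C ^+ 2).
  by field.
by rewrite sqr_i; field.
Qed.

Lemma ccosN z : ccos (- z) = ccos z.
Proof. by rewrite /ccos mulrN opprK addrC. Qed.

Lemma ccos2csin2 z : ccos z ^+ 2 + csin z ^+ 2 = 1.
Proof.
have := ccosD z (- z); rewrite subrr ccosN csinN mulrN opprK -!expr2 => <-.
by rewrite /ccos mulr0 oppr0 cexp0; field.
Qed.

Lemma ccosDpi z : ccos (z + cpi R) = - ccos z.
Proof.
have h : cexp (- ('i%C * cpi R)) = -1 :> C by rewrite cexpN cexp_ipi invrN1.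
by rewrite /ccos mulrDr opprD !cexpD h cexp_ipi; ring.
Qed.

Lemma ccotDpi z : ccot (z + cpi R) = ccot z.
Proof. by rewrite /ccot ccosDpi csinDpi invrN mulrNN. Qed.

Lemma ccotDpin z k : ccot (z + k%:R * cpi R) = ccot z.
Proof.
elim: k => [|k IH]; first by rewrite mul0r addr0.
by rewrite -natr1 mulrDl mul1r addrA ccotDpi.
Qed.

Lemma csin_cot_add A B : csin A != 0 -> csin B != 0 ->
  csin (A + B) / (csin A * csin B) = ccot A + ccot B.
Proof.
move=> a0 b0; rewrite csinD /ccot.
by move: (csin A) (csin B) (ccos A) (ccos B) a0 b0 => a b d e a0 b0; field; rewrite a0 b0.
Qed.

(** The cotangent formula for a difference, solved for the product. *)
Lemma ccot_mul B D : csin B != 0 -> csin D != 0 -> csin (B + D) != 0 ->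
  ccot (B + D) * ccot B = -1 + ccot D * (ccot B - ccot (B + D)).
Proof.
move=> b0 d0; rewrite /ccot csinD ccosD => s0.
have := ccos2csin2 B; have := ccos2csin2 D.
move: (csin B) (csin D) (ccos B) (ccos D) b0 d0 s0 => b d e f b0 d0 s0 h1 h2.
have : (1 - (f ^+ 2 + d ^+ 2)) * (b ^+ 2) = 0 by rewrite h1; ring.
move=> h3; apply/eqP; rewrite -subr_eq0; apply/eqP.
by field; rewrite b0 d0 s0.
Qed.

Lemma ccot_sqr z : csin z != 0 -> ccot z ^+ 2 = (csin z)^-2 - 1.
Proof.
move=> s0; rewrite /ccot expr_div_n; have := ccos2csin2 z.
move=> /(canRL (addrK _)) ->; field => //.
Qed.

Lemma ccot_exp z : csin z != 0 ->
  ccot z = 'i%C * (1 - 2 / (1 - cexp (2 * 'i%C * z))) .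
Proof.
move=> s0; have i0 := i_neq0 R.
have e : cexp (2 * 'i%C * z) = cexp ('i%C * z) ^+ 2.
  by rewrite -cexpMn; apply: congr1; rewrite -mulr_natl; ring.
have := csinE z; rewrite /ccot /ccos cexpN e.
have v0 : cexp ('i%C * z) != 0 := cexp_neq0 _.
move: (cexp _) v0 => v v0 h.
have -> : csin z = (v - v^-1) / (2 * 'i%C) by rewrite h mulrC mulKf // i2_neq0.
have d0 : 1 - v ^+ 2 != 0.
  apply/eqP => d; move: s0; have -> : csin z = 0; last by rewrite eqxx.
  apply: (mulfI (i2_neq0 R)); rewrite -h mulr0; apply: (mulIf v0).
  rewrite mulrBl mulVf // mul0r -expr2.
  by apply/eqP; rewrite subr_eq0 eq_sym -subr_eq0 d.
have vv0 : v * v - 1 != 0 by rewrite -oppr_eq0 opprB -expr2.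
have -> : (v + v^-1) / 2 / ((v - v^-1) / (2 * 'i%C)) = 'i%C * (v * v + 1) / (v * v - 1).
  by field; rewrite i0 vv0 v0.
by field; rewrite ?vv0 ?d0.
Qed.

Section RootSums.
Variables (M : nat) (om t : C).
Hypothesis hom : M.-primitive_root om.
Hypothesis tM : 1 - t ^+ M != 0.

Let M0 : (0 < M)%N := prim_order_gt0 hom.

Let geo m : (1 - t * om ^+ m) * \sum_(j < M) (t * om ^+ m) ^+ j = 1 - t ^+ M.
Proof.
have := subrX1 (t * om ^+ m) M; rewrite exprMn -exprM mulnC exprM (prim_expr_order hom) expr1n mulr1.
by move=> h; rewrite -[RHS]opprB h -[1 - _]opprB mulNr.
Qed.

Lemma root_den m : 1 - t * om ^+ m != 0.
Proof.
by apply: contraNneq tM => h; have := geo m; rewrite h mul0r => <-.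
Qed.

(** Expand in powers of t: only the exponents divisible by M survive the summation. *)
Lemma sum_inv : \sum_(m < M) (1 - t * om ^+ m)^-1 = M%:R / (1 - t ^+ M).
Proof.
have e m : (1 - t * om ^+ m)^-1 = (\sum_(j < M) (t * om ^+ m) ^+ j) / (1 - t ^+ M).
  apply: (mulIf tM); rewrite divfK // -(geo m) mulrA mulVf ?mul1r //.
  exact: root_den.
under eq_bigr do rewrite e.
rewrite -mulr_suml exchange_big /=; congr (_ / _).
rewrite (bigD1 (Ordinal M0)) //= [X in _ + X]big1 ?addr0.
  by under eq_bigr do rewrite expr0; rewrite sumr_const card_ord.
move=> j j0; under eq_bigr do rewrite exprMn -exprM.
rewrite -mulr_sumr (prim_root_sum _ hom) ifF ?mulr0 //.
by apply/negP => /dvdn_leq; rewrite lt0n => /(_ j0); rewrite leqNgt ltn_ord.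
Qed.

(** Both factors 1 / (1 - t om^m) are written as polynomials over the common denominator
1 - t^M; among the exponents up to 2 M - 1 only M is divisible by M. *)
Lemma sum_inv_sq : \sum_(m < M) (t * om ^+ m) / (1 - t * om ^+ m) ^+ 2 =
  M%:R ^+ 2 * t ^+ M / (1 - t ^+ M) ^+ 2.
Proof.
have e m : (t * om ^+ m) / (1 - t * om ^+ m) ^+ 2 =
   (\sum_(i < M) \sum_(j < M) t ^+ (i + j).+1 * om ^+ (m * (i + j).+1)) / (1 - t ^+ M) ^+ 2.
  have -> : \sum_(i < M) \sum_(j < M) t ^+ (i + j).+1 * om ^+ (m * (i + j).+1) =
     (t * om ^+ m) * (\sum_(j < M) (t * om ^+ m) ^+ j) ^+ 2.
    rewrite expr2 mulr_suml mulr_sumr; apply: eq_bigr => i _.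
    rewrite mulr_sumr mulr_sumr; apply: eq_bigr => j _.
    by rewrite exprM -exprMn -exprD -exprS.
  have g := geo m; have d0 := root_den m.
  have S0 : \sum_(j < M) (t * om ^+ m) ^+ j != 0.
    by apply: contraNneq tM => h; move: g; rewrite h mulr0 => <-.
  rewrite -g; move: (\sum_(j < M) _) S0 => S S0; move: (1 - _) d0 => d d0.
  by field; rewrite S0 d0.
under eq_bigr do rewrite e.
rewrite -mulr_suml; congr (_ / _).
rewrite exchange_big /=; under eq_bigr do rewrite exchange_big /=.
have inner (i j : 'I_M) : \sum_(m < M) t ^+ (i + j).+1 * om ^+ (m * (i + j).+1) =
    if (j == rev_ord i) then M%:R * t ^+ M else 0.
  rewrite -mulr_sumr (prim_root_sum _ hom).
  have hi := ltn_ord i; have hj := ltn_ord j.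
  case: eqP => [->|ne].
    have -> : (i + rev_ord i).+1 = M by rewrite /= -addSn subnKC.
    by rewrite dvdnn mulrC.
  rewrite ifF ?mulr0 //; apply/negP => /dvdnP [q hq]; apply: ne.
  apply: val_inj => /=; case: q hq => [|[|q]] hq.
  - by [].
  - by rewrite mul1n in hq; rewrite -[X in (X - _)%N]hq -addSn addKn.
  - have : ((i + j).+1 < M + M)%N by rewrite -addSn; apply: leq_ltn_trans (leq_add hi (leqnn j)) _; rewrite ltn_add2l.
    by rewrite hq !mulSn addnA ltnNge leq_addr.
transitivity (\sum_(i < M) (M%:R * t ^+ M : C)).
  apply: eq_bigr => i _; under eq_bigr do rewrite inner.
  by rewrite -big_mkcond /= big_pred1_eq.
by rewrite sumr_const card_ord -mulr_natl; ring.
Qed.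

End RootSums.
End Cotangent.

(** * Sums of cotangents over the residues modulo N *)

Section CotangentSums.
Variable R : realType.
Notation C := R[i].
Implicit Types (z x w : C).

Lemma cexp2_neq1 z : csin z != 0 -> 1 - cexp (2 * 'i%C * z) != 0.
Proof.
move=> s0; apply/eqP => d; move/eqP: s0; apply.
have e : cexp (2 * 'i%C * z) = cexp ('i%C * z) ^+ 2.
  by rewrite -cexpMn; apply: congr1; rewrite -mulr_natl; ring.
apply: (mulfI (i2_neq0 R)); have := csinE z; rewrite cexpN mulr0 => <-.
move: d; rewrite e; have := cexp_neq0 ('i%C * z); move: (cexp _) => v v0 d.
apply: (mulIf v0); rewrite mulrBl mulVf // mul0r -expr2.
by apply/eqP; rewrite subr_eq0 eq_sym -subr_eq0 d.
Qed.

Lemma csin_inv_sqr z : csin z != 0 ->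
  (csin z)^-2 = - 4 * (cexp (2 * 'i%C * z) / (1 - cexp (2 * 'i%C * z)) ^+ 2).
Proof.
move=> s0; have i0 := i_neq0 R; have := cexp2_neq1 s0.
have e : cexp (2 * 'i%C * z) = cexp ('i%C * z) ^+ 2.
  by rewrite -cexpMn; apply: congr1; rewrite -mulr_natl; ring.
rewrite e; have := csinE z; rewrite cexpN.
have v0 : cexp ('i%C * z) != 0 := cexp_neq0 _.
move: (cexp _) v0 => v v0 h d0.
have h2 : csin z ^+ 2 = - 4^-1 * (v - v^-1) ^+ 2.
  have := congr1 (fun y => y ^+ 2) h; rewrite /= exprMn exprMn sqr_i => ->.
  by field.
have vv0 : v * v - 1 != 0 by rewrite -oppr_eq0 opprB -expr2.
by rewrite h2; field; rewrite d0 v0 vv0.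
Qed.

Variable n : nat.
Let N : C := n.+2%:R.
Let N0 : N != 0. Proof. by rewrite pnatr_eq0. Qed.

(** This only depends on m modulo N, see [cotN_sub]. *)
Definition cotN w x (m : 'I_n.+2) : C := ccot (cpi R * (x / (N * w)) + (m : nat)%:R * (cpi R / N)).

Section OneParam.
Variable w : C.
Hypothesis w0 : w != 0.

Let theta x (m : nat) : C := cpi R * (x / (N * w)) + m%:R * (cpi R / N).

Lemma cotN_den_int x (m : int) : off_lattice w x ->
  csin (cpi R * (x / (N * w)) + m%:~R * (cpi R / N)) != 0.
Proof.
move=> hx; apply/eqP => /csin_eq0 [k] e.
have := hx (k * n.+2%:Z - m); rewrite rmorphB rmorphM /= -!pmulrn -/N.
move/eqP; apply.
have -> : x = (cpi R * (x / (N * w))) * (N * w / cpi R).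
  by move: (cpi R) (N) (cpi_neq0 R) N0 => p N' p0 N'0; field; rewrite p0 N'0 w0.
by rewrite (canRL (addrK _) e); move: (cpi R) (N) (cpi_neq0 R) N0 => p N' p0 N'0; field; rewrite p0 N'0.
Qed.

Lemma cotN_den x m : off_lattice w x -> csin (theta x m) != 0.
Proof. exact: (@cotN_den_int x m). Qed.

Lemma off_csin x : off_lattice w x -> csin (cpi R * (x / w)) != 0.
Proof. exact: sn_neq0. Qed.

Lemma thetaD x (k d : 'I_n.+2) :
  exists j, theta x (k + d)%N = theta x (k + d)%R + j%:R * cpi R.
Proof.
exists ((k + d) %/ n.+2)%N; rewrite /theta.
have -> : (((k + d)%R : 'I_n.+2) : nat) = ((k + d) %% n.+2)%N by [].
rewrite {1}(divn_eq (k + d) n.+2) natrD natrM -/N.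
by move: (cpi R) (N) (cpi_neq0 R) N0 => p N' p0 N'0; field; rewrite ?N'0 ?w0 ?p0.
Qed.

Lemma cotN_sub x (k d : 'I_n.+2) :
  cotN w x (k - d) = ccot (cpi R * (x / (N * w)) + ((k : nat)%:R - (d : nat)%:R) * (cpi R / N)).
Proof.
have [j] := thetaD x (k - d) d; rewrite subrK => e.
rewrite -(ccotDpin _ j).
have -> : cpi R * (x / (N * w)) + ((k : nat)%:R - (d : nat)%:R) * (cpi R / N) + j%:R * cpi R
   = theta x k + j%:R * cpi R - (d : nat)%:R * (cpi R / N) by rewrite /theta; ring.
rewrite -e /theta natrD /cotN.
by apply: congr1; ring.
Qed.

Lemma cotN_shift x (m : 'I_n.+2) : cotN w (x - w) m = cotN w x (m - 1).
Proof.
rewrite cotN_sub /cotN; apply: congr1.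
have -> : (1 : 'I_n.+2) = 1%N :> nat by [].
by move: (cpi R) (N) (cpi_neq0 R) N0 => p N' p0 N'0; field; rewrite N'0 w0.
Qed.

Let om : C := cexp (2 * 'i%C * cpi R / N).
Let om_prim : n.+2.-primitive_root om.
Proof. exact: (@prim_root_cexp R n.+2 isT). Qed.
Let t x : C := cexp (2 * 'i%C * (cpi R * (x / (N * w)))).

Let tE x : t x ^+ n.+2 = cexp (2 * 'i%C * (cpi R * (x / w))).
Proof.
rewrite -cexpMn -(mulr_natl _ n.+2); apply: congr1; rewrite -/N.
by move: (cpi R) (N) (cpi_neq0 R) N0 => p N' p0 N'0; field; rewrite N'0 w0.
Qed.

Let thE x m : cexp (2 * 'i%C * theta x m) = t x * om ^+ m.
Proof.
rewrite -cexpMn -cexpD; apply: congr1; rewrite /theta -(mulr_natl _ m).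
by move: (cpi R) (N) (cpi_neq0 R) N0 => p N' p0 N'0; field; rewrite N'0 w0.
Qed.

Let tne x : off_lattice w x -> 1 - t x ^+ n.+2 != 0.
Proof. by move=> h; rewrite tE; apply/cexp2_neq1/off_csin. Qed.

Lemma cotN_sum x : off_lattice w x ->
  \sum_(m < n.+2) cotN w x m = N * ccot (cpi R * (x / w)).
Proof.
move=> hx.
have e (m : 'I_n.+2) : cotN w x m = 'i%C * (1 - 2 * (1 - t x * om ^+ m)^-1).
  by rewrite /cotN ccot_exp ?(cotN_den m hx) // thE.
under eq_bigr do rewrite e.
rewrite -mulr_sumr sumrB -mulr_sumr (sum_inv om_prim (tne hx)).
rewrite sumr_const card_ord ccot_exp ?off_csin // -tE -/N.
have := tne hx; by move: (1 - _) (N) => d N' d0; field.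
Qed.

Lemma csc_sum x : off_lattice w x ->
  \sum_(m < n.+2) (csin (theta x m))^-2 = N ^+ 2 * (csin (cpi R * (x / w)))^-2.
Proof.
move=> hx.
under eq_bigr do rewrite (csin_inv_sqr (cotN_den _ hx)) thE.
rewrite -mulr_sumr (sum_inv_sq om_prim (tne hx)) csin_inv_sqr ?off_csin // -tE -/N.
have := tne hx; by move: (t x ^+ _) (N) => T N' d0; field.
Qed.

Lemma cotN_sqr_sum x : off_lattice w x ->
  \sum_(m < n.+2) cotN w x m ^+ 2 = N ^+ 2 * (csin (cpi R * (x / w)))^-2 - N.
Proof.
move=> hx.
have e (m : 'I_n.+2) : cotN w x m ^+ 2 = (csin (theta x m))^-2 - 1.
  by rewrite /cotN ccot_sqr // (cotN_den m hx).
under eq_bigr do rewrite e.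
by rewrite sumrB csc_sum // sumr_const card_ord.
Qed.

Let csin_ord (p : 'I_n.+2) : p != 0 -> csin ((p : nat)%:R * (cpi R / N)) != 0.
Proof.
move=> p0; apply/eqP => /csin_eq0 [k] e; move/eqP: p0; apply; apply: val_inj => /=.
have e2 : (p : nat)%:R = (k * n.+2%:Z)%:~R :> C.
  rewrite rmorphM /= -!pmulrn -/N; apply: (mulIf (cpi_neq0 R)).
  by rewrite mulrAC -e; move: (cpi R) (N) N0 => q N' N'0; field.
have e3 : (p : nat)%:Z = k * n.+2%:Z by apply: (@intr_inj C); rewrite -pmulrn.
case: k e e2 e3 => [[|q]|q] _ _ e3.
- by rewrite mul0r in e3; case: e3.
- have := ltn_ord p; case: e3 => ->; by rewrite mulSn ltnNge leq_addr.
- by [].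
Qed.

(** By [ccot_mul], cot(a) cot(a + d) is -1 plus a multiple of cot(a) - cot(a + d), and these
differences cancel in the sum over all the residues. *)
Lemma cotN_corr x (p : 'I_n.+2) : off_lattice w x -> p != 0 ->
  \sum_(m < n.+2) cotN w x m * cotN w x (m + p) = - N.
Proof.
move=> hx p0.
have e (m : 'I_n.+2) : cotN w x m * cotN w x (m + p) =
    -1 + ccot ((p : nat)%:R * (cpi R / N)) * (cotN w x m - cotN w x (m + p)).
  have h : cotN w x (m + p) = ccot (theta x m + (p : nat)%:R * (cpi R / N)).
    have [j hj] := thetaD x m p; rewrite /cotN -/(theta x (m + p)%R) -(ccotDpin _ j) -hj.
    by rewrite /theta natrD; apply: congr1; ring.
  rewrite h mulrC {2}/cotN -/(theta x m) ccot_mul //.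
  - exact: cotN_den.
  - exact: csin_ord.
  - have -> : theta x m + (p : nat)%:R * (cpi R / N) = theta x (m + p)%N.
      by rewrite /theta natrD; ring.
    exact: cotN_den.
under eq_bigr do rewrite e.
rewrite big_split /= -mulr_sumr sumrB sumr_const card_ord.
have -> : \sum_(m < n.+2) cotN w x (m + p) = \sum_(m < n.+2) cotN w x m.
  by rewrite [RHS](reindex_inj (addIr p)).
by rewrite subrr mulr0 addr0 mulNrn.
Qed.

End OneParam.
End CotangentSums.

(** * The trigonometric R-matrix: quasi-periodicity and unitarity *)

Section Tensor.
Variable n : nat.
Notation I := 'I_n.+2.
Notation pr a b := (@mxtens_index n.+2 n.+2 (a, b)).

Lemma sum_tens (V : nmodType) (F : 'I_(n.+2 * n.+2) -> V) :
  \sum_u F u = \sum_(i < n.+2) \sum_(j < n.+2) F (pr i j).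
Proof.
rewrite pair_big /= (reindex (@mxtens_index n.+2 n.+2)) /=.
  by apply: eq_bigr => -[i j].
exists (@mxtens_unindex n.+2 n.+2) => u _; [exact: mxtens_indexK|exact: mxtens_unindexK].
Qed.

Lemma tens_ext (T : Type) (X Y : 'M[T]_(n.+2 * n.+2)) :
  (forall a b k d, X (pr a b) (pr k d) = Y (pr a b) (pr k d)) -> X = Y.
Proof.
move=> h; apply/matrixP => u v.
by case: (mxtens_indexP u) => a b; case: (mxtens_indexP v) => k d; apply: h.
Qed.

Lemma sum_antidiag (V : pzSemiRingType) (s : I) (f : I -> I -> V) :
  \sum_p \sum_q (s == p + q)%:R * f p q = \sum_p f p (s - p).
Proof.
apply: eq_bigr => p _; rewrite (bigD1 (s - p)) //= [p + _]addrC subrK eqxx mul1r.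
rewrite big1 ?addr0 // => q hq; case: eqP => [h|_]; last by rewrite mul0r.
by move/eqP: hq; case; rewrite h addrC addKr.
Qed.

Lemma pr_eq (a b k d : I) : (pr a b == pr k d) = (a == k) && (b == d).
Proof. by rewrite (can_eq (@mxtens_indexK n.+2 n.+2)). Qed.

End Tensor.

Section TrigMatrices.
Variable R : realType.
Notation C := R[i].
Variable n : nat.
Let N : C := n.+2%:R.
Notation I := 'I_n.+2.
Notation pr a b := (@mxtens_index n.+2 n.+2 (a, b)).
Implicit Types (x y w : C) (a b k d p q l : I) (X : 'M[C]_(n.+2 * n.+2)).

(** The R-matrix of parameter w without its scalar factor, with a quotient of sines
sin(a + b) / (sin a sin b) rewritten as cot a + cot b. *)
Definition Rtrig w x : 'M[C]_(n.+2 * n.+2) := \matrix_(u, v)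
  let: (a, b) := mxtens_unindex u in let: (k, d) := mxtens_unindex v in
  (a + b == k + d)%:R * (cotN w x (b - k) + cotN w 1 (k - a)).

(** The matrix [Rtrig w (- x)] with the two tensor factors exchanged. *)
Definition Rtrig_inv w x : 'M[C]_(n.+2 * n.+2) := \matrix_(u, v)
  let: (a, b) := mxtens_unindex u in let: (k, d) := mxtens_unindex v in
  (a + b == k + d)%:R * (cotN w 1 (a - k) - cotN w x (b - k)).

Lemma RtrigE w x a b k d : Rtrig w x (pr a b) (pr k d) =
  (a + b == k + d)%:R * (cotN w x (b - k) + cotN w 1 (k - a)).
Proof. by rewrite mxE !mxtens_indexK. Qed.

Lemma Rtrig_invE w x a b k d : Rtrig_inv w x (pr a b) (pr k d) =
  (a + b == k + d)%:R * (cotN w 1 (a - k) - cotN w x (b - k)).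
Proof. by rewrite mxE !mxtens_indexK. Qed.

Lemma hmat_mulE (m : nat) (X : 'M[C]_(n.+2, m)) a j : (hmat R n *m X) a j = X (a + 1) j.
Proof.
rewrite mxE (bigD1 (a + 1)) //= mxE eqxx mul1r big1 ?addr0 // => k hk.
by rewrite mxE eq_sym (negbTE hk) mul0r.
Qed.

Lemma hmat_unit : hmat R n \is a GRing.unit.
Proof.
have h : hmat R n * (hmat R n)^T = 1.
  apply/matrixP => a b; rewrite hmat_mulE !mxE.
  by rewrite (inj_eq (addIr 1)) eq_sym.
by case: (mulmx1_unit h).
Qed.

Notation h1 := (hmat R n *t (1%:M : 'M[C]_n.+2)).
Notation h2 := ((1%:M : 'M[C]_n.+2) *t hmat R n).

Lemma h1_mul X a b v : (h1 *m X) (pr a b) v = X (pr (a + 1) b) v :> C.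
Proof.
rewrite mxE sum_tens (bigD1 (a + 1)) //= [X in _ + X]big1 ?addr0; last first.
  move=> k hk; rewrite big1 // => j _.
  by rewrite tensmxE mxE eq_sym (negbTE hk) !mul0r.
rewrite (bigD1 b) //= tensmxE !mxE !eqxx !mul1r big1 ?addr0 // => j hj.
by rewrite tensmxE !mxE eq_sym (negbTE hj) mulr0 mul0r.
Qed.

Lemma h2_mul X a b v : (h2 *m X) (pr a b) v = X (pr a (b + 1)) v :> C.
Proof.
rewrite mxE sum_tens (bigD1 a) //= [X in _ + X]big1 ?addr0; last first.
  move=> k hk; rewrite big1 // => j _.
  by rewrite tensmxE !mxE eq_sym (negbTE hk) !mul0r.
rewrite (bigD1 (b + 1)) //= tensmxE !mxE !eqxx !mul1r big1 ?addr0 // => j hj.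
by rewrite tensmxE !mxE eq_sym (negbTE hj) mulr0 mul0r.
Qed.

Lemma mul_h1 X u k d : (X *m h1) u (pr k d) = X u (pr (k - 1) d) :> C.
Proof.
rewrite mxE sum_tens (bigD1 (k - 1)) //= [X in _ + X]big1 ?addr0; last first.
  move=> j hj; rewrite big1 // => l _.
  by rewrite tensmxE mxE eq_sym -subr_eq eq_sym (negbTE hj) mul0r mulr0.
rewrite (bigD1 d) //= tensmxE !mxE subrK !eqxx !mulr1 big1 ?addr0 // => l hl.
by rewrite tensmxE !mxE (negbTE hl) !mulr0.
Qed.

Lemma mul_h2 X u k d : (X *m h2) u (pr k d) = X u (pr k (d - 1)) :> C.
Proof.
rewrite mxE sum_tens (bigD1 k) //= [X in _ + X]big1 ?addr0; last first.
  move=> j hj; rewrite big1 // => l _.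
  by rewrite tensmxE !mxE (negbTE hj) mul0r mulr0.
rewrite (bigD1 (d - 1)) //= tensmxE !mxE subrK !eqxx !mulr1 big1 ?addr0 // => l hl.
by rewrite tensmxE !mxE [_ == d]eq_sym -subr_eq eq_sym (negbTE hl) !mulr0.
Qed.

Lemma Rtrig_quasi w x : w != 0 -> Rtrig w (x - w) *m h1 = h1 *m Rtrig w x.
Proof.
move=> w0; apply: tens_ext => a b k d; rewrite mul_h1 h1_mul !RtrigE cotN_shift //.
have -> : (a + b == k - 1 + d) = (a + 1 + b == k + d).
  by rewrite -(inj_eq (addIr 1)); congr (_ == _); ring.
have -> : b - (k - 1) - 1 = b - k by ring.
by have -> : k - 1 - a = k - (a + 1) by ring.
Qed.

Definition unit_cst w x : C := N ^+ 2 * ((sn w 1)^-2 - (sn w x)^-2).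

Lemma cotN_corr_inj w x (u : I -> I) (e : I) : w != 0 -> off_lattice w x -> injective u ->
  \sum_p cotN w x (u p) * cotN w x (u p + e) =
  if e == 0 then N ^+ 2 * (sn w x)^-2 - N else - N.
Proof.
move=> w0 hx iu; rewrite -(reindex_inj iu (P := xpredT) (F := fun m => cotN w x m * cotN w x (m + e))).
case: eqP => [->|/eqP e0]; last exact: cotN_corr.
by under eq_bigr do rewrite addr0 -expr2; rewrite cotN_sqr_sum.
Qed.

(** Expand the product of the two sums of cotangents. The mixed terms cancel after a
translation of the summation index; the two autocorrelations are N and - N off the diagonal, and
sums of squares on it. *)
Lemma Rtrig_unitary w x : w != 0 -> off_lattice w 1 -> off_lattice w x ->
  Rtrig w x *m Rtrig_inv w x = (unit_cst w x)%:M.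
Proof.
move=> w0 h1 hx; apply: tens_ext => a b k d.
rewrite mxE sum_tens [RHS]mxE pr_eq.
under eq_bigr do under eq_bigr do rewrite RtrigE Rtrig_invE.
transitivity ((a + b == k + d)%:R * \sum_p (cotN w x (b - p) + cotN w 1 (p - a)) *
   (cotN w 1 (p - k) - cotN w x (a + b - p - k))).
  rewrite mulr_sumr -(sum_antidiag (a + b) (fun p q => (a + b == k + d)%:R *
    ((cotN w x (b - p) + cotN w 1 (p - a)) * (cotN w 1 (p - k) - cotN w x (q - k))))).
  apply: eq_bigr => p _; apply: eq_bigr => q _.
  case: eqP => [e|_]; last by rewrite !mul0r.
  by rewrite -e !mul1r mulrCA.
have -> : \sum_p (cotN w x (b - p) + cotN w 1 (p - a)) * (cotN w 1 (p - k) - cotN w x (a + b - p - k)) =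
  \sum_p cotN w 1 (p - a) * cotN w 1 (p - a + (a - k)) - \sum_p cotN w x (b - p) * cotN w x (b - p + (a - k))
  + (\sum_p cotN w x (b - p) * cotN w 1 (p - k) - \sum_p cotN w x (a + b - p - k) * cotN w 1 (p - a)).
  rewrite -!sumrB -big_split /=; apply: eq_bigr => p _.
  have -> : p - a + (a - k) = p - k by ring.
  have -> : b - p + (a - k) = a + b - p - k by ring.
  ring.
have -> : \sum_p cotN w x (a + b - p - k) * cotN w 1 (p - a) = \sum_p cotN w x (b - p) * cotN w 1 (p - k).
  rewrite (reindex_inj (addIr (a - k))) /=; apply: eq_bigr => p _.
  have -> : a + b - (p + (a - k)) - k = b - p by ring.
  by have -> : p + (a - k) - a = p - k by ring.
rewrite subrr addr0 !cotN_corr_inj //; first last.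
- by move=> p q /addIr.
- by move=> p q /(addrI b) /oppr_inj.
rewrite subr_eq0; case: (a =P k) => [->|_] /=; last by rewrite subrr mulr0.
rewrite (inj_eq (addrI k)) mulr_natl; congr (_ *+ _).
by rewrite /unit_cst; ring.
Qed.

End TrigMatrices.

(** * The trigonometric R-matrix: crossing *)

Section Crossing.
Variable R : realType.
Notation C := R[i].
Variable n : nat.
Let N : C := n.+2%:R.
Let N0 : N != 0. Proof. by rewrite pnatr_eq0. Qed.
Notation I := 'I_n.+2.
Notation pr a b := (@mxtens_index n.+2 n.+2 (a, b)).
Notation Rtrig := (@Rtrig R n).
Notation Rtrig_inv := (@Rtrig_inv R n).
Notation cotN := (@cotN R n).
Implicit Types (x y w : C) (a b k d p q l : I).

Definition crossing_cst w : C := N ^+ 2 * (sn w 1)^-2.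

Lemma cotN_cross w x m : w != 0 -> off_lattice w 1 -> off_lattice w x -> off_lattice w (x + N) ->
  cotN w (x + N) m * cotN w x m =
  -1 + ccot (cpi R * (1 / w)) * (cotN w x m - cotN w (x + N) m).
Proof.
move=> w0 h1 hx hx'.
have e : cpi R * ((x + N) / (N * w)) + (m : nat)%:R * (cpi R / N) =
   (cpi R * (x / (N * w)) + (m : nat)%:R * (cpi R / N)) + cpi R * (1 / w).
  by move: (cpi R) (N) N0 => p N' N'0; field; rewrite N'0 w0.
rewrite /cotN -/N e; apply: ccot_mul; rewrite -?e.
- exact: cotN_den.
- exact: off_csin.
- exact: cotN_den.
Qed.

(** The left-hand side is an entry of the product of the partial transposes of
[Rtrig_inv w (x + N)] and [Rtrig w x]. Off the diagonal, [cotN_corr] and [cotN_sum] for the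
argument 1 combine with the cotangent formula [cotN_cross], as x -> x + N adds pi / w to the angle. *)
Lemma Rtrig_crossing w x p q a l : w != 0 -> off_lattice w 1 -> off_lattice w x ->
  off_lattice w (x + N) ->
  \sum_k \sum_b Rtrig_inv w (x + N) (pr p b) (pr k q) * Rtrig w x (pr k l) (pr a b) =
  crossing_cst w * ((p == a) && (q == l))%:R.
Proof.
move=> w0 h1 hx hx'.
pose F k : C := (p + l == a + q)%:R * ((cotN w 1 (p - k) - cotN w (x + N) (q - p)) *
  (cotN w x (q - p) + cotN w 1 (a - k))).
transitivity (\sum_k F k).
  apply: eq_bigr => k _; rewrite (bigD1 (k + q - p)) //= big1 ?addr0 => [|b hb].
    rewrite Rtrig_invE RtrigE /F.
    have -> : p + (k + q - p) = k + q by ring.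
    rewrite eqxx mul1r; have -> : k + q - p - k = q - p by ring.
    have -> : (k + l == a + (k + q - p)) = (p + l == a + q).
      by rewrite -(inj_eq (addIr (p - k))); congr (_ == _); ring.
    case: eqP => [e|_]; last by rewrite !mul0r mulr0.
    have -> : l - a = q - p.
      have -> : l - a = (p + l) - p - a by ring.
      by rewrite e; ring.
    by rewrite !mul1r.
  rewrite Rtrig_invE; case: eqP => [e|_]; last by rewrite !mul0r.
  by move/eqP: hb; case; rewrite -e addrAC subrr add0r.
rewrite /F -mulr_sumr.
have -> : \sum_k (cotN w 1 (p - k) - cotN w (x + N) (q - p)) * (cotN w x (q - p) + cotN w 1 (a - k)) =
  (\sum_k cotN w 1 (p - k)) * cotN w x (q - p) + \sum_k cotN w 1 (p - k) * cotN w 1 (p - k + (a - p))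
  - (cotN w (x + N) (q - p) * cotN w x (q - p)) *+ n.+2 - cotN w (x + N) (q - p) * \sum_k cotN w 1 (a - k).
  rewrite mulr_suml mulr_sumr -[X in _ *+ X](card_ord n.+2) -sumr_const -big_split -!sumrB /=.
  apply: eq_bigr => k _; have -> : p - k + (a - p) = a - k by ring.
  ring.
have inj (b : I) : injective (fun k => b - k) by move=> k k' /(addrI b) /oppr_inj.
have s1 b : \sum_k cotN w 1 (b - k) = N * ccot (cpi R * (1 / w)).
  by rewrite -(cotN_sum n w0 h1) [RHS](reindex_inj (inj b)).
rewrite !s1 cotN_corr_inj // cotN_cross // -(mulr_natl _ n.+2) -/N.
rewrite subr_eq0 [a == p]eq_sym /crossing_cst; case: (p =P a) => [->|_] /=.
  by rewrite (inj_eq (addrI a)) [l == q]eq_sym mulrC; congr (_ * _); rewrite -/N; ring.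
by rewrite mulr0 -[RHS](mulr0 (p + l == a + q)%:R); congr (_ * _); rewrite -/N; ring.
Qed.

Lemma Rhat_entries (b r : C) : r != 0 -> off_lattice r 1 ->
  let x := 'i%C * b / cpi R in off_lattice r x ->
  Rhat n b r = (- N^-1 * sn r 1 * Rfactor N r x) *: Rtrig r x.
Proof.
move=> r0 h1 x hx; apply: tens_ext => a e k d.
rewrite /Rhat mxE [RHS]mxE.
have -> : Rmat n b r (pr a e) (pr k d) = (a + e == k + d)%:R * Rcoef b r a e k.
  rewrite /Rmat summxE (bigD1 a) //= [X in _ + X]big1 ?addr0 => [|i hi]; last first.
    rewrite summxE big1 // => j _; rewrite summxE big1 // => l _.
    by rewrite mxE tensmxE mxE eq_sym (negbTE hi) mul0r mulr0.
  rewrite summxE (bigD1 e) //= [X in _ + X]big1 ?addr0 => [|j hj]; last first.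
    rewrite summxE big1 // => l _.
    by rewrite mxE tensmxE !mxE [e == j]eq_sym (negbTE hj) !mulr0.
  rewrite summxE (bigD1 k) //= [X in _ + X]big1 ?addr0 => [|l hl]; last first.
    by rewrite mxE tensmxE !mxE [k == l]eq_sym (negbTE hl) andbF mul0r mulr0.
  rewrite mxE tensmxE !mxE !eqxx mul1r mulrC /=; congr (_%:R * _).
  by rewrite [d == _]eq_sym subr_eq [d + k]addrC.
rewrite RtrigE; case: eqP => [_|_]; last by rewrite !mul0r !mulr0.
rewrite !mul1r.
have p0 := cpi_neq0 R.
have bE : 'i%C * b = cpi R * x by rewrite /x [RHS]mulrC divfK.
have hA : ('i%C * b + ((e : nat)%:R - (k : nat)%:R) * cpi R * r) / (N * r) =
   cpi R * (x / (N * r)) + ((e : nat)%:R - (k : nat)%:R) * (cpi R / N).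
  by rewrite bE; move: (cpi R) (x) (N) N0 => p y N' N'0; field; rewrite N'0 r0.
have hB : (cpi R - ((a : nat)%:R - (k : nat)%:R) * cpi R * r) / (N * r) =
   cpi R * (1 / (N * r)) + ((k : nat)%:R - (a : nat)%:R) * (cpi R / N).
  by move: (cpi R) (N) N0 => p N' N'0; field; rewrite N'0 r0.
have hAB : ('i%C * b + cpi R + ((e : nat)%:R - (a : nat)%:R) * cpi R * r) / (N * r) =
   (cpi R * (x / (N * r)) + ((e : nat)%:R - (k : nat)%:R) * (cpi R / N)) +
   (cpi R * (1 / (N * r)) + ((k : nat)%:R - (a : nat)%:R) * (cpi R / N)).
  by rewrite bE; move: (cpi R) (x) (N) N0 => p y N' N'0; field; rewrite N'0 r0.
have den y (u v : I) : off_lattice r y ->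
   csin (cpi R * (y / (N * r)) + ((u : nat)%:R - (v : nat)%:R) * (cpi R / N)) != 0.
  by move=> hy; have := cotN_den_int n r0 (u%:Z - v%:Z) hy; rewrite rmorphB /= -!pmulrn.
have key : csin (('i%C * b + cpi R + ((e : nat)%:R - (a : nat)%:R) * cpi R * r) / (N * r)) /
    (csin (('i%C * b + ((e : nat)%:R - (k : nat)%:R) * cpi R * r) / (N * r)) *
     csin ((cpi R - ((a : nat)%:R - (k : nat)%:R) * cpi R * r) / (N * r))) =
    cotN r x (e - k) + cotN r 1 (k - a).
  rewrite hAB hA hB (cotN_sub r0 x e k) (cotN_sub r0 1 k a).
  by apply: csin_cot_add; apply: den.
rewrite /Rcoef -/N key.
rewrite /S0 -/x -/N -/(S2_ratio r N x) /Rfactor.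
have -> : csin ((cpi R - 'i%C * b) / N) = sn N (1 - x).
  by rewrite bE /sn; apply: congr1; ring.
have -> : csin ('i%C * b / N) = sn N x by rewrite bE /sn mulrA.
have -> : csin ('i%C * b / r) = sn r x by rewrite bE /sn mulrA.
have -> : csin (cpi R / r) = sn r 1 by rewrite /sn mulrA mulr1.
have -> : csin (('i%C * b + cpi R) / r) = sn r (x + 1).
  by rewrite bE /sn; apply: congr1; ring.
by ring.
Qed.

End Crossing.

(** * Exchange relations in a ring *)

Section RingExchange.
Variable B : pzRingType.
Implicit Types P S V W L K : B.

(** Conjugation on the first tensor factor, by matrices that commute with L2. *)
Lemma exchange_conj1 P P' S S' V V1 L1 L2 : P * L1 * L2 = L2 * L1 * S ->
  V * P = P' * V -> S * V1 = V1 * S' -> V * L2 = L2 * V -> V1 * L2 = L2 * V1 ->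
  P' * (V * L1 * V1) * L2 = L2 * (V * L1 * V1) * S'.
Proof.
move=> h hP hS hV hV1.
have -> : P' * (V * L1 * V1) * L2 = (P' * V) * L1 * (V1 * L2) by rewrite !mulrA.
rewrite -hP hV1.
have -> : V * P * L1 * (L2 * V1) = V * (P * L1 * L2) * V1 by rewrite !mulrA.
rewrite h.
have -> : V * (L2 * L1 * S) * V1 = (V * L2) * L1 * (S * V1) by rewrite !mulrA.
by rewrite hV hS !mulrA.
Qed.

(** Conjugation on the second tensor factor, by matrices that commute with L1. *)
Lemma exchange_conj2 P P' S S' W W1 L1 L2 : P * L1 * L2 = L2 * L1 * S ->
  W * P = P' * W -> S * W1 = W1 * S' -> W * L1 = L1 * W -> W1 * L1 = L1 * W1 ->
  P' * L1 * (W * L2 * W1) = (W * L2 * W1) * L1 * S'.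
Proof.
move=> h hP hS hW hW1.
have -> : P' * L1 * (W * L2 * W1) = P' * (L1 * W) * L2 * W1 by rewrite !mulrA.
rewrite -hW.
have -> : P' * (W * L1) * L2 * W1 = (P' * W) * L1 * L2 * W1 by rewrite !mulrA.
rewrite -hP.
have -> : W * P * L1 * L2 * W1 = W * (P * L1 * L2) * W1 by rewrite !mulrA.
rewrite h.
have -> : W * (L2 * L1 * S) * W1 = W * L2 * L1 * (S * W1) by rewrite !mulrA.
rewrite hS.
have -> : W * L2 * L1 * (W1 * S') = W * L2 * (L1 * W1) * S' by rewrite !mulrA.
by rewrite -hW1 !mulrA.
Qed.

Definition two_sided_inv (X Y : B) := X * Y = 1 /\ Y * X = 1.

(** The relation for (L1, K2) turns the inverse of Pp into that of S, which the one for (L1, L2)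
removes; the relation for (K1, K2) then introduces S, which the one for (K1, L2) turns into Pm. *)
Lemma exchange_ring P0 Pp Pm S L1 L2 K1 K2 P0' Pp' S' L1' L2' :
  two_sided_inv P0 P0' -> two_sided_inv Pp Pp' -> two_sided_inv S S' -> two_sided_inv L1 L1' -> two_sided_inv L2 L2' ->
  P0 * L1 * L2 = L2 * L1 * S -> Pm * K1 * L2 = L2 * K1 * S ->
  Pp * L1 * K2 = K2 * L1 * S -> P0 * K1 * K2 = K2 * K1 * S ->
  K1 * L1' * Pp' * (K2 * L2') = P0' * (K2 * L2') * Pm * (K1 * L1') * P0'.
Proof.
move=> [p1 p2] [q1 q2] [s1 s2] [l1 l2] [m1 m2] e0 e1 e2 e3.
have f2 : L1' * Pp' * K2 = K2 * S' * L1'.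
  have h : K2 = L1' * Pp' * K2 * L1 * S.
    by rewrite -!mulrA (mulrA K2) -e2 -!mulrA (mulrA Pp') q2 mul1r mulrA l2 mul1r.
  rewrite [in RHS]h -(mulrA _ S) s1 mulr1 -(mulrA _ L1) l1 mulr1 //.
have f0 : S' * L1' * L2' = L2' * L1' * P0'.
  have h : S * (L2' * L1' * P0' * L2 * L1) = 1.
    have hS : S = L1' * L2' * P0 * L1 * L2.
      by rewrite -!mulrA (mulrA P0) e0 -!mulrA (mulrA L2') m2 mul1r mulrA l2 mul1r.
    rewrite hS -!mulrA (mulrA L2 L2') m1 mul1r (mulrA L1 L1') l1 mul1r (mulrA P0 P0') p1 mul1r.
    by rewrite (mulrA L2' L2) m2 mul1r.
  have -> : S' = L2' * L1' * P0' * L2 * L1 by rewrite -[LHS]mulr1 -h mulrA s2 mul1r.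
  by rewrite -!mulrA (mulrA L1 L1') l1 mul1r m1 mulr1.
have f1 : K1 * S * L2' = L2' * Pm * K1.
  by rewrite -[LHS]mul1r -m2 -!mulrA (mulrA K1) (mulrA L2) (mulrA L2 K1) -e1 -!mulrA m1 mulr1.
have f3 : K1 * K2 = P0' * K2 * K1 * S.
  by rewrite -[LHS]mul1r -p2 -!mulrA (mulrA P0) e3 !mulrA.
have -> : K1 * L1' * Pp' * (K2 * L2') = K1 * (L1' * Pp' * K2) * L2' by rewrite !mulrA.
have -> : P0' * (K2 * L2') * Pm * (K1 * L1') * P0' = P0' * K2 * (L2' * Pm * K1) * L1' * P0'.
  by rewrite !mulrA.
rewrite f2 -f1.
have -> : K1 * (K2 * S' * L1') * L2' = K1 * K2 * (S' * L1' * L2') by rewrite !mulrA.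
by rewrite f0 f3 !mulrA.
Qed.
End RingExchange.

(** * Matrices acting on one tensor factor *)

Section Legs.
Variable R : realType.
Notation C := R[i].
Variables (n : nat) (A : algType C).
Notation pr a b := (@mxtens_index n.+2 n.+2 (a, b)).
Notation I := 'I_n.+2.
Notation MA := (@mx_alg R A _ _).
Implicit Types (a b k d p q : I) (T : 'M[A]_n.+2) (X : 'M[C]_n.+2).

Lemma mx_algM (m p q : nat) (X : 'M[C]_(m, p)) (Y : 'M[C]_(p, q)) :
  MA (X *m Y) = MA X *m MA Y.
Proof. exact: (map_mxM (GRing.in_alg A)). Qed.

Lemma mx_alg1 (m : nat) : MA (1%:M : 'M[C]_m) = 1%:M.
Proof. exact: (map_mx1 (GRing.in_alg A)). Qed.

Lemma mx_algE (m p : nat) (X : 'M[C]_(m, p)) i j : MA X i j = (X i j)%:A.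
Proof. by rewrite mxE. Qed.

Definition leg1 T : 'M[A]_(n.+2 * n.+2) := T *t 1%:M.
Definition leg2 T : 'M[A]_(n.+2 * n.+2) := 1%:M *t T.

Lemma leg1E T a b k d : leg1 T (pr a b) (pr k d) = T a k *+ (b == d).
Proof. by rewrite tensmxE mxE; case: (b == d); rewrite ?mulr1 ?mulr0. Qed.

Lemma leg2E T a b k d : leg2 T (pr a b) (pr k d) = T b d *+ (a == k).
Proof. by rewrite tensmxE mxE; case: (a == k); rewrite ?mul1r ?mul0r. Qed.

Lemma leg1_mul T (V : 'M[A]_(n.+2 * n.+2)) a b v :
  (leg1 T *m V) (pr a b) v = \sum_p T a p * V (pr p b) v.
Proof.
rewrite mxE sum_tens; apply: eq_bigr => p _.
rewrite (bigD1 b) //= leg1E eqxx big1 ?addr0 // => q hq.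
by rewrite leg1E eq_sym (negbTE hq) mul0r.
Qed.

Lemma leg2_mul T (V : 'M[A]_(n.+2 * n.+2)) a b v :
  (leg2 T *m V) (pr a b) v = \sum_p T b p * V (pr a p) v.
Proof.
rewrite mxE sum_tens (bigD1 a) //= [X in _ + X]big1 ?addr0.
  by apply: eq_bigr => p _; rewrite leg2E eqxx.
by move=> q hq; rewrite big1 // => p _; rewrite leg2E eq_sym (negbTE hq) mul0r.
Qed.

Lemma leg1M T T' : leg1 (T *m T') = leg1 T *m leg1 T'.
Proof.
apply: tens_ext => a b k d; rewrite leg1_mul leg1E mxE -sumrMnl.
by apply: eq_bigr => p _; rewrite leg1E mulrnAr.
Qed.

Lemma leg2M T T' : leg2 (T *m T') = leg2 T *m leg2 T'.
Proof.
apply: tens_ext => a b k d; rewrite leg2_mul leg2E mxE -sumrMnl.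
by apply: eq_bigr => p _; rewrite leg2E mulrnAr.
Qed.

Lemma leg1_1 : leg1 1%:M = 1%:M.
Proof. by apply: tens_ext => a b k d; rewrite leg1E !mxE pr_eq -mulr_natr -natrM mulnb. Qed.

Lemma leg2_1 : leg2 1%:M = 1%:M.
Proof. by apply: tens_ext => a b k d; rewrite leg2E !mxE pr_eq -mulr_natr -natrM mulnb andbC. Qed.

Lemma leg1_inv T T' : is_mxinv T T' -> two_sided_inv (leg1 T) (leg1 T').
Proof. by move=> [h1 h2]; split; rewrite -[_ * _]leg1M ?h1 ?h2 leg1_1. Qed.

Lemma leg2_inv T T' : is_mxinv T T' -> two_sided_inv (leg2 T) (leg2 T').
Proof. by move=> [h1 h2]; split; rewrite -[_ * _]leg2M ?h1 ?h2 leg2_1. Qed.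

Lemma leg1_alg X : MA (X *t 1%:M) = leg1 (MA X).
Proof.
apply: tens_ext => a b k d; rewrite mx_algE tensmxE leg1E mx_algE mxE.
by case: (b == d); rewrite ?mulr1 ?mulr0 ?scale0r.
Qed.

Lemma leg2_alg X : MA (1%:M *t X) = leg2 (MA X).
Proof.
apply: tens_ext => a b k d; rewrite mx_algE tensmxE leg2E mx_algE mxE.
by case: (a == k); rewrite ?mul1r ?mul0r ?scale0r.
Qed.

(** The entries of the algebra do not commute, but scalar entries on one tensor factor commute
with everything on the other one. *)
Lemma leg1_comm X T : leg1 (MA X) *m leg2 T = leg2 T *m leg1 (MA X).
Proof.
apply: tens_ext => a b k d; rewrite leg1_mul leg2_mul.
rewrite (bigD1 k) //= [X in _ + X]big1 ?addr0; last first.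
  by move=> p hp; rewrite leg2E (negbTE hp) mulr0.
rewrite (bigD1 d) //= [X in _ + X]big1 ?addr0; last first.
  by move=> p hp; rewrite leg1E (negbTE hp) mulr0.
by rewrite leg1E leg2E !eqxx mx_algE mulr_algl mulr_algr.
Qed.

Lemma leg2_comm X T : leg2 (MA X) *m leg1 T = leg1 T *m leg2 (MA X).
Proof.
apply: tens_ext => a b k d; rewrite leg1_mul leg2_mul.
rewrite (bigD1 d) //= [X in _ + X]big1 ?addr0; last first.
  by move=> p hp; rewrite leg1E (negbTE hp) mulr0.
rewrite (bigD1 k) //= [X in _ + X]big1 ?addr0; last first.
  by move=> p hp; rewrite leg2E (negbTE hp) mulr0.
by rewrite leg1E leg2E !eqxx mx_algE mulr_algl mulr_algr.
Qed.

Lemma trace_alg_comm (m : nat) (X : 'M[C]_m) (T : 'M[A]_m) :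
  \tr (MA X *m T) = \tr (T *m MA X).
Proof.
rewrite /mxtrace; under eq_bigr do rewrite mxE.
under [RHS]eq_bigr do rewrite mxE.
rewrite exchange_big /=; apply: eq_bigr => i _; apply: eq_bigr => j _.
by rewrite mx_algE mulr_algl mulr_algr.
Qed.

(** The hypothesis says that the partial transposes of Q and W are inverse to each other up to z;
the sum over the two indices contracted between Q and W gives Kronecker symbols that close the two
traces separately. *)
Lemma trace_fuse (Q W : 'M[C]_(n.+2 * n.+2)) (z : C) T T' :
  (forall p q a l, \sum_k \sum_b Q (pr p b) (pr k q) * W (pr k l) (pr a b)
     = z * ((p == a) && (q == l))%:R) ->
  \tr (leg1 T *m MA Q *m leg2 T' *m MA W) = z *: (\tr T * \tr T').
Proof.
move=> h; rewrite -(mulmxA (leg1 T *m _)) -mulmxA /mxtrace sum_tens.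
transitivity (\sum_a \sum_p \sum_q \sum_l
   (\sum_k \sum_b Q (pr p b) (pr k q) * W (pr k l) (pr a b)) *: (T a p * T' q l)).
  apply: eq_bigr => a _.
  under eq_bigr do rewrite leg1_mul.
  rewrite exchange_big /=; apply: eq_bigr => p _.
  transitivity (\sum_b \sum_k \sum_q \sum_l
     (Q (pr p b) (pr k q) * W (pr k l) (pr a b)) *: (T a p * T' q l)).
    apply: eq_bigr => b _; rewrite mxE sum_tens mulr_sumr; apply: eq_bigr => k _.
    rewrite mulr_sumr; apply: eq_bigr => q _; rewrite leg2_mul mx_algE mulr_sumr mulr_sumr.
    apply: eq_bigr => l _; rewrite mx_algE mulr_algl mulr_algr -scalerA.
    by rewrite !scalerAr.
  rewrite exchange_big /=; under eq_bigr do rewrite exchange_big /=.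
  rewrite exchange_big /=; apply: eq_bigr => q _.
  under eq_bigr do rewrite exchange_big /=.
  rewrite exchange_big /=; apply: eq_bigr => l _.
  rewrite scaler_suml; apply: eq_bigr => k _; by rewrite scaler_suml.
rewrite mulr_suml scaler_sumr; apply: eq_bigr => a _.
rewrite (bigD1 a) //= [X in _ + X]big1 ?addr0; last first.
  by move=> p hp; rewrite big1 // => q _; rewrite big1 // => l _; rewrite h (negbTE hp) mulr0 scale0r.
rewrite mulr_sumr scaler_sumr; apply: eq_bigr => q _.
rewrite (bigD1 q) //= [X in _ + X]big1 ?addr0; last first.
  by move=> l hl; rewrite h [q == l]eq_sym (negbTE hl) andbF mulr0 scale0r.
by rewrite h !eqxx mulr1.
Qed.

(** The order of the factors of the algebra is reversed, while the same contraction of Q and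
W appears. *)
Lemma trace_fuse_sym (W Q : 'M[C]_(n.+2 * n.+2)) (z : C) T T' :
  (forall p q a l, \sum_k \sum_b Q (pr p b) (pr k q) * W (pr k l) (pr a b)
     = z * ((p == a) && (q == l))%:R) ->
  \tr (leg2 T' *m MA W *m leg1 T *m MA Q) = z *: (\tr T' * \tr T).
Proof.
move=> h; rewrite -(mulmxA (leg2 T' *m _)) -mulmxA /mxtrace sum_tens exchange_big /=.
transitivity (\sum_b \sum_q \sum_k \sum_p
   (\sum_a \sum_l Q (pr p l) (pr a b) * W (pr a q) (pr k l)) *: (T' b q * T k p)).
  apply: eq_bigr => b _.
  under eq_bigr do rewrite leg2_mul.
  rewrite exchange_big /=; apply: eq_bigr => q _.
  transitivity (\sum_a \sum_k \sum_l \sum_p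
     (Q (pr p l) (pr a b) * W (pr a q) (pr k l)) *: (T' b q * T k p)).
    apply: eq_bigr => a _; rewrite mxE sum_tens mulr_sumr; apply: eq_bigr => k _.
    rewrite mulr_sumr; apply: eq_bigr => l _; rewrite leg1_mul mx_algE mulr_sumr mulr_sumr.
    apply: eq_bigr => p _; rewrite mx_algE mulr_algl mulr_algr mulrC -scalerA.
    by rewrite !scalerAr.
  rewrite exchange_big /=; apply: eq_bigr => k _.
  under eq_bigr do rewrite exchange_big /=.
  rewrite exchange_big /=; apply: eq_bigr => p _.
  rewrite scaler_suml; apply: eq_bigr => a _; by rewrite scaler_suml.
rewrite mulr_suml scaler_sumr; apply: eq_bigr => b _.
rewrite (bigD1 b) //= [X in _ + X]big1 ?addr0; last first.
  move=> q hq; rewrite big1 // => k _; rewrite big1 // => p _.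
  by rewrite h [b == q]eq_sym (negbTE hq) andbF mulr0 scale0r.
rewrite mulr_sumr scaler_sumr; apply: eq_bigr => k _.
rewrite (bigD1 k) //= [X in _ + X]big1 ?addr0; last first.
  by move=> p hp; rewrite h (negbTE hp) mulr0 scale0r.
by rewrite h !eqxx mulr1.
Qed.

End Legs.

(** * Shifts of the argument by multiples of the parameter *)

Section Powers.
Variable R : realType.
Notation C := R[i].
Variable n : nat.
Notation Rtrig := (@Rtrig R n).
Notation h := (hmat R n).
Implicit Types (x w : C) (k l : int).

Definition pow1 k : 'M[C]_(n.+2 * n.+2) := (h ^ k) *t 1%:M.
Definition pow2 k : 'M[C]_(n.+2 * n.+2) := 1%:M *t (h ^ k).

Lemma pow1D k l : pow1 (k + l) = pow1 k *m pow1 l.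
Proof. by rewrite /pow1 exprzDr ?hmat_unit // [RHS]tensmx_mul mulmx1. Qed.

Lemma pow2D k l : pow2 (k + l) = pow2 k *m pow2 l.
Proof. by rewrite /pow2 exprzDr ?hmat_unit // [RHS]tensmx_mul mulmx1. Qed.

Lemma tens11 : (1%:M : 'M[C]_n.+2) *t (1%:M : 'M[C]_n.+2) = 1%:M.
Proof. by apply: tens_ext => a b k d; rewrite tensmxE !mxE pr_eq -natrM mulnb. Qed.

Lemma pow1_0 : pow1 0 = 1%:M. Proof. by rewrite /pow1 expr0z tens11. Qed.
Lemma pow2_0 : pow2 0 = 1%:M. Proof. by rewrite /pow2 expr0z tens11. Qed.

(** Negative exponents follow from the positive ones at a translated argument. *)
Lemma intertwine_pow (m : nat) (F : C -> 'M[C]_m) (V : int -> 'M[C]_m) w :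
  V 0 = 1%:M -> (forall k l, V (k + l) = V k *m V l) ->
  (forall x, V 1 *m F x = F (x - w) *m V 1) ->
  forall k x, V k *m F x = F (x - k%:~R * w) *m V k.
Proof.
move=> V0 VD h1.
have pos (j : nat) x : V j *m F x = F (x - j%:R * w) *m V j.
  elim: j x => [|j IH] x; first by rewrite V0 mul1mx mulmx1 mul0r subr0.
  have -> : Posz j.+1 = 1 + Posz j by rewrite -addn1 PoszD addrC.
  rewrite VD -mulmxA IH mulmxA h1 -mulmxA -natr1.
  by congr (F _ *m _); ring.
have inv k : V k *m V (- k) = 1%:M by rewrite -VD subrr.
case=> j x; first by rewrite pos pmulrn.
have e := pos j.+1 (x + j.+1%:R * w); rewrite addrK in e.
rewrite NegzE rmorphN /= mulNr opprK -pmulrn.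
have h2 : V (- j.+1%:Z) *m V j.+1 = 1%:M by have := inv (- j.+1%:Z); rewrite opprK.
rewrite -[LHS]mulmx1 -(inv j.+1) -mulmxA (mulmxA (F x)) -e mulmxA mulmxA h2 mul1mx //.
Qed.

Lemma Rtrig_pow1 w x k : w != 0 -> pow1 k *m Rtrig w x = Rtrig w (x - k%:~R * w) *m pow1 k.
Proof.
move=> w0; apply: intertwine_pow; [exact: pow1_0|exact: pow1D|] => y.
by rewrite /pow1 expr1z Rtrig_quasi.
Qed.

Lemma Rtrig_quasi2 w x : w != 0 -> Rtrig w (x + w) *m pow2 1 = pow2 1 *m Rtrig w x.
Proof.
move=> w0; rewrite /pow2 expr1z; apply: tens_ext => a b k d; rewrite mul_h2 h2_mul !RtrigE.
have -> : (a + b == k + (d - 1)) = (a + (b + 1) == k + d).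
  by rewrite -(inj_eq (addIr 1)); congr (_ == _); ring.
rewrite -[in cotN w x _](addrK w x) cotN_shift //.
by have -> : b + 1 - k - 1 = b - k by ring.
Qed.

Lemma Rtrig_pow2 w x k : w != 0 -> pow2 k *m Rtrig w x = Rtrig w (x + k%:~R * w) *m pow2 k.
Proof.
move=> w0; have := @intertwine_pow _ (Rtrig w \o -%R) pow2 w pow2_0 pow2D _ k (- x).
rewrite /= opprK opprB [_ - - x]addrC opprK; apply=> y.
by rewrite -Rtrig_quasi2 // opprB addrC.
Qed.

End Powers.

Section NuValue.
Variable R : realType.
Notation C := R[i].
Implicit Types (x w : C).

Lemma csin_mulDB (a b : C) : csin (a + b) * csin (a - b) = csin a ^+ 2 - csin b ^+ 2.
Proof.
rewrite !csinD ccosN csinN; have := ccos2csin2 a; have := ccos2csin2 b.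
move: (csin a) (csin b) (ccos a) (ccos b) => s t u v.
move=> /(canRL (addrK _)) hv /(canRL (addrK _)) hu.
have -> : (s * v + u * t) * (s * v + u * - t) = s ^+ 2 * v ^+ 2 - u ^+ 2 * t ^+ 2 by ring.
by rewrite hv hu; ring.
Qed.

(** Since sin(a)^2 - sin(b)^2 = sin(a + b) sin(a - b). *)
Lemma unit_cst_val n w x : w != 0 -> off_lattice w 1 -> off_lattice3 w x ->
  unit_cst n w x = n.+2%:R ^+ 2 / (sin_ratio w x * sn w 1 ^+ 2).
Proof.
move=> w0 h1 h3; have [s1 s2 s3] := off_lattice3_sn w0 h3; have s4 := sn_neq0 w0 h1.
have e : sn w (x + 1) * sn w (x - 1) = sn w x ^+ 2 - sn w 1 ^+ 2.
  by rewrite -csin_mulDB /sn; congr (csin _ * csin _); ring.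
rewrite /unit_cst /sin_ratio e; move: e (mulf_neq0 s2 s3) => -> .
move: (sn w x) (sn w 1) s1 s4 (n.+2%:R : C) => s t s0 t0 m d0.
by field; rewrite s0 t0 d0.
Qed.

End NuValue.

(** * Exchange of the traces *)

Lemma mulmx1C_scalar (F : fieldType) (m : nat) (X Y : 'M[F]_m) z :
  z != 0 -> X *m Y = z%:M -> Y *m X = z%:M.
Proof.
move=> z0 h; have : (z^-1 *: X) *m Y = 1%:M.
  by rewrite -scalemxAl h scale_scalar_mx mulVf.
move=> /mulmx1C; rewrite -scalemxAr => /(congr1 (fun U => z *: U)).
by rewrite scalerA divff // scale1r => ->; rewrite scale_scalar_mx mulr1.
Qed.

Section Main.
Variable R : realType.
Notation C := R[i].
Variables (n : nat) (r c : C).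
Hypothesis generic_rc : generic_params r c.
Let N : C := n.+2%:R.
Let rs : C := r - c.
Notation Rtrig := (@Rtrig R n).
Notation Rtrig_inv := (@Rtrig_inv R n).
Notation unit_cst := (@unit_cst R n).
Notation h := (hmat R n).
Notation V := (@pow1 R n).
Notation W := (@pow2 R n).
Implicit Types (x y w b u : C).

Let r0 : r != 0 := generic_r_neq0 generic_rc.
Let rs0 : rs != 0 := generic_rc_neq0 generic_rc.

Let off1 : off_lattice r 1.
Proof. by case: generic_rc => _ _ g _ k; rewrite eq_sym. Qed.
Let offs1 : off_lattice rs 1.
Proof. by case: generic_rc => _ _ _ g k; rewrite eq_sym. Qed.

(** The quotient of the scalar factors of the two R-matrices of the defining relation. *)
Definition hratio x : C :=
  (- N^-1 * sn r 1 * Rfactor N r x) / (- N^-1 * sn rs 1 * Rfactor N rs x).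

Let kst_neq0 w : w != 0 -> off_lattice w 1 -> - N^-1 * sn w 1 != 0.
Proof.
move=> w0 h1; apply: mulf_neq0; last exact: sn_neq0.
by rewrite oppr_eq0 invr_eq0 pnatr_eq0.
Qed.

Lemma hratio_neq0 x : generic_pt r c x -> hratio x != 0.
Proof.
move=> g; have G0 := G_neq0 n generic_rc g; have Gs0 := Gs_neq0 n generic_rc g.
rewrite /hratio; apply: mulf_neq0; last apply: invr_neq0.
  by apply: mulf_neq0 => //; exact: kst_neq0.
by apply: mulf_neq0 => //; exact: kst_neq0.
Qed.

Lemma hratio_prod (M : int) x : M%:~R * r = - c - N -> generic_pt r c x ->
  hratio (x + rs) * hratio (x - rs) / hratio x ^+ 2 * (unit_cst r (x + N) / unit_cst r x) =
  \prod_(1 <= k < (Kbound M).+1) (sin_ratio N (x + k%:R * r) / sin_ratio N (x - k%:R * r)).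
Proof.
move=> hM g.
have e := critical_scalar generic_rc hM g.
have s1 := Gs_shift n generic_rc g.
have s2 := Gs_shift n generic_rc (genBrs g); rewrite subrK in s2.
have A1 := A_neq0 n g; have A2 := A_neq0 n (genBrs g).
have B1 := Ar_neq0 generic_rc g; have B2 := Ar_neq0 generic_rc (genDN n g).
have G1 := G_neq0 n generic_rc g; have Gm := Gs_neq0 n generic_rc (genBrs g).
have t1 := sn_neq0 r0 off1.
have k1 := kst_neq0 r0 off1; have k2 := kst_neq0 rs0 offs1.
rewrite !unit_cst_val //; [|exact: gen_off3r|exact/gen_off3r/genDN].
rewrite /hratio -/rs -/N in e s1 s2 A1 A2 B2 Gm *; rewrite s1 s2.
move: (\prod_(1 <= k < _) _) e => P e.
move: (- N^-1 * sn r 1) (- N^-1 * sn rs 1) k1 k2 => a1 a2 k1 k2.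
have N0 : N != 0 by rewrite pnatr_eq0.
move: (N) (Rfactor N r x) (Rfactor N r (x + rs)) (Rfactor N r (x - rs)) (Rfactor N rs (x - rs)) (sin_ratio N x)
  (sin_ratio N (x - rs)) (sin_ratio r (x + N)) (sin_ratio r x) (sn r 1) A1 A2 B1 B2 G1 Gm t1 N0 e =>
  N' g0 gp gm s aa am b1 b2 t A1 A2 B1 B2 G1 Gm t1 N0 e.
have -> : P = gm * gp * (am / aa) * b2 / (g0 ^+ 2 * b1) by rewrite e; field; rewrite G1 B1 B2.
by field; rewrite ?G1 ?B1 ?B2 ?A1 ?A2 ?Gm ?t1 ?N0 ?k1 ?k2.
Qed.

Variables (A : algType C) (L : C -> 'M[A]_n.+2).
Hypothesis hL : is_DYgl r c L.
Notation MA := (@mx_alg R A _ _).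

Lemma mx_alg_scalar (m : nat) (z : C) (T : 'M[A]_m) : MA z%:M *m T = T *m MA z%:M.
Proof.
apply/matrixP => i j; rewrite !mxE (bigD1 i) //= [X in _ + X]big1 ?addr0; last first.
  by move=> k hk; rewrite !mxE eq_sym (negbTE hk) scale0r mul0r.
rewrite (bigD1 j) //= [X in _ = _ + X]big1 ?addr0; last first.
  by move=> k hk; rewrite !mxE (negbTE hk) scale0r mulr0.
by rewrite !mxE !eqxx mulr_algl mulr_algr.
Qed.

Let xof b1 b2 : C := 'i%C * (b1 - b2) / cpi R.

Lemma exchange0 b1 b2 : generic_pt r c (xof b1 b2) ->
  MA (hratio (xof b1 b2) *: Rtrig r (xof b1 b2)) *m leg1 (L b1) *m leg2 (L b2) =
  leg2 (L b2) *m leg1 (L b1) *m MA (Rtrig rs (xof b1 b2)).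
Proof.
move=> g; have [hrel _] := hL; have := hrel b1 b2 g.
rewrite (Rhat_entries n r0 off1 (gen_off_r g)) (Rhat_entries n rs0 offs1 (gen_off_rc g)).
rewrite -/(xof b1 b2) -/N -/rs -/(leg1 (L b1)) -/(leg2 (L b2)).
move: (xof b1 b2) g => x g; rewrite /hratio.
have k2 : - N^-1 * sn rs 1 * Rfactor N rs x != 0.
  by apply: mulf_neq0; [exact: kst_neq0|exact: Gs_neq0].
move: (- N^-1 * sn r 1 * Rfactor N r x) (- N^-1 * sn rs 1 * Rfactor N rs x) k2 => p q q0 e.
have -> : MA ((p / q) *: Rtrig r x) = MA (q^-1)%:M *m MA (p *: Rtrig r x).
  by rewrite -mx_algM mul_scalar_mx scalerA mulrC.
have -> : MA (Rtrig rs x) = MA (q^-1)%:M *m MA (q *: Rtrig rs x).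
  by rewrite -mx_algM mul_scalar_mx scalerA mulVf // scale1r.
move: (leg1 _) (leg2 _) (MA (p *: _)) (MA (q *: _)) e => X Y P S e.
transitivity (MA (q^-1)%:M *m (P *m X *m Y)); first by rewrite !mulmxA.
by rewrite e (mx_alg_scalar _ (Y *m X *m S)) (mx_alg_scalar _ S) !mulmxA.
Qed.

Variable M : int.
Hypothesis critical : M%:~R * r = - c - N.

Let a : C := 'i%C * cpi R * rs.

(** The first factor of t, after a cyclic permutation under the trace. *)
Definition Lbar u : 'M[A]_n.+2 := MA (h ^ (- M - 1)) *m L (u + a) *m MA h.

Let rsE : rs = (M + 1)%:~R * r + N.
Proof. by rewrite rmorphD /= mulrDl critical mul1r /rs; ring. Qed.

Let ii : 'i%C * 'i%C = -1 :> C. Proof. by rewrite -expr2 sqr_i. Qed.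

Let xofDl u1 u2 : xof (u1 + a) u2 = xof u1 u2 - rs.
Proof.
have p0 := cpi_neq0 R; rewrite /xof /a.
have -> : 'i%C * (u1 + 'i%C * cpi R * rs - u2) = 'i%C * (u1 - u2) + 'i%C * 'i%C * (cpi R * rs).
  by move: (cpi R) => p; ring.
by rewrite ii mulrDl mulN1r mulNr [cpi R * _]mulrC mulfK.
Qed.

Let xofDr u1 u2 : xof u1 (u2 + a) = xof u1 u2 + rs.
Proof.
have p0 := cpi_neq0 R; rewrite /xof /a.
have -> : 'i%C * (u1 - (u2 + 'i%C * cpi R * rs)) = 'i%C * (u1 - u2) - 'i%C * 'i%C * (cpi R * rs).
  by move: (cpi R) => p; ring.
by rewrite ii mulrDl mulN1r opprK [cpi R * _]mulrC mulfK.
Qed.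

Let legV u : MA (V (- M - 1)) *m leg1 (L (u + a)) *m MA (V 1) = leg1 (Lbar u).
Proof. by rewrite /pow1 expr1z !leg1_alg -!leg1M. Qed.

Let legW u : MA (W (- M - 1)) *m leg2 (L (u + a)) *m MA (W 1) = leg2 (Lbar u).
Proof. by rewrite /pow2 expr1z !leg2_alg -!leg2M. Qed.

Let Vl k T : MA (V k) *m leg2 T = leg2 T *m MA (V k).
Proof. by rewrite /pow1 leg1_alg leg1_comm. Qed.
Let Wl k T : MA (W k) *m leg1 T = leg1 T *m MA (W k).
Proof. by rewrite /pow2 leg2_alg leg2_comm. Qed.

Let VM z x y : x - (- M - 1)%:~R * r = y ->
  MA (V (- M - 1)) *m MA (z *: Rtrig r x) = MA (z *: Rtrig r y) *m MA (V (- M - 1)).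
Proof. by move=> <-; rewrite -!mx_algM -scalemxAl -scalemxAr Rtrig_pow1. Qed.

Let WM z x y : x + (- M - 1)%:~R * r = y ->
  MA (W (- M - 1)) *m MA (z *: Rtrig r x) = MA (z *: Rtrig r y) *m MA (W (- M - 1)).
Proof. by move=> <-; rewrite -!mx_algM -scalemxAl -scalemxAr Rtrig_pow2. Qed.

Let SV x : MA (Rtrig rs (x - rs)) *m MA (V 1) = MA (V 1) *m MA (Rtrig rs x).
Proof. by have := @Rtrig_pow1 R n rs x 1 rs0; rewrite mul1r -!mx_algM => ->. Qed.

Let SW x : MA (Rtrig rs (x + rs)) *m MA (W 1) = MA (W 1) *m MA (Rtrig rs x).
Proof. by have := @Rtrig_pow2 R n rs x 1 rs0; rewrite mul1r -!mx_algM => ->. Qed.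

Let Mm1 : (- M - 1)%:~R * r = N - rs.
Proof. by rewrite -opprD addrC rmorphN /= mulNr rsE; ring. Qed.

Section Pair.
Variables (u1 u2 : C).
Let x := xof u1 u2.
Hypothesis g : generic_pt r c x.

(** The shift of x by - rs is turned into conjugation on the first factor: by h for the matrix of
parameter rs, by h^(M+1) for the matrix of parameter r, where a shift by - N remains. *)
Lemma exchange1 : MA (hratio (x - rs) *: Rtrig r (x - N)) *m leg1 (Lbar u1) *m leg2 (L u2) =
  leg2 (L u2) *m leg1 (Lbar u1) *m MA (Rtrig rs x).
Proof.
have := @exchange0 (u1 + a) u2; rewrite xofDl -/x => /(_ (genBrs g)) e.
rewrite -legV; apply: (exchange_conj1 e).
- by apply: VM; rewrite Mm1; ring.
- exact: SV.
- exact: Vl.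
- exact: Vl.
Qed.

(** As for [exchange1], on the second tensor factor and with the opposite shifts. *)
Lemma exchange2 : MA (hratio (x + rs) *: Rtrig r (x + N)) *m leg1 (L u1) *m leg2 (Lbar u2) =
  leg2 (Lbar u2) *m leg1 (L u1) *m MA (Rtrig rs x).
Proof.
have := @exchange0 u1 (u2 + a); rewrite xofDr -/x => /(_ (genDrs g)) e.
rewrite -legW; apply: (exchange_conj2 e).
- by apply: WM; rewrite Mm1; ring.
- exact: SW.
- exact: Wl.
- exact: Wl.
Qed.

(** The shifts on the two factors compensate each other. *)
Lemma exchange3 : MA (hratio x *: Rtrig r x) *m leg1 (Lbar u1) *m leg2 (Lbar u2) =
  leg2 (Lbar u2) *m leg1 (Lbar u1) *m MA (Rtrig rs x).
Proof.
have := @exchange0 (u1 + a) (u2 + a); rewrite xofDl xofDr addrK -/x => /(_ g) e.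
have e' : MA (hratio x *: Rtrig r (x + rs - N)) *m leg1 (Lbar u1) *m leg2 (L (u2 + a)) =
  leg2 (L (u2 + a)) *m leg1 (Lbar u1) *m MA (Rtrig rs (x + rs)).
  rewrite -legV; apply: (exchange_conj1 e).
  - by apply: VM; rewrite Mm1; ring.
  - by have := SV (x + rs); rewrite addrK.
  - exact: Vl.
  - exact: Vl.
rewrite -legW; apply: (exchange_conj2 e').
- by apply: WM; rewrite Mm1; ring.
- exact: SW.
- exact: Wl.
- exact: Wl.
Qed.

Let unit_cst_neq0 w y : w != 0 -> off_lattice w 1 -> off_lattice3 w y -> unit_cst w y != 0.
Proof.
move=> w0 o1 h3.
rewrite unit_cst_val //; apply: mulf_neq0; first by rewrite expf_neq0 // pnatr_eq0.
apply/invr_neq0/mulf_neq0; first exact: sin_ratio_neq0.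
exact/expf_neq0/sn_neq0.
Qed.

Let inv_unit w y z : w != 0 -> off_lattice w 1 -> off_lattice3 w y -> z != 0 ->
  two_sided_inv (MA (z *: Rtrig w y)) (MA ((z * unit_cst w y)^-1 *: Rtrig_inv w y)).
Proof.
move=> w0 o1 h3 z0; have hy : off_lattice w y by case: h3.
have nu0 := unit_cst_neq0 w0 o1 h3.
have e : (z *: Rtrig w y) *m ((z * unit_cst w y)^-1 *: Rtrig_inv w y) = 1%:M.
  rewrite -scalemxAl -scalemxAr scalerA Rtrig_unitary // scale_scalar_mx; congr _%:M.
  by move: (unit_cst w y) nu0 => v v0; field; rewrite z0 v0.
by split; rewrite -[_ * _]mx_algM ?e ?(mulmx1C e) mx_alg1.
Qed.

(** Multiply by R(x) on the right and take traces. On the right-hand side cyclicity brings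
R(x)^-1 R(x) R(x)^-1 together, and crossing is used at x on the left and at x - N on the right. *)
Lemma trace_compare (T1 T2 : 'M[A]_n.+2) (kp k0 km : C) :
  leg1 T1 *m MA (kp *: Rtrig_inv r (x + N)) *m leg2 T2 =
  MA (k0 *: Rtrig_inv r x) *m leg2 T2 *m MA (km *: Rtrig r (x - N)) *m leg1 T1 *m MA (k0 *: Rtrig_inv r x) ->
  (kp * crossing_cst n r) *: (\tr T1 * \tr T2) =
  (k0 * unit_cst r x * k0 * km * crossing_cst n r) *: (\tr T2 * \tr T1).
Proof.
move=> key.
have o := gen_off_r g; have oN := gen_off_r (genDN n g); have oB := gen_off_r (genBN n g).
have sc (k : C) (X Y : 'M[C]_(n.+2 * n.+2)) (z : C)
    (h : forall p q a l, \sum_k \sum_b X (mxtens_index (p, b)) (mxtens_index (k, q)) *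
      Y (mxtens_index (k, l)) (mxtens_index (a, b)) = z * ((p == a) && (q == l))%:R) (k' : C) :
   forall p q a l, \sum_j \sum_b (k *: X) (mxtens_index (p, b)) (mxtens_index (j, q)) *
      (k' *: Y) (mxtens_index (j, l)) (mxtens_index (a, b)) = (k * k' * z) * ((p == a) && (q == l))%:R.
  move=> p q a' l; rewrite -mulrA -h mulr_sumr; apply: eq_bigr => j _.
  rewrite mulr_sumr; apply: eq_bigr => b _; rewrite !mxE; ring.
have t1 := trace_fuse T1 T2 (sc kp _ _ _ (fun p q a l => Rtrig_crossing p q a l r0 off1 o oN) 1).
have oBN : off_lattice r (x - N + N) by rewrite subrK.
have t2 := trace_fuse_sym T1 T2
  (sc (k0 * unit_cst r x * k0) _ _ _ (fun p q a l => Rtrig_crossing p q a l r0 off1 oB oBN) km).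
rewrite scale1r mulr1 in t1; rewrite subrK in t2.
have e : (k0 *: Rtrig_inv r x) *m Rtrig r x *m (k0 *: Rtrig_inv r x) = (k0 * unit_cst r x * k0) *: Rtrig_inv r x.
  rewrite -!scalemxAl (mulmx1C_scalar (unit_cst_neq0 r0 off1 (gen_off3r g)) (Rtrig_unitary n r0 off1 o)) -scalemxAr mul_scalar_mx.
  by rewrite !scalerA; congr (_ *: _); ring.
rewrite -t1 -t2 -e.
have -> : leg1 T1 *m MA (kp *: Rtrig_inv r (x + N)) *m leg2 T2 *m MA (Rtrig r x) = MA (k0 *: Rtrig_inv r x) *m
   (leg2 T2 *m MA (km *: Rtrig r (x - N)) *m leg1 T1 *m MA (k0 *: Rtrig_inv r x) *m MA (Rtrig r x)).
  by rewrite key !mulmxA.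
rewrite trace_alg_comm; congr (\tr _).
by rewrite !mx_algM !mulmxA.
Qed.

Lemma trace_exchange Y1 Y2 : is_mxinv (L u1) Y1 -> is_mxinv (L u2) Y2 ->
  \tr (Lbar u1 *m Y1) * \tr (Lbar u2 *m Y2) =
  (hratio (x + rs) * hratio (x - rs) / hratio x ^+ 2 * (unit_cst r (x + N) / unit_cst r x)) *:
  (\tr (Lbar u2 *m Y2) * \tr (Lbar u1 *m Y1)).
Proof.
move=> hY1 hY2.
have o3 := gen_off3r g; have o3N := gen_off3r (genDN n g).
have o3s := gen_off3rc g.
have gp := genDrs g; have gm := genBrs g.
have e0 := @exchange0 u1 u2 g; rewrite -/x in e0.
have i0 := inv_unit r0 off1 o3 (hratio_neq0 g).
have ip := inv_unit r0 off1 o3N (hratio_neq0 gp).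
have := inv_unit rs0 offs1 o3s (oner_neq0 C); rewrite scale1r mul1r => iS.
have := exchange_ring i0 ip iS (leg1_inv hY1) (leg2_inv hY2) e0 exchange1 exchange2 exchange3.
rewrite -[leg2 (Lbar u2) * _]leg2M -[leg1 (Lbar u1) * _]leg1M.
set T1 := Lbar u1 *m Y1; set T2 := Lbar u2 *m Y2.
set Pi := MA (_ *: Rtrig_inv r x); set Q := MA (_ *: Rtrig_inv r (x + N)); set Pm := MA (_ *: Rtrig r (x - N)).
move=> key.
have := trace_compare key.
have z0 := hratio_neq0 g; have zp := hratio_neq0 gp; have n0 := unit_cst_neq0 r0 off1 o3.
have np := unit_cst_neq0 r0 off1 o3N.
have c0 : crossing_cst n r != 0.
  apply: mulf_neq0; first by rewrite expf_neq0 // pnatr_eq0.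
  exact/invr_neq0/expf_neq0/sn_neq0.
move: (\tr T1 * \tr T2) (\tr T2 * \tr T1) => t t'.
move: (hratio x) (hratio (x + rs)) (hratio (x - rs)) (unit_cst r x) (unit_cst r (x + N)) (crossing_cst n r)
  z0 zp n0 np c0 => h0 hp hm v vp z z0 zp n0 np c0 e.
have d0 : (hp * vp)^-1 * z != 0 by rewrite mulf_neq0 // invr_neq0 // mulf_neq0.
apply: (scalerI d0); rewrite e scalerA; congr (_ *: _).
by field; rewrite z0 zp n0 np.
Qed.

End Pair.
End Main.

(** * The quadratic algebra *)

Lemma mxinv_eq (A : pzRingType) (m : nat) (X Y : 'M[A]_m) : is_mxinv X Y -> mxinv X = Y.
Proof.
move=> [h1 h2]; rewrite /mxinv; have : [set Z | is_mxinv X Z] (mxinv X).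
  by apply: (@xgetI _ 0 [set Z | is_mxinv X Z] Y); split.
move=> [h3 h4]; rewrite -/(mxinv X).
by rewrite -[LHS]mul1mx -h2 -mulmxA h3 mulmx1.
Qed.

Lemma mxtrace_trmx_mul (A : pzRingType) (m : nat) (X Y : 'M[A]_m) :
  \tr (X^T *m Y^T) = \tr (X *m Y).
Proof.
rewrite /mxtrace; under eq_bigr do rewrite mxE.
under [RHS]eq_bigr do rewrite mxE.
by rewrite exchange_big /=; apply: eq_bigr => i _; apply: eq_bigr => j _; rewrite !mxE.
Qed.

(** The powers of h at both ends are gathered by cyclicity of the trace. *)
Lemma tM_trace (R : realType) (n : nat) (r c : R[i]) (M : int) (A : algType R[i])
    (L : R[i] -> 'M[A]_n.+2) (b : R[i]) (Y : 'M[A]_n.+2) :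
  let u := b - 'i%C * cpi R * r in
  is_mxinv (L u) Y -> tM r c M L b = \tr (Lbar r c L M u *m Y).
Proof.
move=> u hY.
have hi : mx_alg A (hmat R n) *m mx_alg A (hmat R n)^-1 = 1%:M.
  by rewrite -mx_algM mulmxV ?mx_alg1 // hmat_unit.
have hi' : mx_alg A (hmat R n)^-1 *m mx_alg A (hmat R n) = 1%:M.
  by rewrite -mx_algM mulVmx ?mx_alg1 // hmat_unit.
have inv : is_mxinv (Lminus r L b) (mx_alg A (hmat R n) *m Y *m mx_alg A (hmat R n)^-1).
  have [y1 y2] := hY; rewrite /Lminus -/u.
  split; rewrite -!mulmxA (mulmxA (mx_alg A _^-1)) hi' mul1mx.
    by rewrite (mulmxA (L u)) y1 mul1mx.
  by rewrite (mulmxA Y) y2 mul1mx.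
rewrite /tM /LM /Lminus_tilde (mxinv_eq inv) mxtrace_trmx_mul /Lplus.
rewrite mulmxA -trace_alg_comm; congr (\tr _).
have -> : b - 2^-1 * 'i%C * cpi R * c - 2^-1 * 'i%C * cpi R * c = u + 'i%C * cpi R * (r - c).
  by rewrite /u; move: (cpi R) => p; field.
rewrite /Lbar exprzDr ?hmat_unit // exprN1 -!mulmxA.
have -> : hmat R n ^ (- M) * (hmat R n)^-1 = (hmat R n)^-1 *m hmat R n ^ (- M).
  by rewrite -exprN1 -[LHS]exprzDr ?hmat_unit // addrC exprzDr ?hmat_unit.
by rewrite mx_algM -!mulmxA.
Qed.

Theorem theorem3 (R : realType) (n : nat) (r c : R[i]) (M : int)
    (generic_rc : generic_params r c)
    (critical : M%:~R * r = - c - n.+2%:R)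
    (A : algType R[i]) (L : R[i] -> 'M[A]_n.+2) (hL : is_DYsl r c L)
    (b1 b2 : R[i]) (generic_b : generic_spec r c (b1 - b2)) :
  tM r c M L b1 * tM r c M L b2
  = Yfun n r M (b2 - b1) *: (tM r c M L b2 * tM r c M L b1).
Proof.
have [hgl _] := hL; have [_ linv] := hgl.
pose u b : R[i] := b - 'i%C * cpi R * r.
have [Y1 hY1] := linv (u b1); have [Y2 hY2] := linv (u b2).
rewrite (tM_trace c M hY1) (tM_trace c M hY2).
have du : u b1 - u b2 = b1 - b2 by rewrite /u; ring.
have g : generic_pt r c ('i%C * (u b1 - u b2) / cpi R) by rewrite du.
rewrite (trace_exchange generic_rc hgl critical g hY1 hY2).
by rewrite (hratio_prod generic_rc critical g) -[b2 - b1]opprB Yfun_sin_ratio du.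
Qed.
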